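(* Let $a>0$, $\lambda\in\mathbb{R}$ with $4\lambda+a\ge0$, and $0\le\beta<\lambda+a/2$. Then for all $f\in\mathcal{S}(\mathbb{R}_+)$ Pitt's inequality $$\bigl\|\rho^{-\beta}H_{\lambda,a}(f)(\rho)\bigr\|_{2,d\nu_{\lambda,a}}\le c(\beta,\lambda,a)\,\bigl\|r^{\beta}f(r)\bigr\|_{2,d\nu_{\lambda,a}}$$ holds, and the constant $$c(\beta,\lambda,a)=a^{-2\beta/a}\,\frac{\Gamma\bigl(a^{-1}(\lambda+a/2-\beta)\bigr)}{\Gamma\bigl(a^{-1}(\lambda+a/2+\beta)\bigr)}$$ is sharp, i.e. it cannot be replaced by any smaller constant.
   Context: $\mathbb{R}_+=[0,\infty)$. $\mathcal{S}(\mathbb{R}_+)$ is the Schwartz space on $\mathbb{R}_+$ (restrictions to $[0,\infty)$ of complex-valued Schwartz functions on $\mathbb{R}$). For a Bessel function $J_\mu$ of the first kind, the normalized Bessel function is $j_\mu(t)=2^\mu\Gamma(\mu+1)t^{-\mu}J_\mu(t)$, so $j_\mu(0)=1$. For $a>0$, define the measure $d\nu_{\lambda,a}(r)=b_{\lambda,a}r^{2\lambda+a-1}\,dr$ on $\mathbb{R}_+$, where $b_{\lambda,a}^{-1}=\int_0^\infty e^{-t^a/a}t^{2\lambda+a-1}\,dt=a^{2\lambda/a}\Gamma(2\lambda/a+1)$, and $\|f\|_{2,d\nu_{\lambda,a}}=\bigl(\int_{\mathbb{R}_+}|f(r)|^2\,d\nu_{\lambda,a}(r)\bigr)^{1/2}$.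 The $a$-deformed Hankel transform (for $4\lambda+a\ge0$) is $$H_{\lambda,a}(f)(\rho)=\int_{\mathbb{R}_+}f(r)\,j_{2\lambda/a}\Bigl(\frac2a(\rho r)^{a/2}\Bigr)\,d\nu_{\lambda,a}(r).$$ *)

(* Defs.v *)
From HB Require Import structures.
From mathcomp Require Import all_boot all_order all_algebra.
From mathcomp Require Import all_classical all_reals all_analysis.
From mathcomp Require Import measurable_realfun complex.

Set Implicit Arguments.
Unset Strict Implicit.
Unset Printing Implicit Defensive.

Import Order.TTheory GRing.Theory Num.Theory.
Import numFieldNormedType.Exports.

Local Open Scope classical_set_scope.
Local Open Scope ring_scope.
Local Open Scope complex_scope.

(* Euler's integral: this is the Gamma function for x > 0 only, which covers
   every argument occurring below when 0 < a, 0 <= 4 * lam + a and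
   0 <= beta < lam + a / 2. *)
Definition Gamma {R : realType} (x : R) : R :=
  \int[lebesgue_measure]_(t in `]0, +oo[) (t `^ (x - 1) * expR (- t)).

(* Bessel function of the first kind, for real order mu > -1 and t > 0. *)
Definition BesselJ {R : realType} (mu t : R) : R :=
  limn (series (fun k : nat =>
    (-1) ^+ k / (k`!%:R * Gamma (k%:R + mu + 1))
      * (t / 2) `^ (2 * k%:R + mu))).

(* The formula for t != 0 extends continuously by 1 at the origin, whereas
   powR and division by zero would produce a junk value there. *)
Definition normalized_bessel {R : realType} (mu t : R) : R :=
  if t == 0 then 1
  else 2 `^ mu * Gamma (mu + 1) * t `^ (- mu) * BesselJ mu t.

Definition nu_const {R : realType} (lam a : R) : R :=
  (\int[lebesgue_measure]_(t in `[0, +oo[)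
     (expR (- (t `^ a / a)) * t `^ (2 * lam + a - 1)))^-1.

(* The measure is put on the whole line, carried by [0, +oo[. *)
Definition nu {R : realType} (lam a : R) (A : set (measurableTypeR R)) :
    \bar R :=
  (\int[lebesgue_measure]_(r in A `&` `[0%R, +oo[)
     (nu_const lam a * r `^ (2 * lam + a - 1))%:E)%E.

Section nu_measure.
Context {R : realType} (lam a : R).

Lemma nu_const_ge0 : 0 <= nu_const lam a.
Proof.
rewrite invr_ge0; apply: Rintegral_ge0 => t _.
by rewrite mulr_ge0 ?expR_ge0 ?powR_ge0.
Qed.

Lemma measurable_nu_density : measurable_fun [set: R]
  (fun r : R => (nu_const lam a * r `^ (2 * lam + a - 1))%:E).
Proof.
apply/measurable_EFinP; apply: measurable_funM => //; exact: measurable_powR.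
Qed.

Let nu0 : nu lam a set0 = 0%E.
Proof. by rewrite /nu set0I integral_set0. Qed.

Let nu_ge0 A : (0 <= nu lam a A)%E.
Proof.
by apply: integral_ge0 => r _; rewrite lee_fin mulr_ge0 ?nu_const_ge0 ?powR_ge0.
Qed.

Let nu_sigma_additive : semi_sigma_additive (nu lam a).
Proof.
move=> /= F mF tF mUF; apply: cvg_toP.
  apply: ereal_nondecreasing_is_cvgn => m n mn.
  by apply: lee_sum_nneg_natr => // k _ _; exact: nu_ge0.
rewrite /nu setI_bigcupl ge0_integral_bigcup//=.
- by move=> k; apply: measurableI; [exact: mF|exact: measurable_itv].
- exact: measurable_funS measurableT (@subsetT _ _) measurable_nu_density.
- by move=> r _; rewrite lee_fin mulr_ge0 ?nu_const_ge0 ?powR_ge0.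
- apply: trivIset_setIr; exact: tF.
Qed.

HB.instance Definition _ := isMeasure.Build _ _ _
  (nu lam a) nu0 nu_ge0 nu_sigma_additive.

End nu_measure.

Definition L2norm_nu {R : realType} (lam a : R) (f : R -> R[i]) : \bar R :=
  Lnorm (nu lam a) 2%:E (fun r => (Normc.normc (f r))%:E).

Definition hankel {R : realType} (lam a : R) (f : R -> R[i]) : R -> R[i] :=
  fun rho =>
    let K (r : R) :=
      normalized_bessel (2 * lam / a) (2 / a * (rho * r) `^ (a / 2)) in
    (\int[nu lam a]_(r in `[0, +oo[) (complex.Re (f r) * K r))
    +i* (\int[nu lam a]_(r in `[0, +oo[) (complex.Im (f r) * K r)).

Definition smooth {R : realType} (u : R -> R) : Prop :=
  forall (n : nat) (x : R), derivable (u^`(n))%classic x 1.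

(* Derivatives of complex-valued functions are taken componentwise. *)
Definition cderiven {R : realType} (n : nat) (g : R -> R[i]) : R -> R[i] :=
  fun x => (fun y => complex.Re (g y))^`(n)%classic x
           +i* (fun y => complex.Im (g y))^`(n)%classic x.

Definition schwartz {R : realType} (g : R -> R[i]) : Prop :=
  [/\ smooth (fun x => complex.Re (g x)),
      smooth (fun x => complex.Im (g x)) &
      forall k n : nat, exists M : R, forall x : R,
        `|x| ^+ k * Normc.normc (cderiven n g x) <= M].

(* Values of f at negative arguments are irrelevant: f stands for its
   restriction to [0, +oo[. *)
Definition schwartz_halfline {R : realType} (f : R -> R[i]) : Prop :=
  exists2 g : R -> R[i], schwartz g & forall r : R, 0 <= r -> f r = g r.

Definition pitt_const {R : realType} (beta lam a : R) : R :=
  a `^ (- (2 * beta / a)) * (Gamma (a^-1 * (lam + a / 2 - beta))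
                             / Gamma (a^-1 * (lam + a / 2 + beta))).

Definition pitt_ineq {R : realType} (beta lam a C : R) (f : R -> R[i]) : Prop :=
  (L2norm_nu lam a (fun rho => ((rho `^ (- beta))%:C * hankel lam a f rho)%R)
   <= C%:E * L2norm_nu lam a (fun r => ((r `^ beta)%:C * f r)%R))%E.

(* Main.v *)
Require Import Defs.
From HB Require Import structures.
From mathcomp Require Import all_boot all_order all_algebra.
From mathcomp Require Import all_classical all_reals all_analysis.
From mathcomp Require Import measurable_realfun complex ring lra.
Set Implicit Arguments.
Unset Strict Implicit.
Unset Printing Implicit Defensive.
Import Order.TTheory GRing.Theory Num.Theory.
Import numFieldNormedType.Exports.
Local Open Scope classical_set_scope.
Local Open Scope ring_scope.

(** Put X(r) = r^a / a, c = 2 lam / a + 1 >= 1/2 and b = beta / a. The kernel of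
    the transform is J(X(rho) X(r)) with J(z) = 0F1(; c; -z), and nu enters only
    through the moments of X, namely
    int X^p exp(- t X) dnu = Gamma(c + p) / Gamma(c) t^(-(c + p)); this is what
    [bessel_measure] records. As rho^(-beta) = (a X)^(-b), the claim is that the
    best constant in | X^(-b) F | <= K | X^b f |, for F the transform of f, is
    K = Gamma(c/2 - b) / Gamma(c/2 + b); real and imaginary parts are treated
    separately.

    Upper bound. Integrating power series term by term shows that the transform
    of exp(- t X) is t^(-c) exp(- X / t) ([bessel_gauss]), and that
    int exp(- t X) J(x X) J(y X) dnu is the heat kernel
    h_t(x, y) = t^(-c) exp(- (x + y) / t) 0F1(; c; x y / t^2) ([bessel_heat]),
    which is positive because the coefficients of 0F1 are. Hence
    int exp(- t X) F^2 is a quadratic form in f with a positive symmetric kernel,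
    and Schur's test with a weight phi bounds it by int (f^2 / phi) h_t phi
    ([heat_schur]). Now X^(-2 b) is a superposition of the exponentials
    exp(- t X), so that int X^(-2 b) F^2 is an average over t of such forms. For
    phi = X^(-(c/2 + b)) the resulting integral of h_t phi over t is an explicit
    combination of gamma and beta integrals ([schur_integral]), and it gives
    exactly K^2 ([pitt_upper]). The bound |J| <= 1 for c >= 1/2, used to exchange
    integrals, follows from a decreasing energy ([jcliff_bound]).

    Sharpness. Nearly extremal functions are X^(-p) exp(- X / 2) with
    p = c/2 + b - dl. Their transform is paired with (1 + X)^(-(c/2 + b + dl)),
    a superposition of Gaussians whose transforms are explicit. The pairing is
    bounded below by a direct computation ([test_pairing_lower]) and above by the
    Cauchy-Schwarz inequality with the weights X^b and X^(-b)
    ([test_pairing_upper]). All quantities grow like Gamma(2 dl) as dl tends to 0,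
    and comparing the leading coefficients gives K ([pitt_lower]). These functions
    are increasing limits of Schwartz functions, obtained by replacing r^2 with
    r^2 + 1/n ([schwartz_reg_span], [reg_test_sequence]). *)

(** * Power substitutions in integrals over the half-line *)

Section Substitution.
Context {R : realType}.
Local Notation mu := (@lebesgue_measure R).
Implicit Types (g : R -> R) (k a x t : R).

Lemma continuous_pos_measurable g :
  (forall x, 0 < x -> {for x, continuous g}) -> measurable_fun `](0:R), +oo[ g.
Proof.
move=> cg; apply: open_continuous_measurable_fun; first exact: interval_open.
by move=> x; rewrite inE/= in_itv/= andbT; exact: cg.
Qed.

Lemma bigcup_itv_pos (F : R -> R) : (forall x, 0 < x -> 0 < F x) ->
  {in `]0, +oo[ &, {homo F : x y / x < y}} ->
  F x @[x --> 0^'+] --> 0 -> F x @[x --> +oo] --> +oo ->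
  \bigcup_n `[F (n.+1%:R^-1), F n.+1%:R]%classic = `](0:R), +oo[%classic.
Proof.
move=> F0 Fi F0l Fl; apply/seteqP; split => x /=.
  move=> [n _] /=; rewrite in_itv/= => /andP[+ _]; rewrite in_itv/= andbT.
  by apply: lt_le_trans; apply: F0; rewrite invr_gt0.
rewrite in_itv/= andbT => x0.
have [d /= d0 Hd] : \forall e \near 0^'+, F e < x by apply: cvgr_lt F0l _ _.
have [M [Mr HM]] : \forall e \near +oo, x < F e by move/cvgryPgt : Fl; apply.
pose N := (Num.truncn (Num.max d^-1 (Num.max M 0))).+1.
have NM : Num.max d^-1 (Num.max M 0) < N%:R by rewrite truncnS_gt.
have [Nd NMx] : d^-1 < N%:R /\ M < N%:R.
  by split; apply: le_lt_trans NM; rewrite !le_max lexx ?orbT.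
exists N.-1 => //=; rewrite in_itv/=; apply/andP; split; last exact/ltW/HM.
apply/ltW/Hd => /=; last by rewrite invr_gt0 ltr0n.
rewrite sub0r normrN gtr0_norm ?invr_gt0 ?ltr0n//.
by rewrite invf_plt ?posrE ?ltr0n.
Qed.

Lemma itv_inv_nondecreasing (F : R -> R) :
  {in `]0, +oo[ &, {homo F : x y / x < y}} ->
  nondecreasing_seq (fun n => `[F (n.+1%:R^-1), F n.+1%:R]%classic).
Proof.
move=> Fi; have Fw x y : 0 < x -> x <= y -> F x <= F y.
  move=> x0; rewrite le_eqVlt => /predU1P[->//|xy]; apply/ltW/Fi => //.
    by rewrite in_itv/= x0.
  by rewrite in_itv/= (lt_trans x0).
move=> m n mn; rewrite subsetEset => x /=; rewrite !in_itv/= => /andP[h1 h2].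
apply/andP; split; [apply: le_trans h1|apply: (le_trans h2)]; apply: Fw => //.
  by rewrite lef_pV2 ?posrE// ler_nat.
by rewrite ler_nat.
Qed.

Lemma powR_cvgy a : 0 < a -> x `^ a @[x --> +oo] --> (+oo : set_system R).
Proof.
move=> a0; apply/cvgryPge => A.
near=> x.
have x0 : 0 < x by near: x; exact: nbhs_pinfty_gt.
have xA : (Num.max A 0) `^ a^-1 <= x by near: x; apply: nbhs_pinfty_ge; rewrite num_real.
have mA : 0 <= Num.max A 0 by rewrite le_max lexx orbT.
apply: (@le_trans _ _ (((Num.max A 0) `^ a^-1) `^ a)).
  by rewrite -powRrM mulVf ?gt_eqF// powRr1// le_max lexx.
by apply: ge0_ler_powR; rewrite ?nnegrE ?powR_ge0 ?ltW//.
Unshelve. all: by end_near. Qed.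

(** The substitution rule on compact intervals, with the half-line exhausted by
    [1/n, n] on one side and by its image on the other. *)
Lemma ge0_integral_subst_powR g k a : 0 < k -> 0 < a ->
  (forall x, 0 < x -> {for x, continuous g}) ->
  (forall x, 0 < x -> 0 <= g x) ->
  (\int[mu]_(x in `]0%R, +oo[) (g x)%:E =
   \int[mu]_(r in `]0%R, +oo[) (g (k * r `^ a) * (k * a * r `^ (a - 1)))%:E)%E.
Proof.
move=> k0 a0 cg g0; pose F r := k * r `^ a.
have F0 x : 0 < x -> 0 < F x by move=> x0; rewrite mulr_gt0// powR_gt0.
have Fi : {in `]0, +oo[ &, {homo F : x y / x < y}}.
  move=> x y; rewrite !in_itv/= !andbT => x0 y0 xy.
  by rewrite ltr_pM2l// gt0_ltr_powR// ?nnegrE ltW.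
have Fl0 : F x @[x --> 0^'+] --> 0.
  rewrite -[X in _ --> X](mulr0 k); apply: cvgM; first exact: cvg_cst.
  exact: powR_cvg0.
have Fly : F x @[x --> +oo] --> +oo.
  by apply: gt0_cvgMry => //; exact: powR_cvgy.
have dF x : 0 < x -> is_derive x 1 F (k * (a * x `^ (a - 1))).
  move=> x0; have := is_derive1_powR a x0 => ?.
  exact: is_deriveZ.
have cpow b x : 0 < x -> {for x, continuous (fun r => r `^ b)}.
  move=> x0; apply: differentiable_continuous; apply/derivable1_diffP.
  by have [] := is_derive1_powR b x0.
have dFE x : 0 < x -> derive1 F x = k * a * x `^ (a - 1).
  by move=> x0; rewrite derive1E; have [_ ->] := dF _ x0; rewrite mulrA.
have cF' x : 0 < x -> derive1 F y @[y --> x] --> derive1 F x.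
  move=> x0; rewrite [X in _ --> X]dFE//.
  have : (fun r => k * a * r `^ (a - 1)) @ x --> k * a * x `^ (a - 1).
    by apply: cvgM; [exact: cvg_cst|exact: cpow].
  apply: cvg_trans; apply: near_eq_cvg.
  by near=> y; rewrite /= dFE//; near: y; exact: lt_nbhsr.
have cFF x : 0 < x -> {for x, continuous F}.
  by move=> x0; apply: differentiable_continuous; apply/derivable1_diffP; have [] := dF _ x0.
have cgF x : 0 < x -> {for x, continuous (fun r => g (F r) * (k * a * r `^ (a - 1)))}.
  move=> x0; apply: cvgM.
    by apply: (@continuous_comp _ _ _ F g); [exact: cFF|exact/cg/F0].
  by apply: cvgM; [exact: cvg_cst|exact: cpow].
have pn n : 0 < n.+1%:R^-1 :> R by rewrite invr_gt0.
have ln n : n.+1%:R^-1 <= n.+1%:R :> R.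
  by rewrite (@le_trans _ _ 1) ?ler1n// invf_le1 ?ler1n.
pose G1 n := `[F n.+1%:R^-1, F n.+1%:R]%classic.
pose G2 n := `[(n.+1%:R^-1 : R), n.+1%:R]%classic.
have step n : (\int[mu]_(x in G1 n) (g x)%:E =
   \int[mu]_(r in G2 n) (g (k * r `^ a) * (k * a * r `^ (a - 1)))%:E)%E.
  have pos x : x \in `[n.+1%:R^-1, n.+1%:R] -> 0 < x.
    by rewrite in_itv/= => /andP[+ _]; apply: lt_le_trans.
  rewrite /G1 /G2 (@integration_by_substitution_increasing _ F g)//.
  - apply: eq_integral => x; rewrite inE/= => /pos x0.
    by rewrite /= fctE dFE.
  - by move=> x y /pos x0 /pos y0; apply: Fi; rewrite in_itv/= ?x0 ?y0.
  - by move=> x /subset_itv_oo_cc/pos; exact: cF'.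
  - by apply/cvg_ex; eexists; apply: cvg_at_right_filter; exact: (cF' _ (pn n)).
  - by apply/cvg_ex; eexists; apply: cvg_at_left_filter; exact: cF'.
  - split; first by move=> x /subset_itv_oo_cc/pos x0; have [] := dF _ x0.
      by apply: cvg_at_right_filter; exact: (cFF _ (pn n)).
    by apply: cvg_at_left_filter; exact: cFF.
  - apply: continuous_in_subspaceT => x; rewrite inE/= in_itv/= => /andP[+ _].
    move=> h; apply: cg; apply: lt_le_trans h; exact/F0.
have U1 : \bigcup_n G1 n = `](0:R), +oo[%classic by exact: bigcup_itv_pos.
have U2 : \bigcup_n G2 n = `](0:R), +oo[%classic.
  apply: (@bigcup_itv_pos id) => //.
  by apply: cvg_at_right_filter; exact: cvg_id.
have nd1 : nondecreasing_seq G1 by exact: itv_inv_nondecreasing.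
have nd2 : nondecreasing_seq G2 by apply: (@itv_inv_nondecreasing id).
have s1 n : G1 n `<=` `]0, +oo[%classic by rewrite -U1; exact: bigcup_sup.
have s2 n : G2 n `<=` `]0, +oo[%classic by rewrite -U2; exact: bigcup_sup.
have m1 : measurable_fun `](0:R), +oo[ (EFin \o g).
  by apply/measurable_EFinP; exact: continuous_pos_measurable.
have m2 : measurable_fun `](0:R), +oo[ (fun r => (g (k * r `^ a) * (k * a * r `^ (a - 1)))%:E).
  by apply/measurable_EFinP; exact: continuous_pos_measurable cgF.
rewrite -[in LHS]U1 -[in RHS]U2.
have C1 : (\int[mu]_(x in G1 i) (g x)%:E @[i --> \oo] -->
    \int[mu]_(x in \bigcup_i G1 i) (g x)%:E)%E.
  apply: ge0_nondecreasing_set_cvg_integral => //.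
  - by move=> n; exact: measurable_itv.
  - by move=> n; apply: measurable_funS m1.
  - by move=> n x /s1 /=; rewrite in_itv/= andbT lee_fin; exact: g0.
have C2 : (\int[mu]_(x in G2 i) (g (k * x `^ a) * (k * a * x `^ (a - 1)))%:E @[i --> \oo] -->
    \int[mu]_(x in \bigcup_i G2 i) (g (k * x `^ a) * (k * a * x `^ (a - 1)))%:E)%E.
  apply: ge0_nondecreasing_set_cvg_integral => //.
  - by move=> n; exact: measurable_itv.
  - by move=> n; apply: measurable_funS m2.
  - move=> n x /s2 /=; rewrite in_itv/= andbT lee_fin => x0.
    rewrite !mulr_ge0 ?powR_ge0 ?(ltW k0) ?(ltW a0)//; exact/g0/F0.
rewrite -(cvg_lim _ C1)// -(cvg_lim _ C2)//.
by congr (limn _); apply/funext => n; exact: step.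
Unshelve. all: by end_near. Qed.

End Substitution.

(** * Measurability and Tonelli's theorem *)

Section MeasurableFunctions.
Context d (T : measurableType d) (R : realType).
Implicit Types (D : set T) (f g : T -> R).

(** Closure properties of measurable functions in pointwise form, which a purely
    syntactic tactic can apply. *)
Lemma mfunD D f g : measurable_fun D f -> measurable_fun D g ->
  measurable_fun D (fun x => f x + g x).
Proof. exact: measurable_funD. Qed.

Lemma mfunM D f g : measurable_fun D f -> measurable_fun D g ->
  measurable_fun D (fun x => f x * g x).
Proof. exact: measurable_funM. Qed.

Lemma mfunN D f : measurable_fun D f -> measurable_fun D (fun x => - f x).
Proof. exact: measurable_funN. Qed.

Lemma mfunX D f n : measurable_fun D f -> measurable_fun D (fun x => f x ^+ n).
Proof. exact: measurable_funX. Qed.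

Lemma mfun_expR D f : measurable_fun D f -> measurable_fun D (fun x => expR (f x)).
Proof. by move=> mf; exact: measurableT_comp (@measurable_expR R) mf. Qed.

Lemma mfun_powR D f p : measurable_fun D f -> measurable_fun D (fun x => f x `^ p).
Proof. by move=> mf; exact: (@measurableT_comp _ _ _ _ _ _ (fun y : R => y `^ p) _ f (@measurable_powR R p) mf). Qed.

Lemma mfunV D f : measurable_fun D f -> (forall x, 0 <= f x) ->
  measurable_fun D (fun x => (f x)^-1).
Proof.
move=> mf f0; under eq_fun do rewrite -powR_inv1//.
exact: mfun_powR.
Qed.

Lemma mfun_normr D f : measurable_fun D f -> measurable_fun D (fun x => `|f x|).
Proof. by move=> mf; exact: measurableT_comp. Qed.

Lemma mfun_EFin D f : measurable_fun D f -> measurable_fun D (fun x => (f x)%:E).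
Proof. by move=> mf; apply/measurable_EFinP. Qed.

End MeasurableFunctions.

Lemma mfun_fst d1 d2 (T1 : measurableType d1) (T2 : measurableType d2) (R : realType)
  (D : set (T1 * T2)) (f : T1 -> R) :
  measurable_fun setT f -> measurable_fun D (fun z => f z.1).
Proof.
move=> mf; apply: measurable_funTS.
exact: (@measurableT_comp _ _ _ _ _ _ f _ (@fst T1 T2) mf measurable_fst).
Qed.

Lemma mfun_snd d1 d2 (T1 : measurableType d1) (T2 : measurableType d2) (R : realType)
  (D : set (T1 * T2)) (f : T2 -> R) :
  measurable_fun setT f -> measurable_fun D (fun z => f z.2).
Proof.
move=> mf; apply: measurable_funTS.
exact: (@measurableT_comp _ _ _ _ _ _ f _ (@snd T1 T2) mf measurable_snd).
Qed.

Lemma mfun_section1 d1 d2 (T1 : measurableType d1) (T2 : measurableType d2) (R : realType)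
  (f : T1 -> T2 -> R) x :
  measurable_fun setT (fun z => f z.1 z.2) -> measurable_fun setT (f x).
Proof.
move=> mf.
exact: (@measurableT_comp _ _ _ _ _ _ (fun z => f z.1 z.2) setT (pair x) mf (pair1_measurable x)).
Qed.

Lemma mfun_swap d1 d2 (T1 : measurableType d1) (T2 : measurableType d2) (R : realType)
  (f : T1 -> T2 -> R) :
  measurable_fun setT (fun z => f z.1 z.2) -> measurable_fun setT (fun z => f z.2 z.1).
Proof.
move=> mf.
have ms : measurable_fun setT (fun z : T2 * T1 => (z.2, z.1)) by exact: measurable_swap.
exact: (@measurableT_comp _ _ _ _ _ _ (fun z : T1 * T2 => f z.1 z.2) _ _ mf ms).
Qed.

Ltac mfun := intros; cbv beta; repeat first
  [ assumption | exact: measurable_cst | exact: measurable_id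
  | exact: measurable_fst | exact: measurable_snd
  | apply: mfun_EFin | apply: mfunD | apply: mfunM | apply: mfunN
  | apply: mfun_expR | apply: mfun_powR | apply: mfunX | apply: mfun_normr
  | apply: mfun_fst | apply: mfun_snd ].

Section Tonelli.
Local Open Scope ereal_scope.
Context d1 d2 (T1 : measurableType d1) (T2 : measurableType d2) (R : realType).
Variable m1 : {sigma_finite_measure set T1 -> \bar R}.
Variable m2 : {sigma_finite_measure set T2 -> \bar R}.

Lemma ge0_eintegral_swap (D1 : set T1) (D2 : set T2) (f : T1 -> T2 -> \bar R) :
  measurable D1 -> measurable D2 ->
  measurable_fun setT (fun z : T1 * T2 => f z.1 z.2) ->
  (forall x y, 0 <= f x y) ->
  \int[m1]_(x in D1) \int[m2]_(y in D2) f x y =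
  \int[m2]_(y in D2) \int[m1]_(x in D1) f x y.
Proof.
move=> mD1 mD2 mf f0.
pose g := (fun z : T1 * T2 => f z.1 z.2) \_ (D1 `*` D2).
have mg : measurable_fun setT g.
  apply/(measurable_restrictT _ (measurableX mD1 mD2)).
  exact: measurable_funS measurableT (@subsetT _ _) mf.
have g0 z : 0 <= g z by apply: erestrict_ge0 => y _.
have gE x y : g (x, y) = if (x \in D1) && (y \in D2) then f x y else 0.
  by rewrite /g /patch in_setX.
have H := fubini_tonelli (m1 := m1) (m2 := m2) g mg g0.
rewrite [LHS]integral_mkcond [RHS]integral_mkcond.
have -> : (fun x => \int[m2]_(y in D2) f x y) \_ D1 =
   (fun x => \int[m2]_y g (x, y)).
  apply/funext => x; rewrite /patch; case: ifPn => xD; last first.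
    by rewrite integral0_eq// => y _; rewrite gE (negbTE xD).
  rewrite integral_mkcond; apply: eq_integral => y _.
  by rewrite gE xD /patch.
have -> // : (fun y => \int[m1]_(x in D1) f x y) \_ D2 =
   (fun y => \int[m1]_x g (x, y)).
apply/funext => y; rewrite /patch; case: ifPn => yD; last first.
  by rewrite integral0_eq// => x _; rewrite gE (negbTE yD) andbF.
rewrite integral_mkcond; apply: eq_integral => x _.
by rewrite gE yD andbT /patch.
Qed.

Lemma ge0_integral_swap (D1 : set T1) (D2 : set T2) (f : T1 -> T2 -> R) :
  measurable D1 -> measurable D2 ->
  measurable_fun setT (fun z : T1 * T2 => f z.1 z.2) ->
  (forall x y, 0 <= f x y)%R ->
  \int[m1]_(x in D1) \int[m2]_(y in D2) (f x y)%:E =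
  \int[m2]_(y in D2) \int[m1]_(x in D1) (f x y)%:E.
Proof.
move=> mD1 mD2 mf f0; apply: (@ge0_eintegral_swap D1 D2 (fun x y => (f x y)%:E)) => //.
exact: mfun_EFin.
Qed.

Lemma measurable_ge0_integral2 (D2 : set T2) (f : T1 -> T2 -> R) :
  measurable D2 ->
  measurable_fun setT (fun z : T1 * T2 => f z.1 z.2) ->
  (forall x y, 0 <= f x y)%R ->
  measurable_fun setT (fun x => \int[m2]_(y in D2) (f x y)%:E).
Proof.
move=> mD2 mf f0.
pose g := (fun z : T1 * T2 => (f z.1 z.2)%:E) \_ (setT `*` D2).
have mg : measurable_fun setT g.
  apply/(measurable_restrictT _ (measurableX measurableT mD2)).
  by apply: measurable_funS (measurableT) _ _ => //; exact/measurable_EFinP.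
have g0 z : 0 <= g z by apply: erestrict_ge0 => y _; rewrite lee_fin.
have := measurable_fun_fubini_tonelli_F (m2 := m2) g mg g0.
congr (measurable_fun _ _); apply/funext => x; rewrite /fubini_F [RHS]integral_mkcond.
by apply: eq_integral => y _; rewrite /g /patch in_setX in_setT.
Qed.

Lemma ge0_integral2D (f g : T1 -> T2 -> R) :
  measurable_fun setT (fun z : T1 * T2 => f z.1 z.2) ->
  measurable_fun setT (fun z : T1 * T2 => g z.1 z.2) ->
  (forall x y, 0 <= f x y)%R -> (forall x y, 0 <= g x y)%R ->
  \int[m1]_x \int[m2]_y (f x y + g x y)%:E =
  \int[m1]_x \int[m2]_y (f x y)%:E + \int[m1]_x \int[m2]_y (g x y)%:E.
Proof.
move=> mf mg f0 g0.
have mf1 x : measurable_fun setT (f x) by exact: mfun_section1.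
have mg1 x : measurable_fun setT (g x) by exact: mfun_section1.
under eq_integral => x _.
  under eq_integral do rewrite EFinD.
  rewrite ge0_integralD//=; last 4 first.
  - by move=> y _; rewrite lee_fin.
  - exact: mfun_EFin.
  - by move=> y _; rewrite lee_fin.
  - exact: mfun_EFin.
  over.
rewrite ge0_integralD//=.
- by move=> x _; apply: integral_ge0 => y _; rewrite lee_fin.
- exact: measurable_ge0_integral2.
- by move=> x _; apply: integral_ge0 => y _; rewrite lee_fin.
- exact: measurable_ge0_integral2.
Qed.

End Tonelli.

(** If |f| is not integrable the right side is infinite. *)
Lemma abs_Rintegral_le d (T : measurableType d) (R : realType)
    (m : {measure set T -> \bar R}) (f : T -> R) : measurable_fun setT f ->
  (`|\int[m]_x f x|%:E <= \int[m]_x `|f x|%:E)%E.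
Proof.
move=> mf.
have := @le_abse_integral _ _ _ m setT (EFin \o f) measurableT.
move=> /(_ (mfun_EFin mf)); apply: le_trans; rewrite /Rintegral.
by case: (\int[m]_x _)%E => [r| |] //=; rewrite normr0 leey.
Qed.

(** * The Gamma function *)

Section GammaFunction.
Context {R : realType}.
Local Notation mu := (@lebesgue_measure R).
Implicit Types (p z t x : R).

Lemma cvg_expRNy k : 0 < k -> expR (- (k * x)) @[x --> +oo] --> (0 : R).
Proof.
move=> k0.
have h : (- (k * x)) @[x --> +oo] --> (-oo : set_system R).
  by apply/cvgNrNy/gt0_cvgMry => //; exact: cvg_id.
apply: (cvg_comp _ _ h).
exact/cvgNy_compNP/cvgr_expR.
Qed.

Lemma integral_expR_tail t : 0 < t ->
  (\int[mu]_(z in `[1%R, +oo[) (t * expR (- (z * t)))%:E = (expR (- t))%:E)%E.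
Proof.
move=> t0.
have dF x : is_derive x 1 (fun z => - expR (- (t * z))) (t * expR (- (t * x))).
  apply: is_derive_eq; rewrite /GRing.scale/= mulr1; ring.
have cF x : {for x, continuous (fun z => - expR (- (t * z)))}.
  by apply: differentiable_continuous; apply/derivable1_diffP; have [] := dF x.
rewrite (@ge0_continuous_FTC2y _ _ (fun z => - expR (- (t * z))) 1 0).
- by rewrite mulr1 sub0e EFinN oppeK.
- by move=> x _; rewrite mulr_ge0 ?expR_ge0 ?ltW.
- apply: continuous_in_subspaceT => x _.
  apply: (@continuousM _ _ (cst t) (fun z => expR (- (z * t)))); first exact: cvg_cst.
  apply: continuous_comp; last exact: continuous_expR.
  by apply: continuousN; apply: mulrr_continuous.
- by rewrite -oppr0; apply: cvgN; exact: cvg_expRNy.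
- by move=> x _; have [] := dF x.
- by apply: cvg_at_right_filter; exact: cF.
- by move=> x _; rewrite derive1E; have [_ ->] := dF x; rewrite (mulrC x).
Qed.

Lemma integral_powR_tail p : 0 < p ->
  (\int[mu]_(z in `[1%R, +oo[) (z `^ (- p - 1))%:E = (p^-1)%:E)%E.
Proof.
move=> p0.
have dF x : 0 < x -> is_derive x 1 (fun z => - (p^-1 * z `^ (- p))) (x `^ (- p - 1)).
  move=> x0; have ? := is_derive1_powR (- p) x0.
  apply: is_derive_eq; rewrite /GRing.scale/=; field; lra.
have cpow b x : 0 < x -> {for x, continuous (fun r => r `^ b)}.
  move=> x0; apply: differentiable_continuous; apply/derivable1_diffP.
  by have [] := is_derive1_powR b x0.
have cF x : 0 < x -> {for x, continuous (fun z => - (p^-1 * z `^ (- p)))}.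
  by move=> /dF[? _]; apply: differentiable_continuous; apply/derivable1_diffP.
rewrite (@ge0_continuous_FTC2y _ _ (fun z => - (p^-1 * z `^ (- p))) 1 0).
- by rewrite powR1 mulr1 sub0e EFinN oppeK.
- by move=> x _; rewrite powR_ge0.
- apply: continuous_in_subspaceT => x; rewrite inE/= in_itv/= andbT => x1.
  by apply: cpow; exact: lt_le_trans x1.
- rewrite -[X in _ --> X]oppr0 -[X in _ --> - X](mulr0 p^-1); apply: cvgN.
  apply: cvgM; first exact: cvg_cst.
  have -> : (fun x => x `^ (- p)) = (fun x => (x `^ p)^-1).
    by apply/funext => x; rewrite powRN.
  apply: (gtr0_cvgV0 _).2; last exact: powR_cvgy.
  by near=> x; rewrite powR_gt0//; near: x; exact: nbhs_pinfty_gt.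
- by move=> x x1; have [] := dF x (lt_trans ltr01 x1).
- by apply: cvg_at_right_filter; exact: cF.
- move=> x; rewrite in_itv/= andbT => x1; rewrite derive1E.
  by have [_ ->] := dF x (lt_trans ltr01 x1).
Unshelve. all: by end_near. Qed.

Definition gamma_density p t := t `^ (p - 1) * expR (- t).

Lemma gamma_density_ge0 p t : 0 <= gamma_density p t.
Proof. by rewrite mulr_ge0 ?powR_ge0 ?expR_ge0. Qed.

Lemma powR_continuous p x : 0 < x -> {for x, continuous (fun r => r `^ p)}.
Proof.
move=> x0; apply: differentiable_continuous; apply/derivable1_diffP.
by have [] := is_derive1_powR p x0.
Qed.

Lemma gamma_density_continuous p x : 0 < x -> {for x, continuous (gamma_density p)}.
Proof.
move=> x0; apply: continuousM; first exact: powR_continuous.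
apply: continuous_comp; last exact: continuous_expR.
by apply: continuousN; exact: cvg_id.
Qed.

(** The substitution t = s^(1/p) removes the singularity at the origin. *)
Lemma gamma_integral_root p : 0 < p ->
  (\int[mu]_(t in `]0%R, +oo[) (gamma_density p t)%:E =
   \int[mu]_(s in `]0%R, +oo[) (p^-1 * expR (- (s `^ p^-1)))%:E)%E.
Proof.
move=> p0; rewrite (@ge0_integral_subst_powR _ _ 1 p^-1)// ?invr_gt0//; last first.
- by move=> x _; exact: gamma_density_ge0.
- by move=> x; exact: gamma_density_continuous.
apply: eq_integral => s; rewrite inE/= in_itv/= andbT => s0; congr EFin.
rewrite /gamma_density !mul1r -powRrM.
rewrite (_ : s `^ (p^-1 * (p - 1)) = (s `^ (p^-1 - 1))^-1); last first.
  by rewrite -powRN; congr (_ `^ _); field; lra.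
by field; rewrite !gt_eqF ?powR_gt0.
Qed.

Lemma expRN_root_le p s : 0 < p -> 1 <= s ->
  expR (- (s `^ p^-1)) <= ((Num.truncn (p *+ 2)).+1)`!%:R * s `^ (- 1 - 1).
Proof.
move=> p0 s1; set n := Num.truncn _.
have s0 : 0 < s by exact: lt_le_trans s1.
have h : s `^ 2 <= (s `^ p^-1) ^+ n.+1.
  rewrite -powR_mulrn ?powR_ge0// -powRrM; apply: ler_powR => //.
  rewrite mulrC ler_pdivlMr// mulrC mulr_natr; apply/ltW; exact: truncnS_gt.
have h2 := expR_ge1Dxn n (powR_ge0 s p^-1).
have f0 : 0 < n.+1`!%:R :> R by rewrite ltr0n fact_gt0.
rewrite (_ : -1 - 1 = - 2 :> R); last by ring.
rewrite expRN powRN ler_pdivlMr ?powR_gt0// mulrC ler_pdivrMr ?expR_gt0//.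
apply: (le_trans h); rewrite mulrC -ler_pdivrMr//.
by apply: le_trans h2; rewrite lerDr.
Qed.

Lemma gamma_integral_lty p : 0 < p ->
  (\int[mu]_(t in `]0%R, +oo[) (gamma_density p t)%:E < +oo)%E.
Proof.
move=> p0; rewrite gamma_integral_root//.
have ms (D : set R) : measurable_fun D (fun s => (p^-1 * expR (- (s `^ p^-1)))%:E).
  by mfun.
have s_ge0 s : (0 <= (p^-1 * expR (- (s `^ p^-1)))%:E)%E.
  by rewrite lee_fin mulr_ge0 ?expR_ge0 ?invr_ge0 ?ltW.
rewrite (_ : `]0%R, +oo[%classic = `](0 : R), 1[ `|` `[1, +oo[); last first.
  by rewrite -itv_bndbnd_setU//= !bnd_simp.
rewrite ge0_integral_setU//=; last first.
  apply/disj_setPS => x [] /=; rewrite !in_itv/= andbT => /andP[_ h1] h2.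
  by move: (lt_le_trans h1 h2); rewrite ltxx.
  exact: ms.
rewrite lte_add_pinfty//.
  apply: (@le_lt_trans _ _ (\int[mu]_(s in `]0%R, 1%R[) (p^-1)%:E)%E).
    apply: ge0_le_integral => //.
      exact: ms.
    move=> s _; rewrite lee_fin ler_piMr ?invr_ge0 ?(ltW p0)//.
    by rewrite expR_le1 oppr_le0 powR_ge0.
  by rewrite integral_cst//= lebesgue_measure_itv/= lte01 -EFinD -EFinM ltry.
apply: (@le_lt_trans _ _ (\int[mu]_(s in `[1%R, +oo[)
    ((p^-1 * (Num.truncn (p *+ 2)).+1`!%:R)%:E * (s `^ (- 1 - 1))%:E))%E).
  apply: ge0_le_integral => //=.
  - exact: ms.
  - apply: measurable_funeM; apply/measurable_EFinP; apply: measurable_funTS.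
    exact: measurable_powR.
  move=> s; rewrite in_itv/= andbT => s1; rewrite -EFinM lee_fin -mulrA.
  by rewrite ler_pM2l ?invr_gt0// expRN_root_le.
rewrite ge0_integralZl//=.
- by rewrite integral_powR_tail// -EFinM ltry.
- by apply/measurable_EFinP; apply: measurable_funTS; exact: measurable_powR.
- by move=> s _; rewrite lee_fin powR_ge0.
- by rewrite lee_fin mulr_ge0// invr_ge0 ltW.
Qed.

Lemma GammaE p : 0 < p ->
  (\int[mu]_(t in `]0%R, +oo[) (gamma_density p t)%:E = (Gamma p)%:E)%E.
Proof.
move=> p0; rewrite /Gamma /Rintegral fineK// ge0_fin_numE ?gamma_integral_lty//.
by apply: integral_ge0 => t _; rewrite lee_fin gamma_density_ge0.
Qed.

Lemma Gamma_gt0 p : 0 < p -> 0 < Gamma p.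
Proof.
move=> p0; have e0 : 0 < p^-1 * expR (- 1) by rewrite mulr_gt0 ?expR_gt0 ?invr_gt0.
apply: (lt_le_trans e0); rewrite -lee_fin -GammaE// gamma_integral_root//.
have ms (D : set R) : measurable_fun D (fun s => (p^-1 * expR (- (s `^ p^-1)))%:E).
  by mfun.
apply: (@le_trans _ _ (\int[mu]_(s in `]0%R, 1%R[) (p^-1 * expR (- 1))%:E)%E).
  by rewrite integral_cst//= lebesgue_measure_itv/= lte01 oppr0 adde0 mule1.
apply: (@le_trans _ _ (\int[mu]_(s in `]0%R, 1%R[) (p^-1 * expR (- (s `^ p^-1)))%:E)%E).
  apply: ge0_le_integral => //=.
  - by move=> s _; rewrite lee_fin mulr_ge0 ?expR_ge0 ?invr_ge0 ?ltW.
  - exact: ms.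
  - move=> s; rewrite in_itv/= => /andP[s0 s1].
    rewrite lee_fin ler_pM2l ?invr_gt0// ler_expR lerN2.
    rewrite (_ : 1 = 1 `^ p^-1); last by rewrite powR1.
    by apply: ge0_ler_powR; rewrite ?nnegrE ?invr_ge0 ?ltW.
apply: ge0_subset_integral => //=.
- exact: ms.
- by move=> s _; rewrite lee_fin mulr_ge0 ?expR_ge0 ?invr_ge0 ?ltW.
- by move=> s /=; rewrite !in_itv/= andbT => /andP[].
Qed.

Lemma gamma_integral_scale p z : 0 < p -> 0 < z ->
  (\int[mu]_(t in `]0%R, +oo[) (t `^ (p - 1) * expR (- (z * t)))%:E =
   (Gamma p * z `^ (- p))%:E)%E.
Proof.
move=> p0 z0; rewrite EFinM -GammaE// (@ge0_integral_subst_powR _ (gamma_density p) z 1)//; last first.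
- by move=> x _; exact: gamma_density_ge0.
- by move=> x; exact: gamma_density_continuous.
rewrite muleC -ge0_integralZl//=.
- apply: eq_integral => t; rewrite inE/= in_itv/= andbT => t0.
  rewrite -EFinM; congr EFin.
  rewrite /gamma_density powRr1 ?(ltW t0)// subrr powRr0 !mulr1 powRM ?ltW//.
  rewrite powRN.
  rewrite -[z in X in _ = _ * (_ * X)](powRr1 (ltW z0)) -[in RHS]mulrA -mulrA.
  have -> : z `^ p = z `^ (p - 1) * z `^ 1.
    by rewrite -powRD ?subrK// gt_eqF ?implybT.
  by field; rewrite !gt_eqF ?powR_gt0.
- by rewrite /gamma_density; mfun.
- by move=> t _; rewrite lee_fin !mulr_ge0 ?powR_ge0 ?expR_ge0 ?ltW.
- by rewrite lee_fin powR_ge0.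
Qed.

(** Integrate t^p exp(- z t) over t > 0 and z >= 1 in both orders: the integral
    in z is t^(p - 1) exp(- t), the one in t is Gamma(p + 1) z^(- p - 1). *)
Lemma GammaS p : 0 < p -> Gamma (p + 1) = p * Gamma p.
Proof.
move=> p0.
have p10 : 0 < p + 1 by lra.
apply: (@mulIf _ p^-1); first by rewrite invr_eq0 gt_eqF.
rewrite mulrAC mulfV ?gt_eqF// mul1r; apply: EFin_inj.
rewrite -[RHS]GammaE// EFinM -integral_powR_tail//.
transitivity (\int[mu]_(t in `]0%R, +oo[) \int[mu]_(z in `[1%R, +oo[)
  (t `^ (p + 1 - 1) * expR (- (z * t)))%:E)%E; last first.
  apply: eq_integral => t; rewrite inE/= in_itv/= andbT => t0.
  rewrite /gamma_density EFinM -integral_expR_tail// -ge0_integralZl//=.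
  - apply: eq_integral => z _; rewrite -EFinM; congr EFin.
    rewrite mulrA; congr (_ * _).
    by rewrite mulrC mulr_powRB1 ?(ltW t0)// addrK.
  - apply/measurable_EFinP; apply: measurable_funTS.
    apply: measurable_funM => //; apply: measurableT_comp => //.
    by apply: measurableT_comp => //; exact: mulrr_measurable.
  - by move=> z _; rewrite lee_fin mulr_ge0 ?expR_ge0 ?ltW.
  - by rewrite lee_fin powR_ge0.
rewrite ge0_integral_swap//; last 2 first.
- by mfun.
- by move=> x y; rewrite mulr_ge0 ?powR_ge0 ?expR_ge0.
rewrite -ge0_integralZl//=.
- apply: eq_integral => z; rewrite inE/= in_itv/= andbT => z1.
  rewrite gamma_integral_scale//; last exact: lt_le_trans z1.
  by rewrite opprD.
- by apply/measurable_EFinP; apply: measurable_funTS; exact: measurable_powR.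
- by move=> z _; rewrite lee_fin powR_ge0.
- by rewrite lee_fin ltW// Gamma_gt0.
Qed.

End GammaFunction.

(** Gamma as an opaque symbol, used only through the lemmas that follow. *)
HB.lock Definition sGamma {R : realType} (x : R) : R := Gamma x.

Section SealedGamma.
Context {R : realType}.
Local Notation mu := (@lebesgue_measure R).
Implicit Types (p z : R).

Lemma sGammaE p : sGamma p = Gamma p. Proof. by rewrite sGamma.unlock. Qed.

Lemma sGamma_gt0 p : 0 < p -> 0 < sGamma p.
Proof. by rewrite sGammaE; exact: Gamma_gt0. Qed.

Lemma sGamma_integral p : 0 < p ->
  (\int[mu]_(t in `]0%R, +oo[) (gamma_density p t)%:E = (sGamma p)%:E)%E.
Proof. by rewrite sGammaE; exact: GammaE. Qed.

Lemma sGamma_integral_scale p z : 0 < p -> 0 < z ->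
  (\int[mu]_(t in `]0%R, +oo[) (t `^ (p - 1) * expR (- (z * t)))%:E =
   (sGamma p * z `^ (- p))%:E)%E.
Proof. by rewrite sGammaE; exact: gamma_integral_scale. Qed.

Lemma sGammaS p : 0 < p -> sGamma (p + 1) = p * sGamma p.
Proof. by rewrite !sGammaE; exact: GammaS. Qed.

End SealedGamma.

(** * Monotone limits, null sets and densities *)

Lemma ge0_monotone_cvg d (T : measurableType d) (R : realType)
    (m : {measure set T -> \bar R}) (D : set T) (g_ : nat -> T -> \bar R) (g : T -> \bar R) :
  measurable D -> (forall n, measurable_fun D (g_ n)) ->
  (forall n x, D x -> (0 <= g_ n x)%E) ->
  (forall x, D x -> {homo g_^~ x : n k / (n <= k)%N >-> (n <= k)%E}) ->
  (forall x, D x -> (g_ n x @[n --> \oo] --> g x)%E) ->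
  (\int[m]_(x in D) g_ n x @[n --> \oo] --> \int[m]_(x in D) g x)%E.
Proof.
move=> mD mg g0 nd gc.
have -> : (\int[m]_(x in D) g x = \int[m]_(x in D) limn (g_^~ x))%E.
  by apply: eq_integral => x /[!inE] Dx; apply/esym/cvg_lim => //; exact: gc.
exact: cvg_monotone_convergence.
Qed.

Section GeneralMeasure.
Context d (T : measurableType d) (R : realType).
Import HBNNSimple.
Local Open Scope ereal_scope.

(** A simple function below f may be set to 0 on N. This covers functions that
    are arbitrary, even not measurable, on N. *)
Lemma le_integral_null (m : {measure set T -> \bar R}) (N : set T) (f g : T -> \bar R) :
  measurable N -> m N = 0 -> (forall x, 0 <= f x) -> (forall x, 0 <= g x) ->
  (forall x, ~ N x -> f x <= g x) -> \int[m]_x f x <= \int[m]_x g x.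
Proof.
move=> mN N0 f0 g0 fg; have mNC : measurable (~` N) by exact: measurableC.
rewrite !ge0_integralTE//; apply: ge_ereal_sup => _ [h /= hf <-].
apply: ereal_sup_ubound; exists (proj_nnsfun h mNC) => /=.
  move=> x; rewrite /= mindicE; have [Nx|Nx] := boolP (x \in ~` N).
    by rewrite mulr1; apply: (le_trans (hf x)); apply: fg; rewrite inE in Nx.
  by rewrite mulr0.
rewrite -!integralT_nnsfun; apply: ae_eq_integral => //.
- by apply/measurable_EFinP.
- by apply/measurable_EFinP.
exists N; split => //= x /= /not_implyP[_ h1]; apply: contrapT => Nx; apply: h1.
by rewrite mindicE mem_set// mulr1.
Qed.

Lemma eq_integral_null (m : {measure set T -> \bar R}) (N : set T) (f g : T -> \bar R) :
  measurable N -> m N = 0 -> (forall x, ~ N x -> f x = g x) ->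
  \int[m]_x f x = \int[m]_x g x.
Proof.
move=> mN N0 fg; rewrite integralE [RHS]integralE; congr (_ - _).
  apply/eqP; rewrite eq_le; apply/andP.
  by split; apply: (le_integral_null mN N0) => // x /fg h; rewrite unlock h.
apply/eqP; rewrite eq_le; apply/andP.
by split; apply: (le_integral_null mN N0) => // x /fg h; rewrite unlock h.
Qed.

Lemma ge0_integral_density (m m' : {measure set T -> \bar R}) (D : set T) (h g : T -> R) :
  measurable D -> measurable_fun setT h -> (forall x, 0 <= h x)%R ->
  (forall A, measurable A -> m' A = \int[m]_(x in A `&` D) (h x)%:E) ->
  measurable_fun setT g -> (forall x, 0 <= g x)%R ->
  \int[m']_x (g x)%:E = \int[m]_(x in D) (g x * h x)%:E.
Proof.
move=> mD mh h0 m'E mg g0.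
have simple (s : {nnsfun T >-> R}) : \int[m']_x (s x)%:E = \int[m]_(x in D) (s x * h x)%:E.
  transitivity (\int[m]_(x in D) \sum_(r \in range s) (r * \1_(s @^-1` [set r]) x * h x)%:E).
    rewrite ge0_integral_fsum//; last 2 first.
    - move=> r; apply: mfun_EFin; apply: mfunM; last exact: measurable_funTS.
      by apply: mfunM; [exact: measurable_cst|exact: measurable_funTS].
    - move=> r x _; rewrite lee_fin mulr_ge0//.
      by have := nnfun_muleindic_ge0 s r x; rewrite -EFinM lee_fin.
    rewrite integralT_nnsfun sintegralE; apply: eq_fsbigr => r /[!inE] -[x _ <-].
    rewrite m'E//.
    transitivity (\int[m]_(y in D) ((s x)%:E * ((h y)%:E * (\1_(s @^-1` [set s x]) y)%:E))); last first.
      by apply: eq_integral => y _; rewrite -!EFinM; congr EFin; rewrite (mulrC (h y)) mulrA.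
    rewrite ge0_integralZl//; last 3 first.
    - apply: emeasurable_funM; first by apply: mfun_EFin; exact: measurable_funTS.
      by apply: mfun_EFin; exact: measurable_funTS.
    - by move=> y _; rewrite mule_ge0// lee_fin.
    - by rewrite lee_fin.
    congr (_ * _); rewrite setIC integral_mkcondr; apply: eq_integral => y _.
    by rewrite epatch_indic.
  apply: eq_integral => x _; rewrite [in RHS]fimfunE.
  rewrite fsbig_finite//= sumEFin -big_distrl/= -fsbig_finite//.
have mg' : measurable_fun setT (EFin \o g) by exact: mfun_EFin.
pose s := nnsfun_approx measurableT mg'.
have sc x : (s n x)%:E @[n --> \oo] --> (g x)%:E.
  by apply: (cvg_nnsfun_approx measurableT mg') => // y _; rewrite lee_fin.
have snd x : {homo s^~ x : n k / (n <= k)%N >-> (n <= k)%R}.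
  by move=> n k nk; exact/lefP/nd_nnsfun_approx.
have h1 : \int[m']_x (s n x)%:E @[n --> \oo] --> \int[m']_x (g x)%:E.
  apply: ge0_monotone_cvg => //.
  - by move=> n; apply/measurable_EFinP.
  - by move=> n x _; rewrite lee_fin.
  - by move=> x _ n k nk; rewrite lee_fin snd.
have h2 : \int[m]_(x in D) (s n x * h x)%:E @[n --> \oo] --> \int[m]_(x in D) (g x * h x)%:E.
  apply: ge0_monotone_cvg => //.
  - by move=> n; apply: mfun_EFin; apply: mfunM; exact: measurable_funTS.
  - by move=> n x _; rewrite lee_fin mulr_ge0.
  - by move=> x _ n k nk; rewrite lee_fin ler_wpM2r// snd.
  - move=> x _; under eq_fun do rewrite EFinM; rewrite EFinM.
    by apply: cvgeZr => //; exact: sc.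
have e : (fun n => \int[m']_x (s n x)%:E) = (fun n => \int[m]_(x in D) (s n x * h x)%:E).
  by apply/funext => n; exact: simple.
by rewrite e in h1; rewrite -(cvg_lim _ h1)// -(cvg_lim _ h2).
Qed.

End GeneralMeasure.

(** * Cauchy products and differentiation of power series *)

Section CauchyProduct.
Context {R : realType}.
Implicit Types a b : R^nat.

Lemma cvg_ord_sum m (f : nat -> R^nat) (l : R^nat) :
  (forall i, f i n @[n --> \oo] --> l i) ->
  \sum_(i < m) f i n @[n --> \oo] --> \sum_(i < m) l i.
Proof.
move=> fl; elim: m => [|m IH].
  rewrite big_ord0 (_ : (fun n => _) = fun=> 0); first exact: cvg_cst.
  by apply/funext => n; rewrite big_ord0.
rewrite big_ord_recr/= (_ : (fun n => _) = fun n => \sum_(i < m) f i n + f m n).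
  exact: cvgD.
by apply/funext => n; rewrite big_ord_recr.
Qed.

Lemma sum_cauchy_productE a b n :
  \sum_(k < n) \sum_(i < k.+1) a i * b (k - i)%N =
  \sum_(i < n) a i * series b (n - i)%N.
Proof.
elim: n => [|n IH]; first by rewrite !big_ord0.
rewrite big_ord_recr/= IH.
under [RHS]eq_bigr => i _ do
  rewrite subSn -1?ltnS// /series/= big_nat_recr//= mulrDr.
rewrite big_split/=; congr (_ + _).
by rewrite [RHS]big_ord_recr/= subnn big_geq// mulr0 addr0.
Qed.

(** Absolute convergence makes the part of the square [0, n)^2 above the
    diagonal negligible: it is dominated by the same part for the absolute
    values, which lies outside the half-size square. *)
Lemma cvg_cauchy_product a b :
  cvgn [normed series a] -> cvgn [normed series b] ->
  \sum_(k < n) \sum_(i < k.+1) a i * b (k - i)%N @[n --> \oo] -->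
  limn (series a) * limn (series b).
Proof.
move=> na nb.
pose a' k : R := `|a k|; pose b' k : R := `|b k|.
have ca' : series a' n @[n --> \oo] --> limn (series a') by exact: na.
have cb' : series b' n @[n --> \oo] --> limn (series b') by exact: nb.
have ca : series a n @[n --> \oo] --> limn (series a) by exact: normed_cvg.
have cb : series b n @[n --> \oo] --> limn (series b) by exact: normed_cvg.
have sb'_nd n m : (n <= m)%N -> series b' n <= series b' m.
  move=> nm; rewrite /series/= [leRHS](@big_cat_nat _ _ _ n)//= lerDl.
  by apply: sumr_ge0 => i _; rewrite /b'.
have sb'0 n : 0 <= series b' n by apply: sumr_ge0 => i _; rewrite /b'.
have half n : series a' n./2 * series b' n./2 <= \sum_(i < n) a' i * series b' (n - i)%N.
  have h2 : (n./2 <= n)%N by rewrite -[leqRHS]odd_double_half -addnn addnA leq_addl.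
  rewrite -(big_mkord xpredT (fun i => a' i * series b' (n - i)%N)) [leRHS](@big_cat_nat _ _ _ n./2)//=.
  apply: (@le_trans _ _ (\sum_(0 <= i < n./2) a' i * series b' (n - i)%N)); last first.
    by rewrite lerDl; apply: sumr_ge0 => i _; rewrite mulr_ge0 ?/a'.
  rewrite /series/= mulr_suml; apply: ler_sum_nat => i /andP[_ i2].
  rewrite ler_wpM2l ?/a'//; apply: sb'_nd.
  rewrite leq_subRL; last exact: leq_trans (ltnW i2) h2.
  apply: (@leq_trans (n./2 + n./2)%N); first by rewrite leq_add2r ltnW.
  by rewrite addnn -[leqRHS](odd_double_half n) leq_addl.
have bnd n : `|series a n * series b n - \sum_(i < n) a i * series b (n - i)%N| <=
    series a' n * series b' n - series a' n./2 * series b' n./2.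
  apply: (@le_trans _ _ (series a' n * series b' n - \sum_(i < n) a' i * series b' (n - i)%N));
    last by rewrite lerD2l lerN2.
  rewrite [series a n]/series/= [series a' n]/series/= !big_mkord !mulr_suml.
  rewrite -!sumrB; apply: (le_trans (ler_norm_sum _ _ _)); apply: ler_sum => i _.
  rewrite -!mulrBr normrM ler_wpM2l//.
  have hi : (n - i <= n)%N by rewrite leq_subr.
  have sB (u : R^nat) : series u n - series u (n - i)%N = \sum_(n - i <= j < n) u j.
    by rewrite /series/= (@big_cat_nat _ _ _ (n - i)%N 0 n)//= addrAC subrr add0r.
  rewrite !sB.
  exact: ler_norm_sum.
have half_cvg : n./2 @[n --> \oo] --> \oo.
  move=> A [N _ NA]; exists N.*2 => //= n /= nN; apply: NA => /=.
  by rewrite -(doubleK N) half_leq.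
have cvg0 : series a' n * series b' n - series a' n./2 * series b' n./2 @[n --> \oo] --> (0 : R).
  rewrite -(subrr (limn (series a') * limn (series b'))).
  apply: cvgB; first exact: cvgM.
  by apply: cvgM; [exact: (cvg_comp _ _ half_cvg ca')|exact: (cvg_comp _ _ half_cvg cb')].
under eq_fun do rewrite sum_cauchy_productE.
have -> : (fun n => \sum_(i < n) a i * series b (n - i)%N) =
  (fun n => series a n * series b n -
     (series a n * series b n - \sum_(i < n) a i * series b (n - i)%N)).
  by apply/funext => n; rewrite opprB addrC subrK.
rewrite -(subr0 (limn (series a) * limn (series b))); apply: cvgB; first exact: cvgM.
apply: norm_cvg0; apply: (squeeze_cvgr _ _ cvg0); last exact: cvg_cst.
by apply: nearW => n; rewrite normr_ge0 bnd.
Qed.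

End CauchyProduct.

Section FactorialSeries.
Context {R : realType}.
Implicit Types (a : R^nat) (M B x : R).

(** Power series with such coefficients converge everywhere, and the class is
    stable under differentiation. *)
Definition fact_bounded M B a := forall k, `|a k| <= M * B ^+ k / k`!%:R.

Lemma series_exp_coeff_le x n : 0 <= x -> series (exp_coeff x) n <= expR x.
Proof.
move=> x0; apply: nondecreasing_cvgn_le; last exact: is_cvg_series_exp_coeff.
apply/nondecreasing_seqP => k; rewrite /series/= big_nat_recr//= lerDl.
exact: exp_coeff_ge0.
Qed.

Lemma fact_bounded_term M B a x k : fact_bounded M B a ->
  `|a k * x ^+ k| <= M * exp_coeff (B * `|x|) k.
Proof.
move=> h; rewrite normrM normrX /exp_coeff/= exprMn.
apply: (le_trans (ler_wpM2r _ (h k))); first by rewrite exprn_ge0.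
by rewrite le_eqVlt; apply/orP; left; apply/eqP; ring.
Qed.

Lemma fact_bounded_normed_cvg M B a x : 0 <= M -> 0 <= B -> fact_bounded M B a ->
  cvgn [normed series (fun k => a k * x ^+ k)].
Proof.
move=> M0 B0 h.
apply: (@series_le_cvg _ _ (M *: exp_coeff (B * `|x|))) => [k|k|k|] /=.
- exact: normr_ge0.
- by rewrite mulr_ge0// exp_coeff_ge0 ?mulr_ge0.
- exact: fact_bounded_term.
- exact/is_cvg_seriesZ/is_cvg_series_exp_coeff.
Qed.

Lemma fact_bounded_cvg M B a x : 0 <= M -> 0 <= B -> fact_bounded M B a ->
  cvgn (pseries a x).
Proof. by move=> M0 B0 h; apply: normed_cvg; exact: fact_bounded_normed_cvg M0 B0 h. Qed.

Lemma fact_bounded_diffs M B a : fact_bounded M B a ->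
  fact_bounded (M * B) B (pseries_diffs a).
Proof.
move=> h k; rewrite /pseries_diffs normrM ger0_norm//.
apply: (le_trans (ler_wpM2l _ (h k.+1))) => //.
rewrite le_eqVlt; apply/orP; left; apply/eqP.
rewrite factS natrM exprS; field.
by rewrite pnatr_eq0 -lt0n fact_gt0/= addrC natr1 pnatr_eq0.
Qed.

Lemma fact_bounded_derive M B a x : 0 <= M -> 0 <= B -> fact_bounded M B a ->
  is_derive x 1 (fun x => limn (pseries a x)) (limn (pseries (pseries_diffs a) x)).
Proof.
move=> M0 B0 h.
have h1 := fact_bounded_diffs h; have h2 := fact_bounded_diffs h1.
apply: (@pseries_snd_diffs _ _ (`|x| + 1)).
- exact: fact_bounded_cvg h.
- by apply: fact_bounded_cvg h1; rewrite ?mulr_ge0.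
- by apply: fact_bounded_cvg h2; rewrite ?mulr_ge0.
- by rewrite [ltRHS]ger0_norm ?addr_ge0// ltrDl.
Qed.

End FactorialSeries.

(** * Rising factorials *)

Section Pochhammer.
Context {R : realType}.
Implicit Types (c : R) (n k i : nat).

Definition poch c k := \prod_(i < k) (c + i%:R).

Lemma poch0 c : poch c 0 = 1. Proof. by rewrite /poch big_ord0. Qed.

Lemma pochS c k : poch c k.+1 = poch c k * (c + k%:R).
Proof. by rewrite /poch big_ord_recr. Qed.

Lemma pochSl c k : poch c k.+1 = c * poch (c + 1) k.
Proof.
rewrite /poch big_ord_recl addr0; congr (_ * _); apply: eq_bigr => i _.
by rewrite -addrA -natr1 [1 + _]addrC.
Qed.

Lemma poch_gt0 c k : 0 < c -> 0 < poch c k.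
Proof. by move=> c0; apply: prodr_gt0 => i _; rewrite ltr_wpDr. Qed.

Lemma Gamma_poch c k : 0 < c -> sGamma (c + k%:R) = poch c k * sGamma c.
Proof.
move=> c0; elim: k => [|k IH]; first by rewrite addr0 poch0 mul1r.
by rewrite -natr1 addrA sGammaS ?ltr_wpDr// IH pochS; ring.
Qed.

(** Each factor c + i of the rising factorial is at least (i + 1) / 2. *)
Lemma fact_le_poch c k : 2^-1 <= c -> k`!%:R <= 2 ^+ k * poch c k.
Proof.
move=> c2; have c0 : 0 < c by apply: lt_le_trans c2; rewrite invr_gt0.
elim: k => [|k IH]; first by rewrite poch0 mulr1.
rewrite factS natrM exprS pochS (_ : _ * _ * _ = (2 * (c + k%:R)) * (2 ^+ k * poch c k)); last by ring.
apply: ler_pM => //; rewrite -natr1; move: (ler0n R k); lra.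
Qed.

Lemma pochD c n k : poch c (n + k) = poch c n * poch (c + n%:R) k.
Proof.
elim: k => [|k IH]; first by rewrite addn0 poch0 mulr1.
by rewrite addnS !pochS IH natrD; ring.
Qed.

(** Vandermonde's identity for rising factorials, i.e. Newton's forward
    difference expansion of c |-> poch c n at c + k. *)
Lemma poch_vandermonde c n k :
  poch (c + k%:R) n = \sum_(i < n.+1) 'C(k, i)%:R * (n ^_ i)%:R * poch (c + i%:R) (n - i).
Proof.
have shift i c' : (i <= n)%N -> (n ^_ i)%:R * poch (c' + 1) (n - i) =
    (n ^_ i)%:R * poch c' (n - i) + (n ^_ i.+1)%:R * poch (c' + 1) (n - i.+1).
  move=> i_n; rewrite ffactnSr natrM -mulrA -mulrDr; congr (_ * _).
  rewrite subnS; case: (n - i)%N => [|m]; first by rewrite !poch0 mul0r addr0.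
  by rewrite /= pochS [poch c' m.+1]pochSl -[m.+1%:R]natr1; ring.
elim: k c => [|k IH] c.
  rewrite addr0 big_ord_recl bin0 ffactn0 subn0 addr0 !mul1r big1 ?addr0// => i _.
  by rewrite bin0n/= !mul0r.
rewrite -[in LHS]natr1 (_ : c + (k%:R + 1) = (c + 1) + k%:R); last by ring.
rewrite IH.
under eq_bigr => i _.
  rewrite -mulrA (_ : c + 1 + i%:R = c + i%:R + 1); last by ring.
  rewrite shift -1?ltnS// mulrDr.
  over.
rewrite big_split/= [X in _ + X]big_ord_recr/= (ffact_small (leqnn _)) mul0r mulr0 addr0.
rewrite big_ord_recl/= [in RHS]big_ord_recl/= !bin0 -addrA; congr (_ + _).
  by rewrite mulrA.
rewrite -big_split/=; apply: eq_bigr => i _.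
rewrite /bump/= add1n binS natrD -natr1 (_ : c + i%:R + 1 = c + (i%:R + 1)); last by ring.
ring.
Qed.

End Pochhammer.

(** * Bessel-Clifford functions *)

Section Clifford.
Context {R : realType}.
Variable c : R.
Hypothesis c_ge : 2^-1 <= c.
Implicit Types (x y z : R) (k n : nat).

Let c0 : 0 < c. Proof. by apply: lt_le_trans c_ge; rewrite invr_gt0. Qed.

(** [icliff] and [jcliff] are the entire functions 0F1(; c; z) and 0F1(; c; -z):
    up to a factor z^((1 - c) / 2), the modified and the ordinary Bessel function
    of order c - 1 at 2 sqrt z. *)
Definition icoeff k : R := (k`!%:R * poch c k)^-1.
Definition jcoeff k : R := (-1) ^+ k * icoeff k.
Definition icliff z := limn (pseries icoeff z).
Definition jcliff z := limn (pseries jcoeff z).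

Lemma icoeff_ge0 k : 0 <= icoeff k.
Proof. by rewrite invr_ge0 mulr_ge0// ltW// poch_gt0. Qed.

Lemma icoeff_bounded : fact_bounded 1 2 icoeff.
Proof.
move=> k; rewrite ger0_norm ?icoeff_ge0// mul1r /icoeff.
have f0 : 0 < k`!%:R :> R by rewrite ltr0n fact_gt0.
have f1 : 1 <= k`!%:R :> R by rewrite ler1n fact_gt0.
have p0 := poch_gt0 k c0.
rewrite invfM mulrC ler_pM2r ?invr_gt0// -[leLHS]mul1r ler_pdivrMr//.
exact: le_trans (fact_le_poch k c_ge).
Qed.

Lemma jcoeff_norm k : `|jcoeff k| = icoeff k.
Proof. by rewrite normrM normrX normrN1 expr1n mul1r ger0_norm// icoeff_ge0. Qed.

Lemma jcoeff_bounded : fact_bounded 1 2 jcoeff.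
Proof. by move=> k; rewrite jcoeff_norm -[icoeff k]ger0_norm ?icoeff_ge0// icoeff_bounded. Qed.

Lemma icliff_cvg z : cvgn (pseries icoeff z).
Proof. exact: fact_bounded_cvg icoeff_bounded. Qed.

Lemma jcliff_cvg z : cvgn (pseries jcoeff z).
Proof. exact: fact_bounded_cvg jcoeff_bounded. Qed.

Lemma icliff_ge0 z : 0 <= z -> 0 <= icliff z.
Proof.
move=> z0; apply: limr_ge; first exact: icliff_cvg.
by apply: nearW => n; apply: sumr_ge0 => k _; rewrite mulr_ge0 ?icoeff_ge0 ?exprn_ge0.
Qed.

Lemma jcliff_derive z :
  is_derive z 1 jcliff (limn (pseries (pseries_diffs jcoeff) z)).
Proof. exact: fact_bounded_derive jcoeff_bounded. Qed.

Lemma icliff_derive z :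
  is_derive z 1 icliff (limn (pseries (pseries_diffs icoeff) z)).
Proof. exact: fact_bounded_derive icoeff_bounded. Qed.

Lemma jcliff_measurable : measurable_fun setT jcliff.
Proof.
apply: continuous_measurable_fun => z; apply: differentiable_continuous.
by apply/derivable1_diffP; have [] := jcliff_derive z.
Qed.

Lemma icliff_measurable : measurable_fun setT icliff.
Proof.
apply: continuous_measurable_fun => z; apply: differentiable_continuous.
by apply/derivable1_diffP; have [] := icliff_derive z.
Qed.

Lemma pseries_at0 (a : R^nat) : limn (pseries a 0) = a 0%N.
Proof.
apply: cvg_lim => //; rewrite -(cvg_shiftS); apply: cvg_near_cst; apply: nearW => n.
rewrite /pseries /series/= big_nat_recl//= expr0 mulr1 big1 ?addr0// => i _.
by rewrite exprS mul0r mulr0.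
Qed.

Lemma jcliff0 : jcliff 0 = 1.
Proof. by rewrite /jcliff pseries_at0 /jcoeff /icoeff fact0 poch0 expr0 mulr1 invr1 mulr1. Qed.

(** The recurrence (k + 1)(c + k) u_(k+1) = - u_k of the coefficients says
    that u solves z u'' + c u' + u = 0. *)
Lemma jcliff_ode z : z * limn (pseries (pseries_diffs (pseries_diffs jcoeff)) z) +
  c * limn (pseries (pseries_diffs jcoeff) z) + jcliff z = 0.
Proof.
have b0 := jcoeff_bounded; have b1 := fact_bounded_diffs b0; have b2 := fact_bounded_diffs b1.
have c1 : cvgn (pseries (pseries_diffs jcoeff) z).
  by apply: fact_bounded_cvg b1; rewrite ?mulr_ge0.
have c2 : cvgn (pseries (pseries_diffs (pseries_diffs jcoeff)) z).
  by apply: fact_bounded_cvg b2; rewrite ?mulr_ge0.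
have h n : z * pseries (pseries_diffs (pseries_diffs jcoeff)) z n +
  c * pseries (pseries_diffs jcoeff) z n.+1 + pseries jcoeff z n.+1 = 0.
  rewrite /pseries /series/= [in X in _ + X + _]big_nat_recl//= [in X in _ + X]big_nat_recl//=.
  set A := \sum_(0 <= k < n) _; set B := \sum_(0 <= k < n) _; set C := \sum_(0 <= k < n) _.
  have -> : z * A + c * (pseries_diffs jcoeff 0 * z ^+ 0 + B) + (jcoeff 0 * z ^+ 0 + C) =
    (z * A + c * B + C) + (c * (pseries_diffs jcoeff 0 * z ^+ 0) + jcoeff 0 * z ^+ 0) by ring.
  rewrite !mulr_sumr -!big_split/=.
  have rec k : (k.+1%:R * (c + k%:R)) * jcoeff k.+1 = - jcoeff k.
    rewrite /jcoeff /icoeff factS natrM pochS exprS.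
    have p0 := poch_gt0 k c0; have f0 : 0 < k`!%:R :> R by rewrite ltr0n fact_gt0.
    have ck : 0 < c + k%:R by rewrite ltr_wpDr.
    by field; rewrite !gt_eqF//= addrC natr1 ltr0n.
  rewrite big1 => [|i _].
    rewrite add0r /pseries_diffs !expr0 !mulr1 mul1r -[jcoeff 0]opprK -rec addr0 mul1r.
    by ring.
  have := rec i.+1; rewrite /pseries_diffs !exprS => e.
  have -> : jcoeff i.+1 = - (i.+2%:R * (c + i.+1%:R) * jcoeff i.+2) by rewrite e opprK.
  by ring.
have : (fun n => z * pseries (pseries_diffs (pseries_diffs jcoeff)) z n +
  c * pseries (pseries_diffs jcoeff) z n.+1 + pseries jcoeff z n.+1) @ \oo -->
  z * limn (pseries (pseries_diffs (pseries_diffs jcoeff)) z) +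
  c * limn (pseries (pseries_diffs jcoeff) z) + jcliff z.
  apply: cvgD; last by rewrite (cvg_shiftS (pseries jcoeff z)); exact: jcliff_cvg.
  apply: cvgD; first by apply: cvgM => //; exact: cvg_cst.
  apply: cvgM; first exact: cvg_cst.
  by rewrite (cvg_shiftS (pseries (pseries_diffs jcoeff) z)).
move/cvg_lim => <- //; apply: cvg_lim => //.
by under eq_fun do rewrite h; exact: cvg_cst.
Qed.

(** The energy u^2 + z u'^2 has derivative (1 - 2 c) u'^2 <= 0 by the
    differential equation, and it equals 1 at the origin. *)
Lemma jcliff_bound z : 0 <= z -> `|jcliff z| <= 1.
Proof.
move=> z0.
pose g z := limn (pseries (pseries_diffs jcoeff) z).
pose h z := limn (pseries (pseries_diffs (pseries_diffs jcoeff)) z).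
pose W z := jcliff z ^+ 2 + z * g z ^+ 2.
have dj x : is_derive x 1 jcliff (g x) by exact: jcliff_derive.
have dg x : is_derive x 1 g (h x).
  by apply: fact_bounded_derive (fact_bounded_diffs jcoeff_bounded); rewrite ?mulr_ge0.
have dW x : is_derive x 1 W ((1 - 2 * c) * g x ^+ 2).
  apply: is_derive_eq.
  rewrite /GRing.scale/= !mulr1.
  have := jcliff_ode x; rewrite -/(g x) -/(h x) => /eqP.
  rewrite addr_eq0 => /eqP e.
  have -> : jcliff x = - (x * h x + c * g x) by rewrite e opprK.
  by ring.
have W1 : W z <= 1.
  have -> : 1 = W 0 by rewrite /W jcliff0 expr1n mul0r addr0.
  apply: (@ler0_derive1_nincry _ W 0) => //.
  - move=> x _; rewrite derive1E; have [_ ->] := dW x.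
    by rewrite mulr_le0_ge0 ?sqr_ge0//; move: c_ge; lra.
  - apply: continuous_subspaceT => x; apply: differentiable_continuous.
    by apply/derivable1_diffP; have [] := dW x.
have : jcliff z ^+ 2 <= 1 ^+ 2.
  by rewrite expr1n; apply: le_trans W1; rewrite lerDl mulr_ge0// sqr_ge0.
by rewrite -(real_normK (num_real (jcliff z))) ler_sqr ?nnegrE.
Qed.

(** Splitting (x y)^k / (k! (c)_k) as (e y)^k / k! times a bounded factor trades
    growth in y against a constant depending on x. *)
Lemma jcliff_partial_le (e x y : R) n : 0 < e -> 0 <= x -> 0 <= y ->
  `|pseries jcoeff (x * y) n| <= expR (2 * x / e) * expR (e * y).
Proof.
move=> e0 x0 y0; apply: (le_trans (ler_norm_sum _ _ _)).
apply: (@le_trans _ _ (expR (2 * x / e) * series (exp_coeff (e * y)) n)); last first.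
  by rewrite ler_pM2l ?expR_gt0// series_exp_coeff_le// mulr_ge0// ltW.
rewrite /series/= mulr_sumr; apply: ler_sum => k _.
rewrite normrM jcoeff_norm [X in _ * X]ger0_norm ?exprn_ge0 ?mulr_ge0//.
have f0 : 0 < k`!%:R :> R by rewrite ltr0n fact_gt0.
have p0 := poch_gt0 k c0.
have -> : (x * y) ^+ k = (x / e) ^+ k * (e * y) ^+ k.
  by rewrite -exprMn; congr (_ ^+ _); field; rewrite gt_eqF.
have -> : icoeff k * ((x / e) ^+ k * (e * y) ^+ k) =
    (x / e) ^+ k / poch c k * exp_coeff (e * y) k.
  by rewrite /icoeff /exp_coeff/=; field; rewrite !gt_eqF.
have xe1 : 0 <= x / e by rewrite divr_ge0// ltW.
have xe0 : 0 <= 2 * x / e by rewrite -mulrA mulr_ge0.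
rewrite ler_wpM2r ?exp_coeff_ge0 ?mulr_ge0 ?(ltW e0)//.
apply: (@le_trans _ _ ((2 * x / e) ^+ k / k`!%:R)).
  rewrite ler_pdivrMr// mulrAC ler_pdivlMr// -(mulrA 2) [X in _ <= X * _]exprMn -mulrA mulrCA.
  by rewrite ler_wpM2l ?exprn_ge0// fact_le_poch.
have := series_exp_coeff_le k.+1 xe0; apply: le_trans.
rewrite /series/= big_nat_recr//= lerDr.
by apply: sumr_ge0 => i _; exact: exp_coeff_ge0.
Qed.

End Clifford.

(** * Series behind the heat kernel *)

Section HeatSeries.
Context {R : realType}.
Variable c : R.
Hypothesis c_ge : 2^-1 <= c.
Implicit Types (x y z : R) (k n : nat).

Let c0 : 0 < c. Proof. by apply: lt_le_trans c_ge; rewrite invr_gt0. Qed.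

(** x^k / k! times 'C(k, i) is x^i / i! times x^(k - i) / (k - i)!. *)
Lemma cvg_exp_coeff_bin x i :
  \sum_(k < n) exp_coeff x k * 'C(k, i)%:R @[n --> \oo] --> exp_coeff x i * expR x.
Proof.
rewrite -(cvg_shiftn i).
have -> : (fun n => \sum_(k < n + i) exp_coeff x k * 'C(k, i)%:R) =
    (fun n => exp_coeff x i * series (exp_coeff x) n).
  apply/funext => n; rewrite -(big_mkord xpredT (fun k => exp_coeff x k * 'C(k, i)%:R)).
  rewrite (@big_cat_nat _ _ _ i) ?leq_addl//= big_nat big1 ?add0r; last first.
    by move=> k /andP[_ ki]; rewrite bin_small ?mulr0.
  rewrite -[X in \sum_(X <= _ < _) _](add0n i) big_addn addnK /series/= mulr_sumr; apply: eq_bigr => k _.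
  have /(congr1 (fun m => m%:R : R)) := bin_fact (leq_addl k i).
  rewrite addnK !natrM /exp_coeff/= exprD => <-.
  have f0 j : j`!%:R != 0 :> R by rewrite pnatr_eq0 -lt0n fact_gt0.
  field; rewrite !f0/= pnatr_eq0 -lt0n bin_gt0 leq_addl//.
by apply: cvgM; [exact: cvg_cst|exact: is_cvg_series_exp_coeff].
Qed.

(** Vandermonde's identity splits the series into n + 1 shifted exponential
    series. This is Kummer's transformation of 1F1(c + n; c; x). *)
Lemma cvg_poch_shift x n :
  \sum_(k < N) x ^+ k * (k`!%:R * poch c k)^-1 * poch c (n + k) @[N --> \oo] -->
  poch c n * expR x * \sum_(i < n.+1) 'C(n, i)%:R * x ^+ i / poch c i.
Proof.
have -> : (fun N => \sum_(k < N) x ^+ k * (k`!%:R * poch c k)^-1 * poch c (n + k)) =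
  (fun N => \sum_(i < n.+1) (\sum_(k < N) exp_coeff x k * 'C(k, i)%:R) *
     ((n ^_ i)%:R * poch (c + i%:R) (n - i))).
  apply/funext => N; under [RHS]eq_bigr do rewrite mulr_suml.
  rewrite exchange_big/=; apply: eq_bigr => k _.
  rewrite addnC pochD poch_vandermonde !mulr_sumr; apply: eq_bigr => i _.
  rewrite /exp_coeff/=; have p0 := poch_gt0 k c0.
  have f0 : 0 < k`!%:R :> R by rewrite ltr0n fact_gt0.
  by field; rewrite !gt_eqF.
have -> : poch c n * expR x * \sum_(i < n.+1) 'C(n, i)%:R * x ^+ i / poch c i =
  \sum_(i < n.+1) (exp_coeff x i * expR x) * ((n ^_ i)%:R * poch (c + i%:R) (n - i)).
  rewrite mulr_sumr; apply: eq_bigr => i _.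
  have i_n : (i <= n)%N by rewrite -ltnS.
  have -> : poch c n = poch c i * poch (c + i%:R) (n - i) by rewrite -pochD subnKC.
  rewrite -bin_ffact natrM /exp_coeff/=; have p0 := poch_gt0 i c0.
  have f0 : 0 < i`!%:R :> R by rewrite ltr0n fact_gt0.
  by field; rewrite !gt_eqF.
apply: (@cvg_ord_sum _ _ (fun i N => (\sum_(k < N) exp_coeff x k * 'C(k, i)%:R) *
    ((n ^_ i)%:R * poch (c + i%:R) (n - i)))
  (fun i => exp_coeff x i * expR x * ((n ^_ i)%:R * poch (c + i%:R) (n - i)))).
by move=> i; apply: cvgM; [exact: cvg_exp_coeff_bin|exact: cvg_cst].
Qed.

(** The inner sum is a Laguerre polynomial in x: this is their generating
    function, read as the Cauchy product of the two series on the right. *)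
Lemma cvg_laguerre_series x y :
  \sum_(k < N) exp_coeff (- y) k * (\sum_(i < k.+1) 'C(k, i)%:R * (- x) ^+ i / poch c i)
    @[N --> \oo] --> icliff c (x * y) * expR (- y).
Proof.
have H := @cvg_cauchy_product _ (fun i => icoeff c i * (x * y) ^+ i) (exp_coeff (- y)).
have {}H : \sum_(k < n) \sum_(i < k.+1) icoeff c i * (x * y) ^+ i * exp_coeff (- y) (k - i)%N
   @[n --> \oo] --> icliff c (x * y) * expR (- y).
  apply: H; last by rewrite normed_series_exp_coeff; exact: is_cvg_series_exp_coeff.
  exact: fact_bounded_normed_cvg (icoeff_bounded c_ge).
apply: cvg_trans H; apply: near_eq_cvg; apply: nearW => N /=.
apply: eq_bigr => k _; rewrite mulr_sumr; apply: eq_bigr => i _.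
have i_k : (i <= k)%N by rewrite -ltnS.
have /(congr1 (fun m => m%:R : R)) := bin_fact i_k; rewrite !natrM => e.
have -> : exp_coeff (- y) k = (- y) ^+ (k - i)%N * (- y) ^+ i / k`!%:R.
  by rewrite -exprD subnK.
rewrite /exp_coeff/= /icoeff -e exprMn !(exprNn x) !(exprNn y).
have p0 := poch_gt0 i c0.
have f0 j : j`!%:R != 0 :> R by rewrite pnatr_eq0 -lt0n fact_gt0.
have b0 : 'C(k, i)%:R != 0 :> R by rewrite pnatr_eq0 -lt0n bin_gt0.
have s2 : (-1) ^+ i * (-1) ^+ i = 1 :> R by rewrite -exprMn mulrNN mulr1 expr1n.
transitivity (((-1) ^+ i * (-1) ^+ i) * (x ^+ i * y ^+ i * (-1) ^+ (k - i)%N * y ^+ (k - i)%N / (i`!%:R * poch c i * (k - i)`!%:R))).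
  by rewrite s2; field; rewrite !f0 gt_eqF.
by field; rewrite !f0 b0 gt_eqF.
Qed.

End HeatSeries.

(** * The heat kernel of a Bessel measure *)

Lemma dominated_cvg_EFin d (T : measurableType d) (R : realType)
    (m : {measure set T -> \bar R}) (D : set T) (f_ : nat -> T -> R) (f g : T -> R) :
  measurable D ->
  (forall n, measurable_fun D (f_ n)) -> measurable_fun D f ->
  (forall x, D x -> f_ n x @[n --> \oo] --> f x) ->
  m.-integrable D (EFin \o g) -> (forall n x, D x -> `|f_ n x| <= g x) ->
  (\int[m]_(x in D) (f_ n x)%:E @[n --> \oo] --> \int[m]_(x in D) (f x)%:E)%E.
Proof.
move=> mD mf_ mf fcvg ig fg.
have [] // := @dominated_convergence _ _ _ m D mD (fun n x => (f_ n x)%:E)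
  (fun x => (f x)%:E) (EFin \o g).
- by move=> n; exact: mfun_EFin.
- exact: mfun_EFin.
- apply: aeW => x Dx; apply/cvg_EFin; first by apply: nearW.
  exact: fcvg.
- by apply: aeW => x n Dx; rewrite lee_fin fg.
Qed.

Lemma mfun_jcliff d (T : measurableType d) (R : realType) c (D : set T) (f : T -> R) :
  2^-1 <= c -> measurable_fun D f -> measurable_fun D (fun y => jcliff c (f y)).
Proof.
move=> c_ge mf.
exact: (@measurableT_comp _ _ _ _ _ _ (jcliff c) _ f (jcliff_measurable c_ge) mf).
Qed.

(** Up to the constant Gamma(c), the image of m under X has the moments of
    x^(c - 1) dx on the half-line. *)
Record bessel_measure d (T : measurableType d) (R : realType)
    (m : {measure set T -> \bar R}) (X : T -> R) (c : R) : Prop := BesselMeasure {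
  bm_measurable : measurable_fun setT X;
  bm_gt0 : forall y, 0 < X y;
  bm_half : 2^-1 <= c;
  bm_moment : forall p t, 0 < c + p -> 0 < t ->
    (\int[m]_y (X y `^ p * expR (- (t * X y)))%:E =
     (sGamma (c + p) / sGamma c * t `^ (- (c + p)))%:E)%E }.

Section AbstractHankel.
Context d (T : measurableType d) (R : realType).
Variables (m : {sigma_finite_measure set T -> \bar R}) (X : T -> R) (c : R).
Hypothesis H : bessel_measure m X c.

Let mX := bm_measurable H.
Let X_gt0 := bm_gt0 H.
Let c_ge := bm_half H.
Let moment := bm_moment H.
Let c0 : 0 < c. Proof. by apply: lt_le_trans c_ge; rewrite invr_gt0. Qed.
Let X0 y : 0 <= X y. Proof. exact: ltW. Qed.
Local Notation J := (jcliff c).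

Lemma moment_nat k t : 0 < t ->
  (\int[m]_y (X y ^+ k * expR (- (t * X y)))%:E =
   (poch c k * t `^ (- (c + k%:R)))%:E)%E.
Proof.
move=> t0; have ck : 0 < c + k%:R by rewrite ltr_wpDr.
under eq_integral do rewrite -powR_mulrn//.
by rewrite moment// Gamma_poch// mulfK// gt_eqF// sGamma_gt0.
Qed.

Lemma integrable_moment k t : 0 < t ->
  m.-integrable setT (EFin \o (fun y => X y ^+ k * expR (- (t * X y)))).
Proof.
move=> t0; apply/integrableP; split; first by rewrite /comp; mfun.
under eq_integral.
  move=> y _; rewrite /= ger0_norm ?mulr_ge0 ?exprn_ge0 ?expR_ge0//; over.
by rewrite moment_nat// ltry.
Qed.

Lemma integrable_bounded_exp n t K (w : T -> R) : 0 < t -> measurable_fun setT w ->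
  (forall y, `|w y| <= K * (X y ^+ n * expR (- (t * X y)))) ->
  m.-integrable setT (EFin \o w).
Proof.
move=> t0 mw wle.
have := integrableZl measurableT K (integrable_moment n t0).
apply: le_integrable => //; first exact/measurable_EFinP.
move=> y _ /=; rewrite lee_fin; apply: (le_trans (wle y)); exact: ler_norm.
Qed.

(** Dominated convergence: exp(- t X) absorbs the growth of the partial sums of
    J, as bounded by [jcliff_partial_le] with e = t / 2. *)
Lemma cvg_bessel_series n t x (w : T -> R) : 0 < t -> 0 <= x -> measurable_fun setT w ->
  (forall y, `|w y| <= X y ^+ n * expR (- (t * X y))) ->
  \sum_(k < N) jcoeff c k * x ^+ k * \int[m]_y (w y * X y ^+ k) @[N --> \oo] -->
  \int[m]_y (w y * J (x * X y)).
Proof.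
move=> t0 x0 mw wle.
have intk k : m.-integrable setT (EFin \o (fun y => w y * X y ^+ k)).
  apply: (@integrable_bounded_exp (n + k) t 1) => //; first by mfun.
  move=> y; rewrite mul1r normrM [X in _ * X]ger0_norm ?exprn_ge0// exprD mulrAC.
  by rewrite ler_wpM2r ?exprn_ge0.
have EN N : (\int[m]_y (w y * pseries (jcoeff c) (x * X y) N)%:E =
    (\sum_(k < N) jcoeff c k * x ^+ k * \int[m]_y (w y * X y ^+ k))%:E)%E.
  transitivity (\int[m]_y (\sum_(k < N) (jcoeff c k * x ^+ k)%:E * (w y * X y ^+ k)%:E))%E.
    apply: eq_integral => y _; rewrite sumEFin; congr EFin.
    rewrite /pseries /series/= big_mkord mulr_sumr; apply: eq_bigr => k _.
    by rewrite exprMn; ring.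
  rewrite (@integral_sum _ _ _ m setT measurableT _
    (fun (k : 'I_N) y => (jcoeff c k * x ^+ k)%:E * (w y * X y ^+ k)%:E)%E); last first.
    by move=> k; exact: (integrableZl measurableT _ (intk k)).
  rewrite -sumEFin; apply: eq_bigr => k _.
  rewrite (integralZl measurableT (intk k)) [in RHS]EFinM; congr (_ * _)%E.
  by rewrite /Rintegral fineK//; exact: (integrable_fin_num measurableT (intk k)).
have t20 : 0 < t / 2 by rewrite divr_gt0.
pose K := expR (2 * x / (t / 2)).
have dom := @integrable_bounded_exp n (t / 2) K (fun y => K * (X y ^+ n * expR (- (t / 2 * X y)))).
have {}dom : m.-integrable setT (EFin \o (fun y => K * (X y ^+ n * expR (- (t / 2 * X y))))).
  apply: dom => //; first by mfun.
  by move=> y; rewrite ger0_norm// !mulr_ge0 ?expR_ge0 ?exprn_ge0.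
have h : (\int[m]_y (w y * pseries (jcoeff c) (x * X y) N)%:E @[N --> \oo] -->
    \int[m]_y (w y * J (x * X y))%:E)%E.
  apply: (dominated_cvg_EFin _ _ _ _ dom) => //.
  - move=> N; apply: mfunM => //.
    rewrite /pseries /series/=; apply: measurable_sum => k.
    by apply: mfunM => //; apply: mfunX; mfun.
  - by apply: mfunM => //; apply: mfun_jcliff => //; mfun.
  - move=> y _; by apply: cvgM; [exact: cvg_cst|exact: jcliff_cvg].
  - move=> N y _; rewrite normrM.
    apply: (le_trans (ler_pM _ _ (wle y) (jcliff_partial_le c_ge N t20 x0 (X0 y)))) => //.
    rewrite -/K le_eqVlt; apply/orP; left; apply/eqP.
    rewrite [in LHS](_ : - (t * X y) = - (t / 2 * X y) - (t / 2 * X y)); last by field.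
    rewrite expRD expRN; have := expR_gt0 (t / 2 * X y) => e0.
    by field; rewrite gt_eqF.
have fin : (\int[m]_y (w y * J (x * X y))%:E)%E \is a fin_num.
  apply: integrable_fin_num => //; apply: (@integrable_bounded_exp n t 1) => //.
    by apply: mfunM => //; apply: mfun_jcliff => //; mfun.
  move=> y; rewrite mul1r normrM -[leRHS]mulr1 ler_pM//.
  by rewrite jcliff_bound// mulr_ge0.
pose S N := \sum_(k < N) jcoeff c k * x ^+ k * \int[m]_y (w y * X y ^+ k).
have h2 : (fun N => (S N)%:E) @ \oo --> (\int[m]_y (w y * J (x * X y)))%:E.
  rewrite /Rintegral fineK//.
  have -> : (fun N => (S N)%:E) = (fun N => \int[m]_y (w y * pseries (jcoeff c) (x * X y) N)%:E)%E.
    by apply/funext => N; rewrite EN.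
  exact: h.
exact: (fine_cvg h2).
Qed.

(** Integrating J term by term gives the series of [cvg_poch_shift]. *)
Lemma bessel_moment n t x : 0 < t -> 0 <= x ->
  \int[m]_y (X y ^+ n * expR (- (t * X y)) * J (x * X y)) =
  poch c n * t `^ (- (c + n%:R)) * expR (- (x / t)) *
    \sum_(i < n.+1) 'C(n, i)%:R * (- (x / t)) ^+ i / poch c i.
Proof.
move=> t0 x0.
have h1 : \sum_(k < N) jcoeff c k * x ^+ k * \int[m]_y (X y ^+ n * expR (- (t * X y)) * X y ^+ k)
   @[N --> \oo] --> \int[m]_y (X y ^+ n * expR (- (t * X y)) * J (x * X y)).
  apply: (@cvg_bessel_series n t) => //; first by mfun.
  by move=> y; rewrite ger0_norm ?mulr_ge0 ?exprn_ge0 ?expR_ge0.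
apply: (cvg_unique _ h1) => //.
have -> : (fun N => \sum_(k < N) jcoeff c k * x ^+ k * \int[m]_y (X y ^+ n * expR (- (t * X y)) * X y ^+ k)) =
  (fun N => t `^ (- (c + n%:R)) * \sum_(k < N) (- (x / t)) ^+ k * (k`!%:R * poch c k)^-1 * poch c (n + k)).
  apply/funext => N; rewrite mulr_sumr; apply: eq_bigr => k _.
  have -> : \int[m]_y (X y ^+ n * expR (- (t * X y)) * X y ^+ k) = poch c (n + k) * t `^ (- (c + (n + k)%:R)).
    rewrite /Rintegral -[RHS]/(fine (_%:E)) -moment_nat//; congr fine.
    by apply: eq_integral => y _; congr EFin; rewrite exprD; ring.
  rewrite natrD addrA opprD powRD; last by rewrite (gt_eqF t0) implybT.
  rewrite (powRN t k%:R) powR_mulrn ?(ltW t0)// /jcoeff /icoeff.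
  rewrite [(- (x / t)) ^+ k]exprNn expr_div_n.
  have p0 := poch_gt0 k c0.
  have f0 : 0 < k`!%:R :> R by rewrite ltr0n fact_gt0.
  by field; rewrite !gt_eqF// exprn_gt0.
rewrite (_ : _ * expR _ * _ = t `^ (- (c + n%:R)) * (poch c n * expR (- (x / t)) *
    \sum_(i < n.+1) 'C(n, i)%:R * (- (x / t)) ^+ i / poch c i)); last by ring.
by apply: cvgM; [exact: cvg_cst|exact: cvg_poch_shift].
Qed.

(** A Gaussian exp(- t X) is mapped by the transform to t^(-c) exp(- X / t). *)
Lemma bessel_gauss t x : 0 < t -> 0 <= x ->
  \int[m]_y (expR (- (t * X y)) * J (x * X y)) = t `^ (- c) * expR (- (x / t)).
Proof.
move=> t0 x0; have := @bessel_moment 0 t x t0 x0.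
rewrite poch0 addr0 mul1r big_ord1 bin0 expr0 poch0 invr1 !mulr1 => <-.
by under [in RHS]eq_Rintegral do rewrite expr0 mul1r.
Qed.

(** The kernel of f |-> H (exp(- t X) (H f)), where H is the transform. *)
Definition heat (t x y : R) := t `^ (- c) * expR (- ((x + y) / t)) * icliff c (x * y / t ^+ 2).

Lemma heat_ge0 t x y : 0 <= x -> 0 <= y -> 0 <= heat t x y.
Proof.
move=> x0 y0; rewrite /heat !mulr_ge0 ?powR_ge0 ?expR_ge0// icliff_ge0//.
by apply: divr_ge0; [exact: mulr_ge0|exact: sqr_ge0].
Qed.

Lemma heatC t x y : heat t x y = heat t y x.
Proof. by rewrite /heat (addrC x) (mulrC x). Qed.

(** Expanding J(y X) leaves moments of J(x X), which are Laguerre polynomials,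
    and [cvg_laguerre_series] sums them. This is Weber's second exponential
    integral. *)
Lemma bessel_heat t x y : 0 < t -> 0 <= x -> 0 <= y ->
  \int[m]_z (expR (- (t * X z)) * J (x * X z) * J (y * X z)) = heat t x y.
Proof.
move=> t0 x0 y0.
have h1 : \sum_(k < N) jcoeff c k * y ^+ k * \int[m]_z (expR (- (t * X z)) * J (x * X z) * X z ^+ k)
   @[N --> \oo] --> \int[m]_z (expR (- (t * X z)) * J (x * X z) * J (y * X z)).
  apply: (@cvg_bessel_series 0 t) => //.
    by apply: mfunM; [mfun|apply: mfun_jcliff => //; mfun].
  move=> z; rewrite expr0 mul1r normrM ger0_norm ?expR_ge0//.
  by rewrite ler_piMr ?expR_ge0// jcliff_bound// mulr_ge0.
apply: (cvg_unique _ h1) => //.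
have -> : (fun N => \sum_(k < N) jcoeff c k * y ^+ k * \int[m]_z (expR (- (t * X z)) * J (x * X z) * X z ^+ k)) =
  (fun N => t `^ (- c) * expR (- (x / t)) * \sum_(k < N) exp_coeff (- (y / t)) k *
    (\sum_(i < k.+1) 'C(k, i)%:R * (- (x / t)) ^+ i / poch c i)).
  apply/funext => N; rewrite mulr_sumr; apply: eq_bigr => k _.
  under eq_Rintegral do rewrite mulrC mulrA.
  rewrite bessel_moment// opprD powRD; last by rewrite (gt_eqF t0) implybT.
  rewrite (powRN t k%:R) powR_mulrn ?(ltW t0)// /jcoeff /icoeff /exp_coeff/=.
  rewrite [(- (y / t)) ^+ k]exprNn expr_div_n.
  have p0 := poch_gt0 k c0.
  have f0 : 0 < k`!%:R :> R by rewrite ltr0n fact_gt0.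
  by field; rewrite !gt_eqF// exprn_gt0.
have -> : heat t x y = t `^ (- c) * expR (- (x / t)) * (icliff c ((x / t) * (y / t)) * expR (- (y / t))).
  rewrite /heat mulrDl opprD expRD.
  rewrite (_ : x * y / t ^+ 2 = x / t * (y / t)); first by ring.
  by field; rewrite gt_eqF.
by apply: cvgM; [exact: cvg_cst|exact: cvg_laguerre_series].
Qed.

(** All terms of the series of the heat kernel are nonnegative, so they may be
    integrated one by one. *)
Lemma heat_gauss t u x : 0 < t -> 0 <= u -> 0 <= x ->
  (\int[m]_y (heat t x (X y) * expR (- (u * X y)))%:E =
   ((1 + t * u) `^ (- c) * expR (- (u * x / (1 + t * u))))%:E)%E.
Proof.
move=> t0 u0 x0.
have ut0 : 0 < u + t^-1 by rewrite ltr_wpDl ?invr_gt0.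
pose a k y := icoeff c k * (x / t ^+ 2) ^+ k * (X y ^+ k * expR (- ((u + t^-1) * X y))).
have xt0 : 0 <= x / t ^+ 2 by apply: divr_ge0 => //; exact: sqr_ge0.
have a0 k y : 0 <= a k y.
  by rewrite /a !mulr_ge0 ?expR_ge0 ?exprn_ge0 ?icoeff_ge0.
have K0 : 0 <= t `^ (- c) * expR (- (x / t)) by rewrite mulr_ge0 ?powR_ge0 ?expR_ge0.
have eser (b : R^nat) : cvgn (series b) -> (\sum_(k <oo) (b k)%:E = (limn (series b))%:E)%E.
  by move=> cb; rewrite -EFin_lim//; congr (limn _); apply/funext => n /=; rewrite sumEFin.
transitivity (\int[m]_y ((t `^ (- c) * expR (- (x / t)))%:E * \sum_(k <oo) (a k y)%:E))%E.
  apply: eq_integral => y _.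
  have e : pseries (icoeff c) (x * X y / t ^+ 2) = series (fun k => icoeff c k * (x * X y / t ^+ 2) ^+ k) by [].
  have aE k : a k y = expR (- ((u + t^-1) * X y)) * (icoeff c k * (x * X y / t ^+ 2) ^+ k).
    rewrite /a (_ : x * X y / t ^+ 2 = x / t ^+ 2 * X y); last by ring.
    by rewrite [(x / t ^+ 2 * X y) ^+ k]exprMn; ring.
  have h : series (a ^~ y) @ \oo --> expR (- ((u + t^-1) * X y)) * icliff c (x * X y / t ^+ 2).
    have -> : series (a ^~ y) = (fun n => expR (- ((u + t^-1) * X y)) * pseries (icoeff c) (x * X y / t ^+ 2) n).
      by apply/funext => n; rewrite e /series/= mulr_sumr; apply: eq_bigr => k _; exact: aE.
    by apply: cvgM; [exact: cvg_cst|exact: icliff_cvg].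
  rewrite eser; last by apply/cvg_ex; eexists; exact: h.
  rewrite (cvg_lim _ h)// -EFinM; congr EFin; rewrite /heat.
  rewrite mulrDl [(u + _) * _]mulrDl !opprD !expRD (mulrC t^-1); ring.
rewrite ge0_integralZl//=; last 2 first.
- by apply: ge0_emeasurable_sum => // [k y _ _|k _]; [rewrite lee_fin|rewrite /a; mfun].
- by move=> y _; apply: nneseries_ge0 => k _ _; rewrite lee_fin.
rewrite integral_nneseries//=; last 2 first.
- by move=> k; rewrite /a; mfun.
- by move=> k y _; rewrite lee_fin.
have aI k : (\int[m]_y (a k y)%:E = ((u + t^-1) `^ (- c) * exp_coeff (x / t ^+ 2 / (u + t^-1)) k)%:E)%E.
  under eq_integral do rewrite /a EFinM.
  rewrite ge0_integralZl//=; last 3 first.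
  - by mfun.
  - by move=> y _; rewrite lee_fin mulr_ge0 ?exprn_ge0 ?expR_ge0.
  - by rewrite lee_fin mulr_ge0 ?icoeff_ge0 ?exprn_ge0.
  rewrite moment_nat// -EFinM; congr EFin.
  rewrite opprD powRD; last by rewrite (gt_eqF ut0) implybT.
  rewrite (powRN _ k%:R) powR_mulrn ?(ltW ut0)// /icoeff /exp_coeff/=.
  rewrite [(_ / (u + t^-1)) ^+ k]expr_div_n.
  have p0 := poch_gt0 k c0.
  have f0 : 0 < k`!%:R :> R by rewrite ltr0n fact_gt0.
  have := exprn_gt0 k ut0; move: ((u + t^-1) ^+ k) ((x / t ^+ 2) ^+ k) => A B A0.
  by field; rewrite !gt_eqF.
under eq_eseriesr do rewrite aI.
pose q := x / t ^+ 2 / (u + t^-1).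
have h : series (fun k => (u + t^-1) `^ (- c) * exp_coeff q k) @ \oo --> (u + t^-1) `^ (- c) * expR q.
  have -> : series (fun k => (u + t^-1) `^ (- c) * exp_coeff q k) = (fun n => (u + t^-1) `^ (- c) * series (exp_coeff q) n).
    by apply/funext => n; rewrite /series/= mulr_sumr.
  by apply: cvgM; [exact: cvg_cst|exact: is_cvg_series_exp_coeff].
rewrite eser; last by apply/cvg_ex; eexists; exact: h.
rewrite (cvg_lim _ h)// -EFinM; congr EFin.
have tu0 : 0 < 1 + t * u by rewrite ltr_pwDl// mulr_ge0// ltW.
have -> : 1 + t * u = t * (u + t^-1) by field; rewrite gt_eqF.
rewrite [(t * _) `^ _]powRM ?ltW// -!mulrA; congr (_ * _); rewrite mulrCA; congr (_ * _).
rewrite -expRD; congr expR; rewrite /q; field.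
by rewrite !gt_eqF//= (_ : u * t + 1 = 1 + t * u) ?gt_eqF//; ring.
Qed.

Lemma measurable_heat d' (T' : measurableType d') (D : set T') (f g h : T' -> R) :
  measurable_fun D f -> measurable_fun D g -> measurable_fun D h ->
  (forall y, 0 <= f y) ->
  measurable_fun D (fun y => heat (f y) (g y) (h y)).
Proof.
move=> mf mg mh f0; rewrite /heat.
apply: mfunM; first by mfun; apply: mfunV.
apply: (@measurableT_comp _ _ _ _ _ _ (icliff c) _ (fun y => g y * h y / f y ^+ 2)).
  exact: icliff_measurable.
by mfun; apply: mfunV; [mfun|move=> y; exact: sqr_ge0].
Qed.

End AbstractHankel.

(** * The transform attached to a Bessel measure *)

Definition bessel_transform d (T : measurableType d) (R : realType)
    (m : {measure set T -> \bar R}) (X : T -> R) (c : R) (f : T -> R) (y : T) :=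
  \int[m]_x (f x * jcliff c (X x * X y)).

Section BesselTransform.
Context d (T : measurableType d) (R : realType).
Variables (m : {sigma_finite_measure set T -> \bar R}) (X : T -> R) (c : R).
Hypothesis H : bessel_measure m X c.

Let mX := bm_measurable H.
Let X_gt0 := bm_gt0 H.
Let c_ge := bm_half H.
Let c0 : 0 < c. Proof. by apply: lt_le_trans c_ge; rewrite invr_gt0. Qed.
Let X0 y : 0 <= X y. Proof. exact: ltW. Qed.
Local Notation J := (jcliff c).

Variable f : T -> R.
Hypothesis intf : m.-integrable setT (EFin \o f).
Local Notation F := (bessel_transform m X c f).

Let mf : measurable_fun setT f.
Proof. by apply/measurable_EFinP; exact: measurable_int intf. Qed.

Lemma J_le1 x y : `|J (X x * X y)| <= 1.
Proof. by rewrite jcliff_bound// mulr_ge0. Qed.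

Lemma integrable_J y : m.-integrable setT (EFin \o (fun x => f x * J (X x * X y))).
Proof.
apply: le_integrable intf => //.
  by apply: mfun_EFin; apply: mfunM => //; apply: mfun_jcliff => //; mfun.
by move=> x _ /=; rewrite lee_fin normrM ler_piMr// J_le1.
Qed.

Definition l1norm := \int[m]_x `|f x|.

Lemma l1normE : (\int[m]_x `|f x|%:E = l1norm%:E)%E.
Proof.
rewrite /l1norm /Rintegral fineK//.
have h := integrable_norm intf.
exact: (integrable_fin_num measurableT h).
Qed.

Lemma bessel_transform_bound y : `|F y| <= l1norm.
Proof.
apply: le_trans (le_normr_Rintegral measurableT (integrable_J y)) _.
apply: le_Rintegral => //.
- exact: integrable_norm (integrable_J y).
- exact: integrable_norm intf.
- by move=> x _; rewrite normrM ler_piMr// J_le1.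
Qed.

Section Swap.
Variables (g : T -> R) (t B : R).
Hypotheses (t0 : 0 < t) (mg : measurable_fun setT g) (gB : forall y, `|g y| <= B).

(** The factor exp(- t X) makes this integrable on the product space. *)
Let k (z : T * T) := f z.1 * (expR (- (t * X z.2)) * g z.2 * J (X z.1 * X z.2)).

Let mk : measurable_fun setT k.
Proof.
apply: mfunM; first by mfun.
by apply: mfunM; [mfun|apply: mfun_jcliff => //; mfun].
Qed.

Let int_exp : m.-integrable setT (EFin \o (fun y => expR (- (t * X y)))).
Proof.
have := integrable_moment H 0 t0; apply: (eq_integrable _) => // y _ /=.
by rewrite expr0 mul1r.
Qed.

Let int_expJ x : m.-integrable setT
  (EFin \o (fun y => expR (- (t * X y)) * g y * J (X x * X y))).
Proof.
have := integrableZl measurableT B int_exp; apply: le_integrable => //.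
  apply: mfun_EFin; apply: mfunM; first by mfun.
  by apply: mfun_jcliff => //; mfun.
move=> y _ /=; rewrite lee_fin; apply: le_trans (ler_norm _).
rewrite !normrM ger0_norm ?expR_ge0// -mulrA mulrC ler_wpM2r ?expR_ge0//.
by rewrite -[leRHS]mulr1 ler_pM// J_le1.
Qed.

Let int_k : (m \x m)%E.-integrable setT (EFin \o k).
Proof.
apply/integrable12ltyP; first exact: mfun_EFin.
have B0 : 0 <= B by apply: le_trans (gB point).
pose K := \int[m]_y expR (- (t * X y)).
have KE : (\int[m]_y (expR (- (t * X y)))%:E = K%:E)%E.
  by rewrite /K /Rintegral fineK//; exact: (integrable_fin_num measurableT int_exp).
apply: (@le_lt_trans _ _ (\int[m]_x ((B * K)%:E * `|f x|%:E))%E); last first.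
  rewrite ge0_integralZl//=; last 2 first.
  - by apply: mfun_EFin; exact: measurableT_comp.
  - rewrite lee_fin mulr_ge0// /K; apply: Rintegral_ge0 => y _; exact: expR_ge0.
  by rewrite l1normE -EFinM ltry.
apply: ge0_le_integral => //=.
- by move=> x _; exact: integral_ge0.
- apply: (measurable_fun_fubini_tonelli_F (fun z => `|(k z)%:E|)%E) => //.
  by apply: measurableT_comp => //; exact: mfun_EFin.
- apply: measurable_funeM; apply: mfun_EFin; exact: measurableT_comp.
move=> x _; rewrite -EFinM mulrAC EFinM -KE -ge0_integralZl//=; last 2 first.
- by mfun.
- by rewrite lee_fin mulr_ge0.
apply: ge0_le_integral => //=.
- apply: mfun_EFin; apply: mfun_normr; exact: (mfun_section1 _ (f := fun x y => k (x, y))).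
- by apply: measurable_funeM; mfun.
move=> y _; rewrite -EFinM lee_fin /k/= !normrM [X in _ * (X * _ * _)]ger0_norm ?expR_ge0//.
rewrite (_ : B * _ * _ = `|f x| * (expR (- (t * X y)) * B)); last by ring.
rewrite ler_wpM2l// -mulrA ler_wpM2l ?expR_ge0//.
by rewrite -[leRHS]mulr1 ler_pM// J_le1.
Qed.

Let inner1 x : (\int[m]_y (k (x, y))%:E =
  (f x * \int[m]_y (expR (- (t * X y)) * g y * J (X x * X y)))%:E)%E.
Proof.
rewrite EFinM /Rintegral fineK; last exact: (integrable_fin_num measurableT (int_expJ x)).
by rewrite -(integralZl measurableT (int_expJ x)).
Qed.

Let inner2 y : (\int[m]_x (k (x, y))%:E = (expR (- (t * X y)) * g y * F y)%:E)%E.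
Proof.
rewrite [in RHS]EFinM /bessel_transform /Rintegral fineK;
  last exact: (integrable_fin_num measurableT (integrable_J y)).
rewrite -(integralZl measurableT (integrable_J y)).
by apply: eq_integral => x _; rewrite /k/= -EFinM; congr EFin; ring.
Qed.

Lemma bessel_transform_swap :
  \int[m]_y (expR (- (t * X y)) * g y * F y) =
  \int[m]_x (f x * \int[m]_y (expR (- (t * X y)) * g y * J (X x * X y))).
Proof.
apply: (congr1 fine (_ : \int[m]_y (expR (- (t * X y)) * g y * F y)%:E =
  \int[m]_x (f x * (\int[m]_y (expR (- (t * X y)) * g y * J (X x * X y))%R))%:E)%E).
transitivity (\int[m]_y \int[m]_x (k (x, y))%:E)%E.
  by apply: eq_integral => y _; rewrite inner2.
rewrite -(Fubini int_k); apply: eq_integral => x _; exact: inner1.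
Qed.

Lemma measurable_swapped : measurable_fun setT (fun y => expR (- (t * X y)) * g y * F y).
Proof.
apply/measurable_EFinP; have := measurable_fubini_G int_k.
by apply: eq_measurable_fun => y _; rewrite /fubini_G inner2.
Qed.

End Swap.

(** Fubini's theorem gives the measurability of exp(- X) F, and the exponential
    is then divided out. *)
Lemma measurable_bessel_transform : measurable_fun setT F.
Proof.
have h := @measurable_swapped (cst 1) 1 1 ltr01 (measurable_cst _) (fun=> eq_ind_r (fun z => z <= 1) (lexx _) (normr1 R)).
have -> : F = (fun y => expR (X y) * (expR (- (1 * X y)) * cst 1 y * F y)).
  by apply/funext => y; rewrite mul1r /= mulr1 mulrA -expRD subrr expR0 mul1r.
by apply: mfunM => //; mfun.
Qed.

End BesselTransform.

(** * Schur's test *)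

Section HeatSchur.
Context d (T : measurableType d) (R : realType).
Variables (m : {sigma_finite_measure set T -> \bar R}) (X : T -> R) (c : R).
Hypothesis H : bessel_measure m X c.

Let mX := bm_measurable H.
Let X_gt0 := bm_gt0 H.
Let c_ge := bm_half H.
Let X0 y : 0 <= X y. Proof. exact: ltW. Qed.
Local Notation J := (jcliff c).

Variable f : T -> R.
Hypothesis intf : m.-integrable setT (EFin \o f).
Local Notation F := (bessel_transform m X c f).

Let mf : measurable_fun setT f.
Proof. by apply/measurable_EFinP; exact: measurable_int intf. Qed.

(** Schur's test for the positive symmetric heat kernel, with weight phi. *)
Lemma heat_schur (phi : T -> R) t : 0 < t -> measurable_fun setT phi ->
  (forall x, 0 < phi x) ->
  (\int[m]_y (expR (- (t * X y)) * F y ^+ 2)%:E <=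
   \int[m]_x ((f x ^+ 2 / phi x)%:E * \int[m]_y (heat c t (X x) (X y) * phi y)%:E))%E.
Proof.
move=> t0 mphi phi0.
have mF := measurable_bessel_transform H intf.
have FB := bessel_transform_bound H intf.
have F2 y : 0 <= expR (- (t * X y)) * F y ^+ 2 by rewrite mulr_ge0 ?expR_ge0 ?sqr_ge0.
pose h x y := heat c t (X x) (X y).
have h0 x y : 0 <= h x y by exact: (heat_ge0 H).
have mh : measurable_fun setT (fun z : T * T => h z.1 z.2).
  apply: (measurable_heat H) => [| | |z]; [mfun|mfun|mfun|exact: ltW].
have GE x : bessel_transform m X c (fun y => expR (- (t * X y)) * F y) x = \int[m]_y (f y * h x y).
  rewrite /bessel_transform.
  transitivity (\int[m]_y (expR (- (t * X y)) * J (X x * X y) * F y)).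
    by apply: eq_Rintegral => y _; rewrite mulrAC (mulrC (X x)).
  rewrite (@bessel_transform_swap _ _ _ _ _ _ H _ intf (fun y => J (X x * X y)) t 1)//; last first.
  - by move=> y; exact: (J_le1 H).
  - by apply: mfun_jcliff => //; mfun.
  by apply: eq_Rintegral => y _; rewrite (bessel_heat H)//; congr (_ * _); exact: heatC.
have int_eF : m.-integrable setT (EFin \o (fun y => expR (- (t * X y)) * F y)).
  apply: (@integrable_bounded_exp _ _ _ _ _ _ H 0 t (l1norm m f)) => //; first by mfun.
  move=> y; rewrite expr0 mul1r normrM ger0_norm ?expR_ge0// mulrC.
  by rewrite ler_wpM2r ?expR_ge0// FB.
have mG := measurable_bessel_transform H int_eF.
have eq1 : \int[m]_y (expR (- (t * X y)) * F y ^+ 2) =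
    \int[m]_x (f x * \int[m]_y (f y * h x y)).
  transitivity (\int[m]_y (expR (- (t * X y)) * F y * F y)).
    by apply: eq_Rintegral => y _; rewrite -mulrA.
  rewrite (bessel_transform_swap H intf t0 mF FB).
  apply: eq_Rintegral => x _; congr (_ * _); rewrite -GE /bessel_transform.
  by apply: eq_Rintegral => y _; rewrite (mulrC (X x)).
have fin : (\int[m]_y (expR (- (t * X y)) * F y ^+ 2)%:E)%E \is a fin_num.
  apply: integrable_fin_num => //.
  apply: (@integrable_bounded_exp _ _ _ _ _ _ H 0 t (l1norm m f ^+ 2)) => //; first by mfun.
  move=> y; rewrite expr0 mul1r ger0_norm// mulrC ler_wpM2r ?expR_ge0//.
  by rewrite -[leLHS]real_normK ?num_real// lerXn2r ?nnegrE ?FB// (le_trans _ (FB y)).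
rewrite -(fineK fin) -[fine _]/(\int[m]_y (expR (- (t * X y)) * F y ^+ 2)) eq1.
have mff : measurable_fun setT (fun z : T * T => `|f z.1| * `|f z.2| * h z.1 z.2) by mfun.
have ffh0 x y : 0 <= `|f x| * `|f y| * h x y by apply: mulr_ge0 => //; exact: mulr_ge0.
have le1 : ((\int[m]_x (f x * \int[m]_y (f y * h x y)))%:E <=
    \int[m]_x \int[m]_y (`|f x| * `|f y| * h x y)%:E)%E.
  have mG' : measurable_fun setT (fun x => \int[m]_y (f y * h x y)).
    by have := mG; apply: eq_measurable_fun => x _; rewrite GE.
  have le2 := @abs_Rintegral_le _ _ _ m (fun x => f x * \int[m]_y (f y * h x y)) (mfunM mf mG').
  apply: le_trans (le_trans _ le2) _; first by rewrite lee_fin ler_norm.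
  apply: ge0_le_integral => //=.
  - by apply: mfun_EFin; apply: mfun_normr; exact: (mfunM mf mG').
  - exact: (measurable_ge0_integral2 m (f := fun x y => `|f x| * `|f y| * h x y) measurableT mff ffh0).
  move=> x _; rewrite normrM EFinM.
  under [leRHS]eq_integral do rewrite -mulrA EFinM.
  have mfh : measurable_fun setT (fun y => f y * h x y).
    by apply: mfunM => //; exact: (mfun_section1 _ mh).
  rewrite ge0_integralZl//=; last 2 first.
  - by apply: mfun_EFin; apply: mfunM; [mfun|exact: (mfun_section1 _ mh)].
  - by move=> y _; rewrite lee_fin mulr_ge0.
  apply: lee_wpmul2l => //; apply: (le_trans (abs_Rintegral_le _ mfh)).
  rewrite le_eqVlt; apply/orP; left; apply/eqP; apply: eq_integral => y _.
  by rewrite normrM [`|h x y|]ger0_norm.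
apply: (le_trans le1) => {le1}.
(* The arithmetic-geometric mean inequality, weighted by phi y / phi x, makes the
   form diagonal. *)
pose A x y := 2^-1 * (h x y * (f x ^+ 2 / phi x * phi y)).
have A0 x y : 0 <= A x y.
  rewrite /A; apply: mulr_ge0; first by rewrite invr_ge0.
  apply: mulr_ge0 => //; apply: mulr_ge0; last exact: ltW.
  by apply: divr_ge0; [exact: sqr_ge0|exact: ltW].
have mA : measurable_fun setT (fun z : T * T => A z.1 z.2).
  rewrite /A; apply: mfunM => //; apply: mfunM => //; apply: mfunM; last by mfun.
  by apply: mfunM; [mfun|apply: mfunV => [|z]; [mfun|exact: ltW]].
have amgm x y : `|f x| * `|f y| * h x y <= A x y + A y x.
  rewrite /A (_ : h y x = h x y); last exact: heatC.
  have px := phi0 x; have py := phi0 y.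
  rewrite (_ : _ + _ = (2^-1 * (f x ^+ 2 / phi x * phi y + f y ^+ 2 / phi y * phi x)) * h x y); last by ring.
  rewrite ler_wpM2r// -(real_normK (num_real (f x))) -(real_normK (num_real (f y))).
  rewrite -subr_ge0 (_ : _ - _ = (2 * phi x * phi y)^-1 * (`|f x| * phi y - `|f y| * phi x) ^+ 2).
    by rewrite mulr_ge0 ?sqr_ge0// invr_ge0 !mulr_ge0// ltW.
  by field; rewrite !gt_eqF.
apply: (@le_trans _ _ (\int[m]_x \int[m]_y (A x y + A y x)%:E)%E).
  have mAA : measurable_fun setT (fun z : T * T => A z.1 z.2 + A z.2 z.1).
    by apply: mfunD => //; exact: (mfun_swap mA).
  apply: ge0_le_integral => //=.
  - by move=> x _; apply: integral_ge0 => y _; rewrite lee_fin.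
  - exact: (measurable_ge0_integral2 m (f := fun x y => `|f x| * `|f y| * h x y) measurableT mff ffh0).
  - apply: (measurable_ge0_integral2 m (f := fun x y => A x y + A y x)) => // x y.
    by rewrite addr_ge0.
  move=> x _; apply: ge0_le_integral => //=.
  - by move=> y _; rewrite lee_fin.
  - exact: mfun_EFin (mfun_section1 _ (f := fun x y => `|f x| * `|f y| * h x y) mff).
  - exact: mfun_EFin (mfun_section1 _ (f := fun x y => A x y + A y x) mAA).
  by move=> y _; rewrite lee_fin amgm.
rewrite (@ge0_integral2D _ _ _ _ _ m m A (fun x y => A y x))//; last exact: (mfun_swap mA).
rewrite -[X in (_ + X)%E](@ge0_integral_swap _ _ _ _ _ m m setT setT A)//.
rewrite -(@ge0_integral2D _ _ _ _ _ m m A A)//.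
rewrite le_eqVlt; apply/orP; left; apply/eqP; apply: eq_integral => x _.
rewrite -ge0_integralZl//=.
- by apply: eq_integral => y _; rewrite -EFinM; congr EFin; rewrite /A /h; field; rewrite gt_eqF.
- by apply: mfun_EFin; apply: mfunM => //; exact: (mfun_section1 x mh).
- by move=> y _; rewrite lee_fin; apply: mulr_ge0; [exact: h0|exact: ltW].
- by rewrite lee_fin; apply: divr_ge0; [exact: sqr_ge0|exact: ltW].
Qed.

End HeatSchur.

(** * The integral in the Schur test *)

Section BetaIntegrals.
Context {R : realType}.
Local Notation mu := (@lebesgue_measure R).
Implicit Types (a b q s c x t u w z : R).

Lemma powRDgt0 x a b : 0 < x -> x `^ (a + b) = x `^ a * x `^ b.
Proof. by move=> x0; rewrite powRD// (gt_eqF x0) implybT. Qed.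

Lemma beta_integral a q : 0 < a -> a < q ->
  (\int[mu]_(w in `]0%R, +oo[) (w `^ (a - 1) * (1 + w) `^ (- q))%:E =
   (sGamma a * sGamma (q - a) / sGamma q)%:E)%E.
Proof.
move=> a0 aq; have q0 : 0 < q by exact: lt_trans aq.
have qa0 : 0 < q - a by rewrite subr_gt0.
have G0 := sGamma_gt0 q0.
transitivity (\int[mu]_(w in `]0%R, +oo[) ((sGamma q)^-1%:E *
  \int[mu]_(z in `]0%R, +oo[) (w `^ (a - 1) * (z `^ (q - 1) * expR (- ((1 + w) * z))))%:E))%E.
  apply: eq_integral => w; rewrite inE/= in_itv/= andbT => w0.
  under eq_integral do rewrite EFinM.
  rewrite ge0_integralZl//=; last 3 first.
  - by mfun.
  - by move=> z _; rewrite lee_fin mulr_ge0 ?powR_ge0 ?expR_ge0.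
  - by rewrite lee_fin powR_ge0.
  rewrite sGamma_integral_scale//; last by rewrite addr_gt0.
  by rewrite -!EFinM; congr EFin; field; rewrite gt_eqF.
rewrite ge0_integralZl//=; last 3 first.
- apply: measurable_funTS.
  apply: (measurable_ge0_integral2 mu (f := fun w z => w `^ (a - 1) * (z `^ (q - 1) * expR (- ((1 + w) * z))))) => //.
    by mfun.
  by move=> w z; rewrite !mulr_ge0 ?powR_ge0 ?expR_ge0.
- by move=> w _; apply: integral_ge0 => z _; rewrite lee_fin !mulr_ge0 ?powR_ge0 ?expR_ge0.
- by rewrite lee_fin invr_ge0 ltW.
rewrite ge0_integral_swap//; last 2 first.
- by mfun.
- by move=> w z; rewrite !mulr_ge0 ?powR_ge0 ?expR_ge0.
rewrite (_ : sGamma a * _ / _ = (sGamma q)^-1 * (sGamma a * sGamma (q - a))); last by ring.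
rewrite EFinM; congr (_ * _)%E; rewrite EFinM -[(sGamma (q - a))%:E]sGamma_integral//.
rewrite -ge0_integralZl//=; last 3 first.
- by rewrite /gamma_density; mfun.
- by move=> z _; rewrite lee_fin gamma_density_ge0.
- by rewrite lee_fin ltW// sGamma_gt0.
apply: eq_integral => z; rewrite inE/= in_itv/= andbT => z0.
transitivity ((z `^ (q - 1) * expR (- z))%:E *
    \int[mu]_(w in `]0%R, +oo[) (w `^ (a - 1) * expR (- (z * w)))%:E)%E.
  rewrite -ge0_integralZl//=; last 3 first.
  - by mfun.
  - by move=> w _; rewrite lee_fin mulr_ge0 ?powR_ge0 ?expR_ge0.
  - by rewrite lee_fin mulr_ge0 ?powR_ge0 ?expR_ge0.
  apply: eq_integral => w _; rewrite -EFinM; congr EFin.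
  by rewrite mulrDl mul1r opprD expRD (mulrC w); ring.
rewrite sGamma_integral_scale// -!EFinM; congr EFin; rewrite /gamma_density.
rewrite (_ : q - a - 1 = (q - 1) + (- a)); last by ring.
by rewrite (powRDgt0 (q - 1))//; ring.
Qed.

(** u^(s - 1) times the image of exp(- u X) under the heat kernel. The inverse of
    1 + t u is written as a power, which is jointly measurable. *)
Definition schur_kernel s c x t u :=
  u `^ (s - 1) * ((1 + t * u) `^ (- c) * expR (- (u * x * (1 + t * u) `^ (- 1)))).

Lemma schur_kernel_ge0 s c x t u : 0 <= schur_kernel s c x t u.
Proof. by rewrite !mulr_ge0 ?powR_ge0 ?expR_ge0. Qed.

Lemma continuous_powR_affine p u t : 0 < 1 + t * u ->
  {for t, continuous (fun t => (1 + t * u) `^ p)}.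
Proof.
move=> tu; apply: (@continuous_comp _ _ _ (fun t => 1 + t * u) (fun z => z `^ p)).
  apply: continuousD; first exact: cvg_cst.
  exact: mulrr_continuous.
exact: powR_continuous.
Qed.

(** Substituting t = w / u makes the exponential a gamma density in u, and
    leaves a beta integral in w. *)
Lemma schur_integral a s c x : 0 < a -> a < s -> s < c -> 0 < x ->
  (\int[mu]_(t in `]0%R, +oo[) \int[mu]_(u in `]0%R, +oo[)
     (t `^ (a - 1) * schur_kernel s c x t u)%:E =
   (sGamma a * (sGamma (s - a) * sGamma (c - s) / sGamma (c - s + a)) * x `^ (a - s))%:E)%E.
Proof.
move=> a0 as0 sc x0.
have sa0 : 0 < s - a by rewrite subr_gt0.
have cs0 : 0 < c - s by rewrite subr_gt0.
have s0 : 0 < s by exact: lt_trans as0.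
rewrite ge0_integral_swap//; last 2 first.
- by rewrite /schur_kernel; mfun.
- by move=> t u; rewrite mulr_ge0 ?powR_ge0 ?schur_kernel_ge0.
pose G w u := w `^ (a - 1) * (1 + w) `^ (- c) * (u `^ (s - a - 1) * expR (- (x * (1 + w) `^ (- 1) * u))).
transitivity (\int[mu]_(u in `]0%R, +oo[) \int[mu]_(w in `]0%R, +oo[) (G w u)%:E)%E.
  apply: eq_integral => u; rewrite inE/= in_itv/= andbT => u0.
  rewrite (@ge0_integral_subst_powR _ (fun t => t `^ (a - 1) * schur_kernel s c x t u) u^-1 1)//; last 3 first.
  - by rewrite invr_gt0.
  - move=> t t0; have tu : 0 < 1 + t * u by rewrite addr_gt0// mulr_gt0.
    apply: continuousM; first exact: powR_continuous.
    apply: continuousM; first exact: cvg_cst.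
    apply: continuousM; first exact: continuous_powR_affine.
    apply: continuous_comp; last exact: continuous_expR.
    apply: continuousN; apply: continuousM; first exact: cvg_cst.
    exact: continuous_powR_affine.
  - by move=> t _; rewrite mulr_ge0 ?powR_ge0 ?schur_kernel_ge0.
  apply: eq_integral => w; rewrite inE/= in_itv/= andbT => w0; congr EFin.
  rewrite powRr1 ?(ltW w0)// subrr powRr0 !mulr1 /schur_kernel /G.
  rewrite (_ : u^-1 * w * u = w); last by field; rewrite gt_eqF.
  rewrite powRM ?invr_ge0 ?(ltW u0) ?(ltW w0)//.
  have -> : u^-1 `^ (a - 1) = u `^ (1 - a).
    by rewrite -powR_inv1 ?(ltW u0)// -powRrM; congr (_ `^ _); ring.
  rewrite (_ : - (x * (1 + w) `^ (- 1) * u) = - (u * x * (1 + w) `^ (- 1))); last by ring.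
  have -> : u `^ (s - a - 1) = u `^ (1 - a) * u `^ (s - 1) * u^-1.
    rewrite -[u^-1]powR_inv1 ?(ltW u0)// -!powRDgt0//; congr (_ `^ _); ring.
  ring.
rewrite -ge0_integral_swap//; last 2 first.
- by rewrite /G; mfun.
- by move=> w u; rewrite !mulr_ge0 ?powR_ge0 ?expR_ge0.
rewrite (_ : sGamma a * _ * _ = (sGamma (s - a) * x `^ (a - s)) * (sGamma a * sGamma (c - s + a - a) / sGamma (c - s + a))); last first.
  by rewrite addrK; ring.
rewrite EFinM -beta_integral//; last by rewrite ltrDr.
rewrite -ge0_integralZl//=; last 3 first.
- by mfun.
- by move=> z _; rewrite lee_fin mulr_ge0 ?powR_ge0.
- by rewrite lee_fin mulr_ge0 ?powR_ge0// ltW// sGamma_gt0.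
apply: eq_integral => w; rewrite inE/= in_itv/= andbT => w0.
have w1 : 0 < 1 + w by rewrite addr_gt0.
under eq_integral do rewrite /G EFinM.
rewrite ge0_integralZl//=; last 3 first.
- by mfun.
- by move=> u _; rewrite lee_fin mulr_ge0 ?powR_ge0 ?expR_ge0.
- by rewrite lee_fin mulr_ge0 ?powR_ge0.
rewrite sGamma_integral_scale// ?mulr_gt0 ?powR_gt0// -!EFinM; congr EFin.
have -> : (x * (1 + w) `^ (- 1)) `^ (- (s - a)) = x `^ (a - s) * (1 + w) `^ (s - a).
  rewrite powRM ?powR_ge0 ?ltW// opprB; congr (_ * _).
  by rewrite -powRrM; congr (_ `^ _); ring.
rewrite (_ : - (c - s + a) = - c + (s - a)); last by ring.
by rewrite (powRDgt0 (- c))//; ring.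
Qed.

End BetaIntegrals.

(** * The upper bound *)

Section PittUpper.
Context d (T : measurableType d) (R : realType).
Variables (m : {sigma_finite_measure set T -> \bar R}) (X : T -> R) (c : R).
Hypothesis H : bessel_measure m X c.
Local Notation mu := (@lebesgue_measure R).

Let mX := bm_measurable H.
Let X_gt0 := bm_gt0 H.
Let c_ge := bm_half H.
Let X0 y : 0 <= X y. Proof. exact: ltW. Qed.

(** X^(-s) is a superposition of the exponentials exp(- u X), on which the heat
    kernel acts explicitly. *)
Lemma heat_powR s t x : 0 < s -> 0 < t -> 0 <= x ->
  (\int[m]_y (heat c t x (X y) * X y `^ (- s))%:E =
   (sGamma s)^-1%:E * \int[mu]_(u in `]0%R, +oo[) (schur_kernel s c x t u)%:E)%E.
Proof.
move=> s0 t0 x0; have G0 := sGamma_gt0 s0.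
have mh : measurable_fun setT (fun y => heat c t x (X y)).
  by apply: (measurable_heat H) => [| | |z]; [mfun|mfun|mfun|exact: ltW].
have h0 y : 0 <= heat c t x (X y) by exact: (heat_ge0 H).
pose k u y := u `^ (s - 1) * (heat c t x (X y) * expR (- (u * X y))).
have k0 u y : 0 <= k u y by rewrite mulr_ge0 ?powR_ge0// mulr_ge0 ?expR_ge0.
have mk : measurable_fun setT (fun z : R * T => k z.1 z.2).
  rewrite /k; apply: mfunM; [mfun|apply: mfunM; last by mfun].
  exact: (@measurableT_comp _ _ _ _ _ _ (fun y => heat c t x (X y)) _ (fun z : R * T => z.2) mh measurable_snd).
transitivity ((sGamma s)^-1%:E * \int[mu]_(u in `]0%R, +oo[) \int[m]_y (k u y)%:E)%E.
  rewrite ge0_integral_swap//.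
  rewrite -ge0_integralZl//=; last 3 first.
  - exact: (measurable_ge0_integral2 mu (f := fun y u => k u y) _ (mfun_swap mk)).
  - by move=> y _; apply: integral_ge0 => u _; rewrite lee_fin.
  - by rewrite lee_fin invr_ge0 ltW.
  apply: eq_integral => y _; under eq_integral do rewrite /k mulrCA EFinM.
  rewrite ge0_integralZl//=; last 3 first.
  - by mfun.
  - by move=> u _; rewrite lee_fin mulr_ge0 ?powR_ge0 ?expR_ge0.
  - by rewrite lee_fin.
  under eq_integral do rewrite mulrC.
  under eq_integral do rewrite mulrC (mulrC _ (X y)).
  rewrite sGamma_integral_scale// -!EFinM; congr EFin.
  by field; rewrite gt_eqF.
congr (_ * _)%E; apply: eq_integral => u; rewrite inE/= in_itv/= andbT => u0.
rewrite /k; under eq_integral do rewrite EFinM.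
rewrite ge0_integralZl//=; last 3 first.
- by apply: mfun_EFin; apply: mfunM => //; mfun.
- by move=> y _; rewrite lee_fin mulr_ge0 ?expR_ge0.
- by rewrite lee_fin powR_ge0.
rewrite (heat_gauss H)// ?ltW// -EFinM /schur_kernel powR_inv1//.
by rewrite addr_ge0// mulr_ge0// ltW.
Qed.

Variable f : T -> R.
Hypothesis intf : m.-integrable setT (EFin \o f).
Local Notation F := (bessel_transform m X c f).

Let mf : measurable_fun setT f.
Proof. by apply/measurable_EFinP; exact: measurable_int intf. Qed.

(** The heat semigroup contracts L2, and the weight exp(- t X) increases to 1
    as t decreases to 0. *)
Lemma bessel_transform_contract :
  (\int[m]_y (F y ^+ 2)%:E <= \int[m]_x (f x ^+ 2)%:E)%E.
Proof.
have mF := measurable_bessel_transform H intf.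
pose t n : R := n.+1%:R^-1.
have t0 n : 0 < t n by rewrite invr_gt0.
have le n : (\int[m]_y (expR (- (t n * X y)) * F y ^+ 2)%:E <= \int[m]_x (f x ^+ 2)%:E)%E.
  have p1 x : 0 < (cst 1 : T -> R) x by [].
  have hs := heat_schur H intf (t0 n) (measurable_cst (1 : R)) p1.
  apply: (le_trans hs).
  rewrite le_eqVlt; apply/orP; left; apply/eqP; apply: eq_integral => x _.
  rewrite divr1 -[RHS]mule1; congr (_ * _)%E.
  have := heat_gauss H (t0 n) (lexx 0) (X0 x).
  rewrite mulr0 addr0 powR1 mul0r mul0r oppr0 expR0 mulr1 => <-.
  by apply: eq_integral => y _; rewrite mul0r oppr0 expR0.
have := @cvg_monotone_convergence _ _ _ m setT measurableT
  (fun n y => (expR (- (t n * X y)) * F y ^+ 2)%:E).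
have limE y : limn (fun n => (expR (- (t n * X y)) * F y ^+ 2)%:E) = (F y ^+ 2)%:E.
  apply/cvg_lim => //; apply/cvg_EFin; first exact: nearW.
  rewrite -[X in _ --> X]mul1r; apply: cvgM; last exact: cvg_cst.
  have h : - (t n * X y) @[n --> \oo] --> (0 : R).
    rewrite -[X in _ --> X]oppr0 -[X in _ --> - X](mul0r (X y)).
    by apply: cvgN; apply: cvgM; [exact: cvg_harmonic|exact: cvg_cst].
  rewrite -expR0; apply: (cvg_comp _ _ h); exact: continuous_expR.
under [X in _ --> X]eq_integral do rewrite limE.
move=> cv; have {}cv := cv _ _ _.
have cv1 : (\int[m]_y (expR (- (t n * X y)) * F y ^+ 2)%:E @[n --> \oo] --> \int[m]_y (F y ^+ 2)%:E)%E.
  apply: cv.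
  - by move=> n; mfun.
  - by move=> n y _; rewrite lee_fin mulr_ge0 ?expR_ge0 ?sqr_ge0.
  - move=> y _ n k nk; rewrite lee_fin ler_wpM2r ?sqr_ge0// ler_expR lerN2.
    by rewrite ler_wpM2r// lef_pV2 ?posrE// ler_nat.
rewrite -(cvg_lim _ cv1)//; apply: lime_le; first by apply/cvg_ex; eexists; exact: cv1.
exact: nearW.
Qed.

(** Average [heat_schur] over t with weight t^(2 b - 1), which turns exp(- t X)
    into Gamma(2 b) X^(-2 b). The exponent c/2 + b of the Schur weight makes the
    two gamma factors s - a and c - s of [schur_integral] both equal to
    c/2 - b. *)
Lemma pitt_upper b : 0 <= b -> b < c / 2 ->
  (\int[m]_y (X y `^ (- (2 * b)) * F y ^+ 2)%:E <=
   ((sGamma (c / 2 - b) / sGamma (c / 2 + b)) ^+ 2)%:E *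
     \int[m]_x (X x `^ (2 * b) * f x ^+ 2)%:E)%E.
Proof.
have mF := measurable_bessel_transform H intf.
have c0 : 0 < c by apply: lt_le_trans c_ge; rewrite invr_gt0.
(* For b = 0 the factor Gamma(2 b) is infinite, hence the separate argument. *)
rewrite le_eqVlt => /predU1P[<- _|b0 bc].
  rewrite mulr0 oppr0 !addr0 divff; last by rewrite gt_eqF// sGamma_gt0 ?divr_gt0.
  rewrite expr1n mul1e; under eq_integral do rewrite powRr0 mul1r.
  by under [leRHS]eq_integral do rewrite powRr0 mul1r; exact: bessel_transform_contract.
pose s := c / 2 + b; pose a := 2 * b.
have s0 : 0 < s by rewrite /s; lra.
have a0 : 0 < a by rewrite /a; lra.
have as0 : a < s by rewrite /s /a; lra.
have sc : s < c by rewrite /s; lra.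
have Ga := sGamma_gt0 a0; have Gs := sGamma_gt0 s0.
pose phi x := X x `^ (- s).
have phi0 x : 0 < phi x by exact: powR_gt0.
have mphi : measurable_fun setT phi by rewrite /phi; mfun.
have F20 y : 0 <= F y ^+ 2 by exact: sqr_ge0.
rewrite -(@lee_pmul2l _ (sGamma a)%:E) ?lte_fin//.
have -> : ((sGamma a)%:E * \int[m]_y (X y `^ (- (2 * b)) * F y ^+ 2)%:E =
   \int[mu]_(t in `]0%R, +oo[) \int[m]_y (t `^ (a - 1) * (expR (- (t * X y)) * F y ^+ 2))%:E)%E.
  rewrite ge0_integral_swap//; last 2 first.
  - by mfun.
  - by move=> t y; rewrite mulr_ge0 ?powR_ge0// mulr_ge0 ?expR_ge0.
  rewrite -ge0_integralZl//=; last 3 first.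
  - by mfun.
  - by move=> y _; rewrite lee_fin mulr_ge0 ?powR_ge0.
  - by rewrite lee_fin ltW.
  apply: eq_integral => y _; rewrite -EFinM mulrA EFinM -sGamma_integral_scale//.
  rewrite -ge0_integralZr//=; last 3 first.
  - by mfun.
  - by move=> t _; rewrite lee_fin mulr_ge0 ?powR_ge0 ?expR_ge0.
  - by rewrite lee_fin.
  by apply: eq_integral => t _; rewrite -EFinM (mulrC (X y)) -mulrA.
pose S x t := (\int[mu]_(u in `]0%R, +oo[) (t `^ (a - 1) * schur_kernel s c (X x) t u)%:E)%E.
have S0 x t : (0 <= S x t)%E.
  by apply: integral_ge0 => u _; rewrite lee_fin mulr_ge0 ?powR_ge0 ?schur_kernel_ge0.
have mS : measurable_fun setT (fun z : T * R => S z.1 z.2).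
  apply: (measurable_ge0_integral2 mu
    (f := fun (z : T * R) u => z.2 `^ (a - 1) * schur_kernel s c (X z.1) z.2 u)) => //.
    rewrite /schur_kernel.
    pose p1 (z : (T * R) * R) := X z.1.1; pose p2 (z : (T * R) * R) := z.1.2.
    have mp1 : measurable_fun setT p1.
      by apply: (mfun_fst _ (f := fun z : T * R => X z.1)); mfun.
    have mp2 : measurable_fun setT p2.
      by apply: (mfun_fst _ (f := fun z : T * R => z.2)); mfun.
    rewrite -[X in measurable_fun _ X]/(fun z : (T * R) * R => p2 z `^ (a - 1) *
      (z.2 `^ (s - 1) * ((1 + p2 z * z.2) `^ (- c) * expR (- (z.2 * p1 z * (1 + p2 z * z.2) `^ (-1)))))).
    by mfun.
  by move=> z u; rewrite mulr_ge0 ?powR_ge0 ?schur_kernel_ge0.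
have w0 x : 0 <= f x ^+ 2 / phi x / sGamma s.
  by rewrite !divr_ge0 ?sqr_ge0 ?ltW.
have mw : measurable_fun setT (fun x => f x ^+ 2 / phi x / sGamma s).
  by apply: mfunM; [apply: mfunM; [mfun|apply: mfunV => // x; exact: ltW]|mfun].
have mw1 : measurable_fun setT (fun z : T * R => (f z.1 ^+ 2 / phi z.1 / sGamma s)%:E * S z.1 z.2)%E.
  apply: emeasurable_funM => //; apply: mfun_EFin.
  exact: (@measurableT_comp _ _ _ _ _ _ (fun x => f x ^+ 2 / phi x / sGamma s) _ (fun z : T * R => z.1) mw measurable_fst).
apply: (@le_trans _ _ (\int[mu]_(t in `]0%R, +oo[) \int[m]_x ((f x ^+ 2 / phi x / sGamma s)%:E * S x t))%E).
  apply: ge0_le_integral => //=.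
  - by move=> t _; apply: integral_ge0 => y _; rewrite lee_fin mulr_ge0 ?powR_ge0// mulr_ge0 ?expR_ge0.
  - apply: measurable_funTS; apply: (measurable_ge0_integral2 m
      (f := fun t y => t `^ (a - 1) * (expR (- (t * X y)) * F y ^+ 2))) => //; first by mfun.
    by move=> t y; rewrite mulr_ge0 ?powR_ge0// mulr_ge0 ?expR_ge0.
  - apply: measurable_funTS.
    apply: (measurable_fun_fubini_tonelli_G (fun z : T * R => ((f z.1 ^+ 2 / phi z.1 / sGamma s)%:E * S z.1 z.2)%E)).
      exact: mw1.
    by move=> z; rewrite mule_ge0// lee_fin.
  move=> t; rewrite in_itv/= andbT => t0.
  under eq_integral do rewrite EFinM.
  rewrite ge0_integralZl//=; last 3 first.
  - by mfun.
  - by move=> y _; rewrite lee_fin mulr_ge0 ?expR_ge0.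
  - by rewrite lee_fin powR_ge0.
  apply: (le_trans (lee_wpmul2l _ (heat_schur H intf t0 mphi phi0))); first by rewrite lee_fin powR_ge0.
  rewrite -ge0_integralZl//=; last 3 first.
  - apply: emeasurable_funM; first by apply: mfun_EFin; apply: mfunM; [mfun|apply: mfunV => // x; exact: ltW].
    apply: (measurable_ge0_integral2 m (f := fun x y => heat c t (X x) (X y) * phi y)) => //.
      apply: mfunM; last by mfun.
      by apply: (measurable_heat H) => [| | |z]; [mfun|mfun|mfun|exact: ltW].
    by move=> x y; apply: mulr_ge0; [exact: (heat_ge0 H)|exact: ltW].
  - move=> x _; apply: mule_ge0; first by rewrite lee_fin divr_ge0 ?sqr_ge0 ?ltW.
    by apply: integral_ge0 => y _; rewrite lee_fin; apply: mulr_ge0; [exact: (heat_ge0 H)|exact: ltW].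
  - by rewrite lee_fin powR_ge0.
  rewrite le_eqVlt; apply/orP; left; apply/eqP; apply: eq_integral => x _.
  rewrite heat_powR// /S.
  under [in RHS]eq_integral do rewrite EFinM.
  rewrite [in RHS]ge0_integralZl//=; last 3 first.
  - by rewrite /schur_kernel; mfun.
  - by move=> u _; rewrite lee_fin schur_kernel_ge0.
  - by rewrite lee_fin powR_ge0.
  by rewrite !muleA -!EFinM; congr (_%:E * _)%E; ring.
rewrite -(@ge0_eintegral_swap _ _ _ _ _ m mu setT _ (fun x t => (f x ^+ 2 / phi x / sGamma s)%:E * S x t)%E)//; last first.
  by move=> x t; rewrite mule_ge0// lee_fin.
rewrite -ge0_integralZl//=; last 3 first.
- by mfun.
- by move=> x _; rewrite lee_fin mulr_ge0 ?powR_ge0 ?sqr_ge0.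
- by rewrite lee_fin sqr_ge0.
rewrite -ge0_integralZl//=; last 3 first.
- by mfun.
- by move=> x _; rewrite lee_fin mulr_ge0 ?sqr_ge0// mulr_ge0 ?powR_ge0 ?sqr_ge0.
- by rewrite lee_fin ltW.
rewrite le_eqVlt; apply/orP; left; apply/eqP; apply: eq_integral => x _.
have mSx : measurable_fun `](0:R), +oo[ (S x).
  by apply: measurable_funTS; exact: (measurableT_comp mS (pair1_measurable x)).
have -> : (\int[mu]_(t in `]0%R, +oo[) ((f x ^+ 2 / phi x / sGamma s)%:E * S x t) =
    (f x ^+ 2 / phi x / sGamma s)%:E * \int[mu]_(t in `]0%R, +oo[) S x t)%E.
  by apply: ge0_integralZl => //; rewrite lee_fin.
rewrite (schur_integral a0 as0 sc (X_gt0 x)) -!EFinM; congr EFin.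
rewrite (_ : s - a = c / 2 - b); last by rewrite /s /a; field.
rewrite (_ : c - s = c / 2 - b); last by rewrite /s; field.
rewrite (_ : c / 2 - b + a = s); last by rewrite /s /a; field.
rewrite /phi powRN -/s (_ : X x `^ (2 * b) = X x `^ s * X x `^ (a - s)).
  by field; rewrite !gt_eqF ?powR_gt0.
by rewrite -powRDgt0//; congr (_ `^ _); rewrite /a; ring.
Qed.

End PittUpper.

(** * Pairings that test the constant *)

Section PittLower.
Context d (T : measurableType d) (R : realType).
Variables (m : {sigma_finite_measure set T -> \bar R}) (X : T -> R) (c : R).
Hypothesis H : bessel_measure m X c.
Local Notation mu := (@lebesgue_measure R).

Let mX := bm_measurable H.
Let X_gt0 := bm_gt0 H.
Let c_ge := bm_half H.
Let X0 y : 0 <= X y. Proof. exact: ltW. Qed.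
Let c0 : 0 < c. Proof. by apply: lt_le_trans c_ge; rewrite invr_gt0. Qed.

Lemma integral_laplace_power s y : 0 < s ->
  (\int[mu]_(u in `]0%R, +oo[) (u `^ (s - 1) * expR (- u) * expR (- (u * X y)))%:E =
   (sGamma s * (1 + X y) `^ (- s))%:E)%E.
Proof.
move=> s0; rewrite -sGamma_integral_scale ?addr_gt0//.
apply: eq_integral => u _; congr EFin; rewrite -mulrA -expRD; congr (_ * expR _).
ring.
Qed.

(** Writing (1 + X)^(-s) as a superposition of exponentials reduces this beta
    integral to the moments of X. *)
Lemma integral_affine_power q s : 0 <= q -> c + q < s ->
  (\int[m]_y (X y `^ q * (1 + X y) `^ (- s))%:E =
   (sGamma (c + q) * sGamma (s - (c + q)) / (sGamma c * sGamma s))%:E)%E.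
Proof.
move=> q0 qs; have cq0 : 0 < c + q by rewrite ltr_wpDr.
have s0 : 0 < s by exact: lt_trans qs.
have d0 : 0 < s - (c + q) by rewrite subr_gt0.
have Gs := sGamma_gt0 s0; have Gc := sGamma_gt0 c0.
pose k y u := X y `^ q * (u `^ (s - 1) * expR (- u) * expR (- (u * X y))).
have k0 y u : 0 <= k y u by rewrite !mulr_ge0 ?powR_ge0 ?expR_ge0.
have mk : measurable_fun setT (fun z : T * R => k z.1 z.2) by rewrite /k; mfun.
transitivity (\int[m]_y ((sGamma s)^-1%:E * \int[mu]_(u in `]0%R, +oo[) (k y u)%:E))%E.
  apply: eq_integral => y _; under eq_integral do rewrite /k EFinM.
  rewrite ge0_integralZl//=; last 3 first.
  - by mfun.
  - by move=> u _; rewrite lee_fin !mulr_ge0 ?powR_ge0 ?expR_ge0.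
  - by rewrite lee_fin powR_ge0.
  by rewrite integral_laplace_power// -!EFinM; congr EFin; field; rewrite gt_eqF.
rewrite ge0_integralZl//=; last 3 first.
- exact: (measurable_ge0_integral2 mu (f := k) _ mk).
- by move=> y _; apply: integral_ge0 => u _; rewrite lee_fin.
- by rewrite lee_fin invr_ge0 ltW.
rewrite ge0_integral_swap//.
have e : (\int[mu]_(u in `]0%R, +oo[) \int[m]_y (k y u)%:E =
   \int[mu]_(u in `]0%R, +oo[) ((sGamma (c + q) / sGamma c)%:E * (gamma_density (s - (c + q)) u)%:E))%E.
  apply: eq_integral => u; rewrite inE/= in_itv/= andbT => u0.
  transitivity ((u `^ (s - 1) * expR (- u))%:E * \int[m]_y (X y `^ q * expR (- (u * X y)))%:E)%E.
    rewrite -ge0_integralZl//=; last 3 first.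
    - by mfun.
    - by move=> y _; rewrite lee_fin mulr_ge0 ?powR_ge0 ?expR_ge0.
    - by rewrite lee_fin mulr_ge0 ?powR_ge0 ?expR_ge0.
    by apply: eq_integral => y _; rewrite -EFinM; congr EFin; rewrite /k; ring.
  rewrite (bm_moment H)// -!EFinM; congr EFin.
  rewrite /gamma_density (_ : s - (c + q) - 1 = (s - 1) + (- (c + q))); last by ring.
  by rewrite (powRDgt0 (s - 1))//; ring.
rewrite e ge0_integralZl//=; last 3 first.
- by rewrite /gamma_density; mfun.
- by move=> u _; rewrite lee_fin gamma_density_ge0.
- by rewrite lee_fin divr_ge0// ltW// sGamma_gt0.
rewrite sGamma_integral// -!EFinM; congr EFin; field.
by rewrite !gt_eqF.
Qed.

Variables (b dl : R).
Hypotheses (b0 : 0 <= b) (bc : b < c / 2) (dl0 : 0 < dl) (dlc : dl < c / 2 + b).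
Let tau := c / 2 + b + dl.
Let p := c / 2 + b - dl.
Let tau0 : 0 < tau. Proof. by rewrite /tau; move: b0 c0 dl0; lra. Qed.
Let p0 : 0 < p. Proof. by rewrite /p; move: dlc; lra. Qed.
Let pc : p < c. Proof. by rewrite /p; move: bc dl0; lra. Qed.
Lemma bernoulli_powRN (q z : R) : 0 <= q -> 0 <= z -> 1 - q * z <= (1 + z) `^ (- q).
Proof.
move=> q0 z0; have z1 : 0 < 1 + z by rewrite ltr_pwDl.
rewrite /powR gt_eqF//; apply: le_trans (expR_ge1Dx _).
by rewrite lerD2l mulNr lerN2 ler_wpM2l// le_ln1Dx// (lt_le_trans _ z0)// ltrN10.
Qed.

(** The value of the pairing of Gamma(tau) (1 + X)^(-tau) with the transform of
    f, computed by writing the former as a superposition of the Gaussians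
    exp(- u X) and transforming each of them. *)
Definition test_pairing (f : T -> R) := (\int[mu]_(u in `]0%R, +oo[)
  \int[m]_x (f x * (u `^ (tau - 1) * expR (- u) * (u `^ (- c) * expR (- (X x * u `^ (-1))))))%:E)%E.

(** The inner integral is a moment of X. The outer one would be Gamma(2 dl) but
    for a factor (1 + u / 2)^(-(c - p)), which Bernoulli's inequality bounds below
    at the cost of a term of relative size dl. *)
Lemma test_pairing_lower :
  ((sGamma (c - p) / sGamma c * sGamma (2 * dl) * (1 - c * dl))%:E <=
    test_pairing (fun x => X x `^ (- p) * expR (- (2^-1 * X x)))%R)%E.
Proof.
have cp0 : 0 < c - p by rewrite subr_gt0.
have Gcp := sGamma_gt0 cp0; have Gc := sGamma_gt0 c0.
have d20 : 0 < 2 * dl by rewrite mulr_gt0.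
have d21 : 0 < 2 * dl + 1 by rewrite addr_gt0.
pose j u := u `^ (2 * dl - 1) * expR (- u) * (1 + 2^-1 * u) `^ (- (c - p)).
have j0 u : 0 <= j u by rewrite !mulr_ge0 ?powR_ge0 ?expR_ge0.
have mj D : measurable_fun D (fun u => (j u)%:E) by rewrite /j; mfun.
have -> : test_pairing (fun x => X x `^ (- p) * expR (- (2^-1 * X x))) =
    ((sGamma (c - p) / sGamma c)%:E * \int[mu]_(u in `]0%R, +oo[) (j u)%:E)%E.
  rewrite -ge0_integralZl//=; last 3 first.
  - exact: mj.
  - by move=> u _; rewrite lee_fin.
  - by rewrite lee_fin divr_ge0// ltW.
  apply: eq_integral => u; rewrite inE/= in_itv/= andbT => u0.
  have hu : 0 < 2^-1 + u^-1 by rewrite addr_gt0 ?invr_gt0.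
  transitivity ((u `^ (tau - 1) * expR (- u) * u `^ (- c))%:E *
      \int[m]_x (X x `^ (- p) * expR (- ((2^-1 + u^-1) * X x)))%:E)%E.
    rewrite -ge0_integralZl//=; last 3 first.
    - by mfun.
    - by move=> y _; rewrite lee_fin mulr_ge0 ?powR_ge0 ?expR_ge0.
    - by rewrite lee_fin !mulr_ge0 ?powR_ge0 ?expR_ge0.
    apply: eq_integral => x _; rewrite -EFinM; congr EFin.
    rewrite powR_inv1 ?ltW//.
    have -> : expR (- ((2^-1 + u^-1) * X x)) = expR (- (2^-1 * X x)) * expR (- (X x / u)).
      by rewrite -expRD; congr (expR _); ring.
    ring.
  rewrite (bm_moment H)// -!EFinM; congr EFin; rewrite /j.
  have -> : (1 + 2^-1 * u) `^ (- (c - p)) = (2^-1 + u^-1) `^ (- (c - p)) * u `^ (- (c - p)).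
    by rewrite -powRM ?ltW//; congr (_ `^ _); field; rewrite gt_eqF.
  have -> : u `^ (2 * dl - 1) = u `^ (tau - 1) * u `^ (- c) * u `^ (c - p).
    by rewrite -!powRDgt0//; congr (_ `^ _); rewrite /tau /p; field.
  rewrite (powRN u (c - p)); have := powR_gt0 (c - p) u0; move: (u `^ (c - p)) => U U0.
  by field; rewrite !gt_eqF.
have jle : (\int[mu]_(u in `]0%R, +oo[) (j u)%:E <= (sGamma (2 * dl))%:E)%E.
  rewrite -sGamma_integral//; apply: ge0_le_integral => //=.
  - by move=> u _; rewrite lee_fin.
  - exact: mj.
  - by rewrite /gamma_density; mfun.
  move=> u; rewrite in_itv/= andbT => u0; rewrite lee_fin /j /gamma_density.
  rewrite ler_piMr ?mulr_ge0 ?powR_ge0 ?expR_ge0// powRN invf_le1 ?powR_gt0//; last first.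
    by rewrite addr_gt0// mulr_gt0.
  rewrite -[leLHS](powRr0 (1 + 2^-1 * u)); apply: ler_powR; last exact: ltW.
  by rewrite lerDl mulr_ge0// ltW.
have jfin : (\int[mu]_(u in `]0%R, +oo[) (j u)%:E)%E \is a fin_num.
  by rewrite ge0_fin_numE ?(le_lt_trans jle) ?ltry//; apply: integral_ge0 => u _; rewrite lee_fin.
have key : ((sGamma (2 * dl))%:E <= \int[mu]_(u in `]0%R, +oo[) (j u)%:E +
    ((c - p) * dl * sGamma (2 * dl))%:E)%E.
  have -> : (c - p) * dl * sGamma (2 * dl) = (c - p) / 2 * sGamma (2 * dl + 1).
    by rewrite sGammaS//; field.
  rewrite EFinM -!sGamma_integral//.
  rewrite -ge0_integralZl//=; last 3 first.
  - by rewrite /gamma_density; mfun.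
  - by move=> u _; rewrite lee_fin gamma_density_ge0.
  - by rewrite lee_fin divr_ge0// ltW.
  rewrite -ge0_integralD//=; last 4 first.
  - by move=> u _; rewrite lee_fin.
  - exact: mj.
  - by move=> u _; rewrite -EFinM lee_fin mulr_ge0 ?gamma_density_ge0// divr_ge0// ltW.
  - by apply: measurable_funeM; rewrite /gamma_density; mfun.
  apply: ge0_le_integral => //=.
  - by move=> u _; rewrite lee_fin gamma_density_ge0.
  - by rewrite /gamma_density; mfun.
  - by apply: emeasurable_funD; [exact: mj|apply: measurable_funeM; rewrite /gamma_density; mfun].
  move=> u; rewrite in_itv/= andbT => u0; rewrite -EFinM -EFinD lee_fin /j /gamma_density.
  have hb := @bernoulli_powRN (c - p) (2^-1 * u) (ltW cp0).
  have {}hb : 1 - (c - p) * (2^-1 * u) <= (1 + 2^-1 * u) `^ (- (c - p)).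
    by apply: hb; rewrite mulr_ge0// ltW.
  rewrite addrK -(@mulr_powRB1 _ u (2 * dl)) ?(ltW u0)//.
  have g0 : 0 <= u `^ (2 * dl - 1) * expR (- u) by rewrite mulr_ge0 ?powR_ge0 ?expR_ge0.
  move: hb g0; move: (u `^ (2 * dl - 1)) (expR (- u)) ((1 + 2^-1 * u) `^ _) => U E V hb g0.
  rewrite (_ : (c - p) / 2 * (u * U * E) = U * E * ((c - p) * (2^-1 * u))); last by ring.
  rewrite -mulrDr -[leLHS]mulr1 ler_wpM2l//; lra.
rewrite -(fineK jfin) -EFinM lee_fin -mulrA ler_wpM2l ?divr_ge0 ?(ltW Gcp) ?(ltW Gc)//.
move: key; rewrite -(fineK jfin) -EFinD lee_fin => key.
have G2 := sGamma_gt0 d20.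
have : p * dl * sGamma (2 * dl) >= 0 by rewrite !mulr_ge0// ltW.
move: key; rewrite mulrBr mulr1 !mulrBl; lra.
Qed.

(** A Gaussian exp(-uX) has the positive transform u^(-c) exp(-X/u). *)
Lemma gauss_pairing_le (f : T -> R) u : 0 < u -> m.-integrable setT (EFin \o f) ->
  (\int[m]_x (f x * (u `^ (- c) * expR (- (X x / u))))%:E <=
   \int[m]_y (expR (- (u * X y)) * `|bessel_transform m X c f y|)%:E)%E.
Proof.
move=> u0 intf.
have mf : measurable_fun setT f by apply/measurable_EFinP; exact: measurable_int intf.
have mF : measurable_fun setT (bessel_transform m X c f) by exact: measurable_bessel_transform.
have mi : measurable_fun setT (fun x => f x * (u `^ (- c) * expR (- (X x / u)))) by mfun.
have intg : m.-integrable setT (EFin \o (fun x => f x * (u `^ (- c) * expR (- (X x / u))))).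
  apply: (le_integrable measurableT _ _ (integrableZl measurableT (u `^ (- c)) intf)).
    exact: mfun_EFin.
  move=> x _; rewrite /= lee_fin !normrM mulrCA.
  apply: ler_wpM2l; first exact: normr_ge0.
  rewrite ler_piMr ?normr_ge0// ger0_norm ?expR_ge0// expR_le1 oppr_le0.
  by rewrite divr_ge0 ?X0// ltW.
have B1 (y : T) : `|(cst 1 : T -> R) y| <= 1 by rewrite normr1.
have sw := bessel_transform_swap H intf u0 (measurable_cst (1 : R)) B1.
have e1 : \int[m]_y (expR (- (u * X y)) * bessel_transform m X c f y) =
    \int[m]_x (f x * (u `^ (- c) * expR (- (X x / u)))).
  transitivity (\int[m]_y (expR (- (u * X y)) * cst 1 y * bessel_transform m X c f y)).
    by apply: eq_Rintegral => y _; rewrite /= mulr1.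
  rewrite sw; apply: eq_Rintegral => x _; congr (_ * _).
  rewrite -(bessel_gauss H u0 (X0 x)).
  by apply: eq_Rintegral => y _; rewrite /= mulr1.
have fin := integrable_fin_num measurableT intg.
have mi2 : measurable_fun setT (fun y => expR (- (u * X y)) * bessel_transform m X c f y) by mfun.
rewrite -(fineK fin) -[fine _]/(\int[m]_x (f x * (u `^ (- c) * expR (- (X x / u))))) -e1.
apply: le_trans (le_trans _ (abs_Rintegral_le m mi2)) _; first by rewrite lee_fin ler_norm.
rewrite le_eqVlt; apply/orP; left; apply/eqP; apply: eq_integral => y _.
by rewrite normrM ger0_norm ?expR_ge0.
Qed.

(** Pairing the transform of f with the Laplace superposition of Gaussians
    Gamma(tau) (1 + X)^(-tau) evaluates the pairing above, because each Gaussian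
    has a positive transform. The inequality is Cauchy-Schwarz with a free
    parameter l. *)
Lemma test_pairing_upper (f : T -> R) l : 0 < l ->
  m.-integrable setT (EFin \o f) -> (forall x, 0 <= f x) ->
  (test_pairing f <=
   (l / 2)%:E * \int[m]_y (X y `^ (- (2 * b)) * bessel_transform m X c f y ^+ 2)%:E +
   ((2 * l)^-1 * (sGamma tau ^+ 2 * (sGamma (c + 2 * b) * sGamma (2 * dl) / (sGamma c * sGamma (2 * tau)))))%:E)%E.
Proof.
move=> l0 intf f0.
have mf : measurable_fun setT f by apply/measurable_EFinP; exact: measurable_int intf.
pose F := bessel_transform m X c f.
have mF : measurable_fun setT F by exact: measurable_bessel_transform.
pose w u : R := u `^ (tau - 1) * expR (- u).
have w0 u : 0 <= w u by rewrite mulr_ge0 ?powR_ge0 ?expR_ge0.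
have mw D : measurable_fun D w by rewrite /w; mfun.
have Gt := sGamma_gt0 tau0.
pose k u y := w u * (expR (- (u * X y)) * `|F y|).
have k0 u y : 0 <= k u y by apply: mulr_ge0 => //; rewrite mulr_ge0 ?expR_ge0.
have mk : measurable_fun setT (fun z : R * T => k z.1 z.2) by rewrite /k /w; mfun.
pose W y := sGamma tau * (1 + X y) `^ (- tau).
have W0 y : 0 <= W y by rewrite mulr_ge0 ?powR_ge0// ltW.
have mW : measurable_fun setT W by rewrite /W; mfun.
pose q u x := f x * (u `^ (tau - 1) * expR (- u) * (u `^ (- c) * expR (- (X x * u `^ (-1))))).
have q0 u x : 0 <= q u x.
  by rewrite mulr_ge0// mulr_ge0 ?mulr_ge0 ?powR_ge0 ?expR_ge0.
have mq : measurable_fun setT (fun z : R * T => q z.1 z.2).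
  have mf2 : measurable_fun setT (fun z : R * T => f z.2) by exact: measurableT_comp mf measurable_snd.
  by rewrite /q; apply: mfunM => //; mfun.
apply: (@le_trans _ _ (\int[mu]_(u in `]0%R, +oo[) \int[m]_y (k u y)%:E)%E).
  apply: ge0_le_integral => //=.
  - by move=> u _; apply: integral_ge0 => x _; rewrite lee_fin !mulr_ge0 ?powR_ge0 ?expR_ge0.
  - by apply: measurable_funTS; exact: (measurable_ge0_integral2 m measurableT mq q0).
  - by apply: measurable_funTS; exact: (measurable_ge0_integral2 m measurableT mk k0).
  move=> u; rewrite in_itv/= andbT => u0.
  under eq_integral do rewrite powR_inv1 ?(ltW u0)//.
  have Z (g : T -> R) : measurable_fun setT g -> (forall y, 0 <= g y) ->
      (\int[m]_y (w u * g y)%:E = (w u)%:E * \int[m]_y (g y)%:E)%E.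
    move=> mg g0; under eq_integral do rewrite EFinM.
    apply: (@ge0_integralZl _ _ _ m setT measurableT (EFin \o g)).
    - exact: mfun_EFin.
    - by move=> y _; rewrite /= lee_fin.
    - by rewrite lee_fin.
  have -> : (\int[m]_x (f x * (u `^ (tau - 1) * expR (- u) * (u `^ (- c) * expR (- (X x / u)))))%:E =
     (w u)%:E * \int[m]_x (f x * (u `^ (- c) * expR (- (X x / u))))%:E)%E.
    transitivity (\int[m]_x (w u * (f x * (u `^ (- c) * expR (- (X x / u)))))%:E)%E.
      by apply: eq_integral => x _; rewrite mulrCA.
    apply: (Z (fun x => f x * (u `^ (- c) * expR (- (X x / u))))); first by mfun.
    move=> y; apply: mulr_ge0; first exact: f0.
    by apply: mulr_ge0; [exact: powR_ge0|exact: expR_ge0].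
  have -> : (\int[m]_y (k u y)%:E = (w u)%:E * \int[m]_y (expR (- (u * X y)) * `|F y|)%:E)%E.
    apply: (Z (fun y => expR (- (u * X y)) * `|F y|)); first by mfun.
    by move=> y; apply: mulr_ge0; [exact: expR_ge0|exact: normr_ge0].
  apply: lee_wpmul2l; first by rewrite lee_fin.
  exact: gauss_pairing_le.
rewrite ge0_integral_swap//.
have -> : (\int[m]_y \int[mu]_(u in `]0%R, +oo[) (k u y)%:E = \int[m]_y (`|F y| * W y)%:E)%E.
  apply: eq_integral => y _; rewrite EFinM /W -integral_laplace_power// -ge0_integralZl//=; last 2 first.
  - by mfun.
  - by move=> u _; rewrite lee_fin !mulr_ge0 ?powR_ge0 ?expR_ge0.
  by apply: eq_integral => u _; rewrite -EFinM; congr EFin; rewrite /k /w; ring.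
pose A y := l / 2 * (X y `^ (- (2 * b)) * F y ^+ 2).
pose B y := (2 * l)^-1 * (sGamma tau ^+ 2 * (X y `^ (2 * b) * (1 + X y) `^ (- (2 * tau)))).
have A0 y : 0 <= A y.
  by rewrite mulr_ge0 ?divr_ge0 ?(ltW l0)// mulr_ge0 ?powR_ge0 ?sqr_ge0.
have B0 y : 0 <= B y.
  by rewrite mulr_ge0 ?invr_ge0 ?mulr_ge0 ?(ltW l0)// ?powR_ge0 ?ltW.
have mA : measurable_fun setT A by rewrite /A; mfun.
have mB : measurable_fun setT B by rewrite /B; mfun.
apply: (@le_trans _ _ (\int[m]_y ((A y)%:E + (B y)%:E))%E).
  apply: ge0_le_integral => //=.
  - by move=> y _; rewrite lee_fin mulr_ge0.
  - by mfun.
  - by apply: emeasurable_funD; exact: mfun_EFin.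
  move=> y _; rewrite -EFinD lee_fin.
  have x2 := powR_gt0 b (X_gt0 y).
  have y1 : 0 < 1 + X y by rewrite addr_gt0.
  pose P := X y `^ b; pose Q := (1 + X y) `^ (- tau).
  have -> : A y = l / 2 * (`|F y| / P) ^+ 2.
    rewrite /A expr_div_n real_normK ?num_real// (_ : X y `^ (- (2 * b)) = (P ^+ 2)^-1).
      by congr (_ * _); rewrite mulrC.
    by rewrite powRN -powR_mulrn ?powR_ge0// -powRrM; congr (_^-1); congr (_ `^ _); ring.
  have -> : B y = (2 * l)^-1 * (P * W y) ^+ 2.
    rewrite /B /W !exprMn; congr (_ * _).
    rewrite (_ : X y `^ (2 * b) = P ^+ 2).
      rewrite (_ : (1 + X y) `^ (- (2 * tau)) = Q ^+ 2); first by rewrite /Q; ring.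
      by rewrite -powR_mulrn ?powR_ge0// -powRrM; congr (_ `^ _); ring.
    by rewrite -powR_mulrn ?powR_ge0// -powRrM; congr (_ `^ _); ring.
  have -> : `|F y| * W y = (`|F y| / P) * (P * W y) by field; rewrite gt_eqF.
  move: (`|F y| / P) (P * W y) => A1 B1.
  rewrite -subr_ge0 (_ : _ - _ = (2 * l)^-1 * (l * A1 - B1) ^+ 2).
    by rewrite mulr_ge0 ?sqr_ge0// invr_ge0 mulr_ge0// ltW.
  by field; rewrite gt_eqF.
rewrite ge0_integralD//=; last 4 first.
- by move=> y _; rewrite lee_fin.
- exact: mfun_EFin.
- by move=> y _; rewrite lee_fin.
- exact: mfun_EFin.
rewrite /A /B; under eq_integral do rewrite EFinM.
rewrite ge0_integralZl//=; last 3 first.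
- by mfun.
- by move=> y _; rewrite lee_fin mulr_ge0 ?powR_ge0 ?sqr_ge0.
- by rewrite lee_fin divr_ge0// ltW.
apply: leeD; first exact: lexx.
pose V y := X y `^ (2 * b) * (1 + X y) `^ (- (2 * tau)).
pose L := (2 * l)^-1 * sGamma tau ^+ 2.
have L0 : 0 <= L by apply: mulr_ge0; [rewrite invr_ge0 mulr_ge0// ltW|exact: sqr_ge0].
have mV : measurable_fun setT V by rewrite /V; mfun.
have -> : (\int[m]_y ((2 * l)^-1 * (sGamma tau ^+ 2 * (X y `^ (2 * b) * (1 + X y) `^ (- (2 * tau)))))%:E =
    L%:E * \int[m]_y (V y)%:E)%E.
  transitivity (\int[m]_y (L%:E * (V y)%:E))%E.
    by apply: eq_integral => y _; rewrite -EFinM; congr EFin; exact: mulrA.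
  apply: (@ge0_integralZl _ _ _ m setT measurableT (EFin \o V)).
  - exact: mfun_EFin.
  - by move=> y _; rewrite /= lee_fin; apply: mulr_ge0; exact: powR_ge0.
  - by rewrite lee_fin.
rewrite /V /L.
rewrite integral_affine_power//; last 2 first.
- by rewrite mulr_ge0.
- by rewrite /tau; move: dl0; lra.
rewrite -EFinM (_ : 2 * tau - (c + 2 * b) = 2 * dl); last by rewrite /tau; field.
rewrite le_eqVlt; apply/orP; left; apply/eqP; congr EFin; exact: (esym (mulrA _ _ _)).
Qed.

End PittLower.

(** * Sharpness of the constant *)

(** The two exponents s/2 and s+1 dominate all exponents near s, on (0,1] and
    on [1,oo) respectively. *)
Lemma sGamma_cvg (R : realType) (s : nat -> R) (s0 : R) : 0 < s0 ->
  (forall n, s0 / 2 <= s n <= s0 + 1) -> s n @[n --> \oo] --> s0 ->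
  sGamma (s n) @[n --> \oo] --> sGamma s0.
Proof.
move=> s00 sb sc.
have s20 : 0 < s0 / 2 by rewrite divr_gt0.
have s10 : 0 < s0 + 1 by rewrite addr_gt0.
pose D : set R := `]0, +oo[%classic.
have ig r : 0 < r -> (@lebesgue_measure R).-integrable D (EFin \o gamma_density r).
  move=> r0; apply/integrableP; split.
    by apply: mfun_EFin; rewrite /gamma_density; mfun.
  under eq_integral do rewrite /= ger0_norm ?gamma_density_ge0//.
  by rewrite sGamma_integral// ltry.
have : (\int[@lebesgue_measure R]_(x in D) (gamma_density (s n) x)%:E @[n --> \oo] -->
    \int[@lebesgue_measure R]_(x in D) (gamma_density s0 x)%:E)%E.
  apply: (@dominated_cvg_EFin _ _ R (@lebesgue_measure R) D (fun n => gamma_density (s n))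
    (gamma_density s0) (fun t => gamma_density (s0 / 2) t + gamma_density (s0 + 1) t)).
  - exact: measurable_itv.
  - by move=> n; rewrite /gamma_density; mfun.
  - by rewrite /gamma_density; mfun.
  - move=> t; rewrite /D/= in_itv/= andbT => t0.
    apply: cvgM; last exact: cvg_cst.
    rewrite /powR gt_eqF//; apply: (continuous_cvg _ (@continuous_expR R _)).
    by apply: cvgM; [apply: cvgB => //; exact: cvg_cst|exact: cvg_cst].
  - have mD : measurable D by exact: measurable_itv.
    have h := integrableD _ (ig _ s20) (ig _ s10).
    apply: eq_integrable; last exact: (h mD).
      exact: mD.
    by move=> x _.
  - move=> n t; rewrite /D/= in_itv/= andbT => t0.
    rewrite ger0_norm ?gamma_density_ge0// /gamma_density -mulrDl ler_wpM2r ?expR_ge0//.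
    have /andP[l1 l2] := sb n.
    have [t1|t1] := leP t 1.
      rewrite ler_wpDr ?powR_ge0// -(opprB 1) -(opprB 1 (s0 / 2)) !powRN.
      rewrite lef_pV2 ?posrE ?powR_gt0//.
      have : t `^ (1 - s n) <= 1 * t `^ (1 - s n) by rewrite mul1r.
      rewrite (_ : 1 - s0 / 2 = (s n - s0 / 2) + (1 - s n)); last by ring.
      rewrite powRDgt0// => _; rewrite ler_piMl ?powR_ge0//.
      apply: (@le_trans _ _ (1 `^ (s n - s0 / 2))); last by rewrite powR1.
      by apply: ge0_ler_powR; rewrite ?nnegrE ?subr_ge0 ?(ltW t0).
    by rewrite ler_wpDl ?powR_ge0//; apply: ler_powR; [exact: ltW|rewrite lerD2r].
have sn0 n : 0 < s n by have /andP[h _] := sb n; exact: lt_le_trans h.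
under eq_fun do rewrite sGamma_integral//.
by rewrite sGamma_integral// => /fine_cvgP[_]; apply.
Qed.

Section PittLowerLimit.
Context d (T : measurableType d) (R : realType).
Variables (m : {sigma_finite_measure set T -> \bar R}) (X : T -> R) (c : R).
Hypothesis H : bessel_measure m X c.

Let mX := bm_measurable H.
Let X_gt0 := bm_gt0 H.
Let c_ge := bm_half H.
Let X0 y : 0 <= X y. Proof. exact: ltW. Qed.
Let c0 : 0 < c. Proof. by apply: lt_le_trans c_ge; rewrite invr_gt0. Qed.

(** The function X^(-p) with p slightly below c/2 + b just belongs to the weighted
    L2 space near the origin; the exponential takes care of infinity. *)
Definition pitt_test (p : R) x := X x `^ (- p) * expR (- (2^-1 * X x)).

Definition test_sequence p (f_ : nat -> T -> R) :=
  [/\ forall n, m.-integrable setT (EFin \o f_ n),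
      forall n x, 0 <= f_ n x <= pitt_test p x,
      forall x, {homo f_^~ x : n k / (n <= k)%N >-> n <= k} &
      forall x, f_ n x @[n --> \oo] --> pitt_test p x].

Lemma test_pairing_cvg b dl p f_ : test_sequence p f_ ->
  (test_pairing m X c b dl (f_ n) @[n --> \oo] --> test_pairing m X c b dl (pitt_test p))%E.
Proof.
move=> [intf fb nd fc].
have mf n : measurable_fun setT (f_ n) by apply/measurable_EFinP; exact: measurable_int (intf n).
have f0 n x : 0 <= f_ n x by have /andP[] := fb n x.
pose tau := c / 2 + b + dl.
pose w u x := u `^ (tau - 1) * expR (- u) * (u `^ (- c) * expR (- (X x * u `^ (-1)))).
have w0 u x : 0 <= w u x by rewrite !mulr_ge0 ?powR_ge0 ?expR_ge0.
have mw : measurable_fun setT (fun z : R * T => w z.1 z.2) by rewrite /w; mfun.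
have mw1 u : measurable_fun setT (w u) by rewrite /w; mfun.
pose q n u x := f_ n x * w u x.
have q0 n u x : 0 <= q n u x by rewrite mulr_ge0.
have mq n : measurable_fun setT (fun z : R * T => q n z.1 z.2).
  have mf2 : measurable_fun setT (fun z : R * T => f_ n z.2) by exact: measurableT_comp (mf n) measurable_snd.
  exact: mfunM.
have mq1 n u : measurable_fun setT (q n u) by exact: mfunM.
have qnd n k u x : (n <= k)%N -> q n u x <= q k u x.
  by move=> nk; apply: ler_wpM2r => //; exact: nd.
apply: ge0_monotone_cvg.
- exact: measurable_itv.
- by move=> n; apply: measurable_funTS; exact: (measurable_ge0_integral2 m measurableT (mq n) (q0 n)).
- by move=> n u _; apply: integral_ge0 => x _; rewrite lee_fin q0.
- move=> u _ n k nk; apply: ge0_le_integral => //=.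
  + by move=> x _; rewrite lee_fin q0.
  + by apply: mfun_EFin; exact: mq1.
  + by apply: mfun_EFin; exact: mq1.
  + by move=> x _; rewrite lee_fin qnd.
- move=> u _; apply: ge0_monotone_cvg => //.
  + by move=> n; apply: mfun_EFin; exact: mq1.
  + by move=> n x _; rewrite lee_fin q0.
  + by move=> x _ n k nk; rewrite lee_fin qnd.
  + move=> x _; apply/cvg_EFin; first by apply: nearW.
    by apply: cvgM; [exact: fc|exact: cvg_cst].
Qed.

Lemma pitt_test_norm b dl : 0 < dl ->
  (\int[m]_x (X x `^ (2 * b) * pitt_test (c / 2 + b - dl) x ^+ 2)%:E =
   (sGamma (2 * dl) / sGamma c)%:E)%E.
Proof.
move=> dl0; transitivity (\int[m]_x (X x `^ (2 * dl - c) * expR (- (1 * X x)))%:E)%E.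
  apply: eq_integral => x _; congr EFin; rewrite /pitt_test exprMn.
  rewrite -expRM_natl -[X in _ * (X * _)]powR_mulrn ?powR_ge0// -powRrM mulrA -powRDgt0//.
  congr (_ * expR _); last by field.
  by congr (_ `^ _); field.
have h := @bm_moment _ _ _ _ _ _ H (2 * dl - c) 1.
have e : c + (2 * dl - c) = 2 * dl by ring.
rewrite e powR1 mulr1 in h; apply: h => //; exact: mulr_gt0.
Qed.

Variables (b K : R).
Hypotheses (b0 : 0 <= b) (bc : b < c / 2) (K0 : 0 <= K).

(** Both bounds on the pairing carry the factor Gamma(2 dl) / Gamma(c), which
    blows up as dl tends to 0. Dividing by it leaves an inequality that has a
    limit. *)
Lemma test_sequence_bound dl l f_ : 0 < dl -> dl < c / 2 + b -> 0 < l ->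
  test_sequence (c / 2 + b - dl) f_ ->
  (forall n, (\int[m]_y (X y `^ (- (2 * b)) * bessel_transform m X c (f_ n) y ^+ 2)%:E <=
     K%:E * \int[m]_x (X x `^ (2 * b) * f_ n x ^+ 2)%:E)%E) ->
  sGamma (c / 2 - b + dl) * (1 - c * dl) <= l / 2 * K +
    (2 * l)^-1 * (sGamma (c / 2 + b + dl) ^+ 2 * sGamma (c + 2 * b) / sGamma (c + 2 * b + 2 * dl)).
Proof.
move=> dl0 dlc l0 tf hK.
have [intf fb nd fc] := tf.
have mf n : measurable_fun setT (f_ n) by apply/measurable_EFinP; exact: measurable_int (intf n).
have f0 n x : 0 <= f_ n x by have /andP[] := fb n x.
have Gc := sGamma_gt0 c0.
have Gd : 0 < sGamma (2 * dl) by apply: sGamma_gt0; rewrite mulr_gt0.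
have mphi : measurable_fun setT (pitt_test (c / 2 + b - dl)) by rewrite /pitt_test; mfun.
pose B := sGamma (c / 2 + b + dl) ^+ 2 * (sGamma (c + 2 * b) * sGamma (2 * dl) /
    (sGamma c * sGamma (2 * (c / 2 + b + dl)))).
have up n : (test_pairing m X c b dl (f_ n) <=
    (l / 2 * (K * (sGamma (2 * dl) / sGamma c)) + (2 * l)^-1 * B)%:E)%E.
  apply: (le_trans (test_pairing_upper H b0 dl0 l0 (intf n) (f0 n))).
  rewrite [leRHS]EFinD; apply: leeD; last exact: lexx.
  rewrite [leRHS]EFinM; apply: lee_wpmul2l.
    by rewrite lee_fin divr_ge0// ltW.
  apply: (le_trans (hK n)); rewrite [leRHS]EFinM; apply: lee_wpmul2l; first by rewrite lee_fin.
  rewrite -(pitt_test_norm b dl0); apply: ge0_le_integral => //=.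
  - by move=> x _; rewrite lee_fin mulr_ge0 ?powR_ge0// sqr_ge0.
  - by mfun.
  - by mfun.
  - move=> x _; rewrite lee_fin; apply: ler_wpM2l; first exact: powR_ge0.
    by have /andP[h1 h2] := fb n x; apply: lerXn2r; rewrite ?nnegrE//; exact: le_trans h2.
have /(le_trans (test_pairing_lower H bc dl0 dlc)) :
    (test_pairing m X c b dl (pitt_test (c / 2 + b - dl)) <=
    (l / 2 * (K * (sGamma (2 * dl) / sGamma c)) + (2 * l)^-1 * B)%:E)%E.
  have h := @test_pairing_cvg b dl _ _ tf.
  by rewrite -(cvg_lim _ h)//; apply: lime_le; [exact: cvgP h|exact: nearW].
rewrite lee_fin (_ : c - (c / 2 + b - dl) = c / 2 - b + dl); last by field.
have G3 : 0 < sGamma (2 * (c / 2 + b + dl)).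
  by apply: sGamma_gt0; move: b0 c0 dl0; lra.
rewrite /B (_ : 2 * (c / 2 + b + dl) = c + 2 * b + 2 * dl) in G3 *; last by field.
move: (sGamma (c / 2 - b + dl)) (sGamma (c / 2 + b + dl)) (sGamma (c + 2 * b + 2 * dl)) G3
  (sGamma (c + 2 * b)) (sGamma c) Gc (sGamma (2 * dl)) Gd => G1 G2 G3 G30 G4 Gc Gc0 Gd Gd0 h.
have e : 0 < Gd / Gc by rewrite divr_gt0.
rewrite -(ler_pM2r e); move: h.
rewrite (_ : G1 / Gc * Gd * (1 - c * dl) = G1 * (1 - c * dl) * (Gd / Gc)); last by ring.
rewrite (_ : _ + _ = (l / 2 * K + (2 * l)^-1 * (G2 ^+ 2 * G4 / G3)) * (Gd / Gc))//.
by field; rewrite !gt_eqF.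
Qed.

Lemma pitt_lower :
  (forall p, 0 < p -> p < c -> exists2 f_, test_sequence p f_ &
    forall n, (\int[m]_y (X y `^ (- (2 * b)) * bessel_transform m X c (f_ n) y ^+ 2)%:E <=
     K%:E * \int[m]_x (X x `^ (2 * b) * f_ n x ^+ 2)%:E)%E) ->
  (sGamma (c / 2 - b) / sGamma (c / 2 + b)) ^+ 2 <= K.
Proof.
move=> hf.
have s1 : 0 < c / 2 - b by rewrite subr_gt0.
have s2 : 0 < c / 2 + b by move: b0 c0; lra.
have s3 : 0 < c + 2 * b by move: b0 c0; lra.
have G1 := sGamma_gt0 s1; have G2 := sGamma_gt0 s2; have G3 := sGamma_gt0 s3.
(* The bound 1/2 keeps 2 dl below 1, the range of exponents in [sGamma_cvg]; the
   bound c/4 keeps c/2 + b - dl positive. *)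
pose eta := Num.min (2^-1) (c / 4).
have eta0 : 0 < eta by rewrite lt_min invr_gt0 ltr0n divr_gt0.
have eta2 : eta <= 2^-1 by rewrite ge_min lexx.
have etac : eta <= c / 4 by rewrite ge_min lexx orbT.
pose dl (n : nat) := eta * n.+1%:R^-1 : R.
have dl0 n : 0 < dl n by rewrite mulr_gt0.
have dle n : dl n <= eta by rewrite ler_piMr ?(ltW eta0)// invf_le1// ler1n.
have dcvg : dl n @[n --> \oo] --> (0 : R).
  by rewrite -(mulr0 eta); apply: cvgM; [exact: cvg_cst|exact: cvg_harmonic].
have Gcvg (s k : R) : 0 < s -> 0 <= k <= 2 -> sGamma (s + k * dl n) @[n --> \oo] --> sGamma s.
  move=> s0 /andP[k0 k2]; apply: sGamma_cvg => //.
    move=> n; have h1 : 0 <= k * dl n by rewrite mulr_ge0// ltW.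
    have h2 : k * dl n <= 1.
      apply: (@le_trans _ _ (2 * 2^-1)); last by rewrite divff.
      by apply: ler_pM => //; [exact: ltW|exact: le_trans eta2].
    by move: s0; lra.
  rewrite -[X in _ --> X](addr0 s) -(mulr0 k); apply: cvgD; first exact: cvg_cst.
  by apply: cvgM => //; exact: cvg_cst.
(* This l minimises the bound in the limit when K is the square of the claimed
   constant. *)
pose l := sGamma (c / 2 + b) ^+ 2 / sGamma (c / 2 - b).
have l0 : 0 < l by rewrite divr_gt0// exprn_gt0.
have key : sGamma (c / 2 - b) * (1 - c * 0) <= l / 2 * K + (2 * l)^-1 *
    (sGamma (c / 2 + b) ^+ 2 * sGamma (c + 2 * b) / sGamma (c + 2 * b)).
  have h1 : sGamma (c / 2 - b + 1 * dl n) * (1 - c * dl n) @[n --> \oo] -->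
      sGamma (c / 2 - b) * (1 - c * 0).
    apply: cvgM; first by apply: Gcvg; rewrite // ler01 ler1n.
    by apply: cvgB; [exact: cvg_cst|apply: cvgM => //; exact: cvg_cst].
  have h2 : l / 2 * K + (2 * l)^-1 * (sGamma (c / 2 + b + 1 * dl n) ^+ 2 * sGamma (c + 2 * b) /
      sGamma (c + 2 * b + 2 * dl n)) @[n --> \oo] --> l / 2 * K + (2 * l)^-1 *
    (sGamma (c / 2 + b) ^+ 2 * sGamma (c + 2 * b) / sGamma (c + 2 * b)).
    apply: cvgD; first exact: cvg_cst.
    apply: cvgM; first exact: cvg_cst.
    apply: cvgM; last first.
      by apply: cvgV; [rewrite gt_eqF|apply: Gcvg; rewrite // ler0n lexx].
    apply: cvgM; last exact: cvg_cst.
    rewrite expr2; under eq_fun do rewrite expr2.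
    by apply: cvgM; apply: Gcvg; rewrite // ler01 ler1n.
  apply: (ler_cvg_to h1 h2); apply: nearW => n; rewrite !mul1r.
  have dc : dl n < c / 2 + b.
    by have := dle n; move: etac b0 c0; lra.
  have [||f_ tf hK] := hf (c / 2 + b - dl n).
  - by rewrite subr_gt0.
  - by have := dl0 n; move: bc; lra.
  exact: (test_sequence_bound (dl0 n) dc l0 tf hK).
move: key; rewrite mulr0 subr0 mulr1 mulfK ?gt_eqF// /l.
move: (sGamma (c / 2 - b)) (sGamma (c / 2 + b)) G1 G2 => g1 g2 g10 g20 key.
rewrite expr_div_n ler_pdivrMr ?exprn_gt0//.
have : g1 * g1 <= (g2 ^+ 2 / g1 / 2 * K + (2 * (g2 ^+ 2 / g1))^-1 * g2 ^+ 2) * g1 by rewrite ler_pM2r.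
rewrite (_ : (_ + _) * g1 = (K * g2 ^+ 2) / 2 + g1 ^+ 2 / 2); last by field; rewrite !gt_eqF.
rewrite -expr2; move: (g1 ^+ 2) (K * g2 ^+ 2) => A B; lra.
Qed.

End PittLowerLimit.

(** * A family of Schwartz functions *)

Section SchwartzFamily.
Context (R : realType) (a e : R).
Hypotheses (a0 : 0 < a) (e0 : 0 < e).

(** Shifting x^2 by e > 0 makes its real powers smooth at the origin. *)
Definition reg_base (x : R) := e + x ^+ 2.
Definition reg_exp (x : R) := expR (- (reg_base x `^ (a / 2) / (2 * a))).

(** A space of rapidly decreasing functions that contains the test functions and
    is closed under differentiation. *)
Inductive reg_span : (R -> R) -> Prop :=
| reg_monomial (k : nat) (s : R) :
    reg_span (fun x => x ^+ k * (reg_base x `^ s * reg_exp x))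
| reg_add u v : reg_span u -> reg_span v -> reg_span (fun x => u x + v x)
| reg_scale (l : R) u : reg_span u -> reg_span (fun x => l * u x).

Lemma reg_base_ge x : e <= reg_base x.
Proof. by rewrite lerDl sqr_ge0. Qed.

Lemma reg_base_gt0 x : 0 < reg_base x.
Proof. exact: lt_le_trans (reg_base_ge x). Qed.

Lemma is_derive_reg_base (x : R) : is_derive x 1 reg_base (2 * x).
Proof.
rewrite /reg_base; apply: is_derive_eq; rewrite /GRing.scale/=; ring.
Qed.

Lemma is_derive_reg_powR s (x : R) :
  is_derive x 1 (fun y => reg_base y `^ s) (2 * s * (x * reg_base x `^ (s - 1))).
Proof.
have h1 := is_derive1_powR s (reg_base_gt0 x).
have h := is_derive1_comp (f := fun y => y `^ s) (g := reg_base) h1 (is_derive_reg_base x).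
by apply: is_derive_eq h _; rewrite /GRing.scale/=; ring.
Qed.

Lemma is_derive_reg_exp (x : R) :
  is_derive x 1 reg_exp (- (2^-1) * (x * (reg_base x `^ (a / 2 - 1) * reg_exp x))).
Proof.
have h1 : is_derive x 1 (fun y => - (reg_base y `^ (a / 2) / (2 * a)))
    (- (2^-1 * (x * reg_base x `^ (a / 2 - 1)))).
  have h := is_derive_reg_powR (a / 2) x.
  apply: is_derive_eq; rewrite /GRing.scale/=; field; rewrite gt_eqF//.
have h := is_derive1_comp (f := expR) (is_derive_expR _) h1.
by apply: is_derive_eq h _; rewrite /GRing.scale/= /reg_exp; ring.
Qed.

Lemma reg_span_derive u : reg_span u ->
  exists2 v, reg_span v & forall x : R, is_derive x 1 u (v x).
Proof.
elim=> [k s|u1 u2 _ [v1 V1 d1] _ [v2 V2 d2]|l u1 _ [v1 V1 d1]].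
- exists (fun x => (k%:R * (x ^+ k.-1 * (reg_base x `^ s * reg_exp x)) +
      (2 * s) * (x ^+ k.+1 * (reg_base x `^ (s - 1) * reg_exp x))) +
      - (2^-1) * (x ^+ k.+1 * (reg_base x `^ (s + (a / 2 - 1)) * reg_exp x))).
    by do ![apply: reg_add]; apply: reg_scale; exact: reg_monomial.
  move=> x; have h1 := is_derive_reg_powR s x; have h2 := is_derive_reg_exp x.
  have hx : is_derive x 1 (fun y : R => y ^+ k) (k%:R * x ^+ k.-1).
    have -> : (fun y : R => y ^+ k) = (id : R -> R) ^+ k.
      by apply/funext => y; rewrite exprfctE.
    by apply: is_derive_eq (is_deriveX k (is_derive_id x 1)) _; rewrite /GRing.scale/= mulr1.
  apply: is_derive_eq (is_deriveM hx (is_deriveM h1 h2)) _.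
  rewrite [reg_base x `^ (s + (a / 2 - 1))]powRD; last first.
    by apply/implyP => _; rewrite gt_eqF// reg_base_gt0.
  rewrite /GRing.scale/= exprS -[(_ * reg_exp) x]/(reg_base x `^ s * reg_exp x).
  by ring.
- exists (fun x => v1 x + v2 x); first exact: reg_add.
  by move=> x; have := d1 x; have := d2 x => *; exact: is_deriveD.
- exists (fun x => l * v1 x); first exact: reg_scale.
  by move=> x; have := d1 x => ?; apply: is_derive_eq; rewrite /GRing.scale/=; ring.
Qed.

Lemma reg_span_derive1n n u : reg_span u -> reg_span (u^`(n))%classic.
Proof.
move=> U; elim: n => [|n]; first by rewrite derive1n0.
move/reg_span_derive => [v V d]; rewrite derive1nS.
suff -> : derive1 (derive1n n u) = v by [].
by apply/funext => x; rewrite derive1E; exact: (@derive_val _ _ _ _ _ _ _ (d x)).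
Qed.

Lemma reg_span_smooth u : reg_span u -> smooth u.
Proof.
by move=> U n x; have [v _ d] := reg_span_derive (reg_span_derive1n n U); have := d x => ?; exact: ex_derive.
Qed.

Lemma reg_span_bounded u k : reg_span u ->
  exists M, forall x, `|x| ^+ k * `|u x| <= M.
Proof.
elim=> [j s|u1 u2 _ [M1 h1] _ [M2 h2]|l u1 _ [M h]].
- pose q := (k + j)%:R / 2 + s.
  (* As n a / 2 >= q and the base is at least e, its power q is at most a constant
     times its power n a / 2, which is (2 a y)^n for y the exponent in reg_exp; and
     y^n <= n! exp y. *)
  pose n := (Num.truncn (q * 2 / a)).+1.
  have qn : q <= n%:R * (a / 2).
    have h := ltW (truncnS_gt (q * 2 / a)).
    rewrite (_ : q = (q * 2 / a) * (a / 2)); last by field; rewrite gt_eqF.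
    by apply: ler_wpM2r => //; rewrite divr_ge0// ltW.
  exists (e `^ (q - n%:R * (a / 2)) * ((2 * a) ^+ n * n`!%:R)) => x.
  have w0 := reg_base_gt0 x.
  have ne0 r : reg_base x `^ r != 0 by rewrite gt_eqF// powR_gt0.
  have xw : `|x| ^+ (k + j) <= reg_base x `^ ((k + j)%:R / 2).
    rewrite mulrC powRrM -[X in X <= _]powR_mulrn//; apply: ge0_ler_powR => //.
    - by rewrite nnegrE powR_ge0.
    rewrite powR12_sqrt ?(ltW w0)// -sqrtr_sqr; apply: ler_wsqrtr.
    by rewrite lerDr ltW.
  have E0 : 0 <= reg_exp x by exact: expR_ge0.
  have -> : `|x ^+ j * (reg_base x `^ s * reg_exp x)| = `|x| ^+ j * (reg_base x `^ s * reg_exp x).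
    by rewrite normrM normrX [X in _ * X]ger0_norm// mulr_ge0 ?powR_ge0.
  rewrite mulrA -exprD.
  apply: (@le_trans _ _ (reg_base x `^ q * reg_exp x)).
    rewrite /q powRD; last by apply/implyP => _; rewrite gt_eqF.
    by rewrite -mulrA ler_wpM2r// mulr_ge0 ?powR_ge0.
  rewrite (_ : q = q - n%:R * (a / 2) + a / 2 * n%:R); last by rewrite [X in _ + X]mulrC subrK.
  rewrite powRD; last by apply/implyP => _; rewrite gt_eqF.
  rewrite -mulrA (_ : q - n%:R * (a / 2) + a / 2 * n%:R - n%:R * (a / 2) = q - n%:R * (a / 2)); last by ring.
  apply: ler_pM; rewrite ?powR_ge0 ?mulr_ge0 ?powR_ge0//.
    rewrite -(opprB _ q) !powRN lef_pV2 ?posrE ?powR_gt0//.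
    by apply: ge0_ler_powR; rewrite ?nnegrE ?subr_ge0 ?(ltW e0) ?(ltW w0)// reg_base_ge.
  rewrite powRrM powR_mulrn ?powR_ge0//.
  pose y := reg_base x `^ (a / 2) / (2 * a).
  have y0 : 0 <= y by rewrite divr_ge0 ?powR_ge0 ?mulr_ge0 ?ltW.
  have -> : reg_base x `^ (a / 2) = 2 * a * y by rewrite /y; field; rewrite gt_eqF.
  rewrite exprMn -mulrA; apply: ler_wpM2l; first by rewrite exprn_ge0// mulr_ge0// ltW.
  rewrite /reg_exp -/y expRN ler_pdivrMr ?expR_gt0// mulrC -ler_pdivrMr ?ltr0n ?fact_gt0//.
  by apply: le_trans (expR_ge1Dxn n.-1 y0); rewrite lerDr.
- exists (M1 + M2) => x; apply: le_trans (lerD (h1 x) (h2 x)).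
  by rewrite -mulrDr ler_wpM2l ?exprn_ge0 ?ler_normD.
- exists (`|l| * M) => x; rewrite normrM mulrCA; exact: ler_wpM2l.
Qed.

Lemma schwartz_reg_span u : reg_span u -> schwartz (fun x => (u x)%:C%C).
Proof.
move=> U; split.
- exact: reg_span_smooth.
- move=> n x; suff -> : derive1n n (fun=> 0 : R) = cst 0 by [].
  by elim: n => [//|n IH]; rewrite derive1nS IH; apply/funext => y; rewrite derive1_cst.
move=> k n; have [M h] := reg_span_bounded k (reg_span_derive1n n U).
exists M => x; rewrite /cderiven/=.
have -> : derive1n n (fun=> 0 : R) = cst 0.
  by elim: n {h} => [//|n IH]; rewrite derive1nS IH; apply/funext => y; rewrite derive1_cst.
by rewrite /= expr0n/= addr0 sqrtr_sqr.
Qed.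

Lemma reg_span_test p : reg_span (fun x => (reg_base x `^ (a / 2) / a) `^ (- p) *
  expR (- (2^-1 * (reg_base x `^ (a / 2) / a)))).
Proof.
have -> : (fun x => (reg_base x `^ (a / 2) / a) `^ (- p) *
  expR (- (2^-1 * (reg_base x `^ (a / 2) / a)))) =
  fun x => a `^ p * (x ^+ 0 * (reg_base x `^ (a / 2 * - p) * reg_exp x)).
  apply/funext => x; rewrite powRM ?powR_ge0 ?invr_ge0 ?(ltW a0)// -powRrM.
  rewrite expr0 mul1r -(powR_inv1 (ltW a0)) -powRrM mulN1r opprK /reg_exp (powR_inv1 (ltW a0)).
  rewrite mulrA (mulrC (a `^ p)); congr (_ * expR (- _)); field; rewrite gt_eqF//.
by apply: reg_scale; exact: reg_monomial.
Qed.

End SchwartzFamily.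

(** * The measure nu *)

Section NuMeasure.
Context (R : realType) (lam a : R).
Hypotheses (a0 : 0 < a) (lam_ge : 0 <= 4 * lam + a).
Local Notation mu := (@lebesgue_measure R).
Local Notation m := (nu lam a).
Let c := 2 * lam / a + 1.

Let c_ge : 2^-1 <= c.
Proof.
rewrite -subr_ge0 (_ : c - 2^-1 = (4 * lam + a) / (2 * a)); last by rewrite /c; field; rewrite gt_eqF.
by rewrite divr_ge0// mulr_ge0// ltW.
Qed.

Let c0 : 0 < c. Proof. by apply: lt_le_trans c_ge; rewrite invr_gt0. Qed.

Let acE : 2 * lam + a - 1 = a * c - 1.
Proof. by rewrite /c; field; rewrite gt_eqF. Qed.

(** The variable r^a / a. It is set to 1 on the null set of nonpositive r so as to
    be positive everywhere. *)
Definition radial (r : R) := if 0 < r then r `^ a / a else 1.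

Lemma radial_gt0 r : 0 < radial r.
Proof. by rewrite /radial; case: ifPn => // r0; rewrite divr_gt0// powR_gt0. Qed.

Lemma measurable_radial : measurable_fun setT radial.
Proof.
apply: measurable_fun_ifT => //; first exact: measurable_fun_ltr.
by mfun.
Qed.

(** The substitution x = r^a / a turns r^(2 lam + a - 1) dr into a multiple of
    x^(c - 1) dx. *)
Lemma lebesgue_moment p t : 0 < c + p -> 0 < t ->
  (\int[mu]_(r in `]0%R, +oo[) ((r `^ a / a) `^ p * expR (- (t * (r `^ a / a))) * r `^ (2 * lam + a - 1))%:E =
   (a `^ (c - 1) * (sGamma (c + p) * t `^ (- (c + p))))%:E)%E.
Proof.
move=> cp t0.
pose g x := a `^ (c - 1) * (x `^ (c + p - 1) * expR (- (t * x))).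
have ai : 0 < a^-1 by rewrite invr_gt0.
have := @ge0_integral_subst_powR R g a^-1 a ai a0.
have -> : (\int[mu]_(x in `]0%R, +oo[) (g x)%:E)%E =
    (a `^ (c - 1) * (sGamma (c + p) * t `^ (- (c + p))))%:E.
  rewrite [RHS]EFinM -sGamma_integral_scale// /g.
  under eq_integral do rewrite EFinM.
  rewrite ge0_integralZl//=.
  - by mfun.
  - by move=> x _; rewrite lee_fin mulr_ge0 ?powR_ge0 ?expR_ge0.
  - by rewrite lee_fin powR_ge0.
move=> ->.
- apply: eq_integral => r; rewrite inE/= in_itv/= andbT => r0; congr EFin.
  rewrite /g mulVf ?gt_eqF// mul1r (mulrC a^-1) acE.
  have y0 : 0 < r `^ a / a by rewrite divr_gt0// powR_gt0.
  rewrite (_ : (r `^ a / a) `^ (c + p - 1) = (r `^ a / a) `^ p * (r `^ a / a) `^ (c - 1)); last first.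
    by rewrite -powRDgt0//; congr (_ `^ _); ring.
  have -> : (r `^ a / a) `^ (c - 1) = r `^ (a * (c - 1)) * a `^ (- (c - 1)).
    rewrite powRM ?powR_ge0 ?(ltW ai)// -powRrM; congr (_ * _).
    by rewrite -(powR_inv1 (ltW a0)) -powRrM mulN1r.
  have -> : r `^ (a * c - 1) = r `^ (a * (c - 1)) * r `^ (a - 1).
    by rewrite -powRDgt0//; congr (_ `^ _); ring.
  rewrite (powRN a (c - 1)); have := powR_gt0 (c - 1) a0; move: (a `^ (c - 1)) => A A0.
  by field; rewrite gt_eqF.
- move=> x x0; apply: cvgM; first exact: cvg_cst.
  apply: cvgM; first exact: powR_continuous.
  apply: (continuous_cvg _ (@continuous_expR R _)).
  by apply: cvgN; apply: cvgM; [exact: cvg_cst|exact: cvg_id].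
- by move=> x x0; rewrite !mulr_ge0 ?powR_ge0 ?expR_ge0.
Qed.

Lemma integral_itv_obnd_cbnd0 (f : R -> R) : measurable_fun setT f ->
  (\int[mu]_(r in `[0%R, +oo[) (f r)%:E = \int[mu]_(r in `]0%R, +oo[) (f r)%:E)%E.
Proof.
move=> mf; apply/esym/integral_itv_obnd_cbnd.
by apply: mfun_EFin; exact: measurable_funTS.
Qed.

Lemma nu_constE : nu_const lam a = (a `^ (c - 1) * sGamma c)^-1.
Proof.
rewrite /nu_const; congr (_^-1).
have mf : measurable_fun setT (fun t : R => expR (- (t `^ a / a)) * t `^ (2 * lam + a - 1)) by mfun.
transitivity (fine (\int[mu]_(r in `]0%R, +oo[)
    (expR (- (r `^ a / a)) * r `^ (2 * lam + a - 1))%:E)%E).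
  by congr fine; exact: integral_itv_obnd_cbnd0.
have h := @lebesgue_moment 0 1; rewrite addr0 powR1 mulr1 in h.
rewrite -[RHS]/(fine (a `^ (c - 1) * sGamma c)%:E) -h//.
by congr fine; apply: eq_integral => r _; rewrite powRr0 !mul1r.
Qed.

Lemma nu_integral (g : R -> R) : measurable_fun setT g -> (forall r, 0 <= g r) ->
  (\int[m]_r (g r)%:E =
   \int[mu]_(r in `]0%R, +oo[) (g r * (nu_const lam a * r `^ (2 * lam + a - 1)))%:E)%E.
Proof.
move=> mg g0.
have mh : measurable_fun setT (fun r : R => nu_const lam a * r `^ (2 * lam + a - 1)) by mfun.
rewrite (@ge0_integral_density _ _ _ mu m `[0%R, +oo[%classic
  (fun r => nu_const lam a * r `^ (2 * lam + a - 1)))//.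
- by rewrite integral_itv_obnd_cbnd0//; exact: mfunM.
- by move=> r; rewrite mulr_ge0 ?nu_const_ge0 ?powR_ge0.
Qed.

Lemma nu_moment p t : 0 < c + p -> 0 < t ->
  (\int[m]_r (radial r `^ p * expR (- (t * radial r)))%:E =
   (sGamma (c + p) / sGamma c * t `^ (- (c + p)))%:E)%E.
Proof.
move=> cp t0; have mX := measurable_radial.
have Gc := sGamma_gt0 c0; have A0 : 0 < a `^ (c - 1) by rewrite powR_gt0.
rewrite nu_integral; last 2 first.
- by mfun.
- by move=> r; rewrite mulr_ge0 ?powR_ge0 ?expR_ge0.
transitivity ((nu_const lam a)%:E * (\int[mu]_(r in `]0%R, +oo[) ((r `^ a / a) `^ p *
    expR (- (t * (r `^ a / a))) * r `^ (2 * lam + a - 1))%:E))%E.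
  rewrite -ge0_integralZl//=; last 3 first.
  - by mfun.
  - by move=> r _; rewrite lee_fin !mulr_ge0 ?powR_ge0 ?expR_ge0.
  - by rewrite lee_fin nu_const_ge0.
  apply: eq_integral => r; rewrite inE/= in_itv/= andbT => r0.
  by rewrite /radial r0 -EFinM; congr EFin; ring.
rewrite lebesgue_moment// -EFinM nu_constE; congr EFin.
by field; rewrite !gt_eqF.
Qed.

(** The sets where X <= n have finite measure, by Markov's inequality for the
    integrable function exp(- X). *)
Lemma nu_sigma_finite : sigma_finite setT m.
Proof.
have mX := measurable_radial.
exists (fun n : nat => [set r | radial r <= n%:R]).
  apply/esym/seteqP; split => // r _.
  exists (Num.truncn (radial r)).+1 => //=; exact: ltW (truncnS_gt _).
move=> n; have mF : measurable [set r : R | radial r <= n%:R].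
  rewrite (_ : [set r | _] = setT `&` radial @^-1` `]-oo, n%:R]).
    by apply: mX => //; exact: measurable_itv.
  by apply/seteqP; split => r /=; rewrite in_itv/=; tauto.
split => //.
pose F := [set r : R | radial r <= n%:R].
have e : (m F = \int[m]_r (\1_F r)%:E)%E by rewrite integral_indic// setIT.
rewrite -/F e; apply: (@le_lt_trans _ _ (\int[m]_r ((expR n%:R)%:E * (expR (- radial r))%:E))%E).
  apply: ge0_le_integral => //=.
  - by apply/measurable_EFinP; exact: measurable_indic.
  - by apply: measurable_funeM; mfun.
  move=> r _; rewrite -EFinM lee_fin -expRD indicE.
  case: (boolP (_ \in _)) => [|_]; last exact: expR_ge0.
  rewrite inE /F/= => h; rewrite -[leLHS]expR0 ler_expR subr_ge0; exact: h.
rewrite ge0_integralZl//=; last by mfun.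
have := @nu_moment 0 1; rewrite addr0 => h.
rewrite (_ : \int[m]_r (expR (- radial r))%:E = \int[m]_r (radial r `^ 0 * expR (- (1 * radial r)))%:E)%E.
  by rewrite h// -EFinM ltry.
by apply: eq_integral => r _; rewrite powRr0 !mul1r.
Qed.

Definition nu_sf : {sigma_finite_measure set (measurableTypeR R) -> \bar R} :=
  HB.pack_for (SigmaFiniteMeasure.type (measurableTypeR R) R) (nu lam a)
    (@Measure_isSigmaFinite.Build _ _ R (nu lam a) nu_sigma_finite).

Lemma nu_bessel_measure : bessel_measure nu_sf radial c.
Proof.
split; [exact: measurable_radial|exact: radial_gt0|exact: c_ge|exact: nu_moment].
Qed.

Lemma nu_nonpos : m [set r : R | r <= 0] = 0%E.
Proof.
rewrite /nu (_ : _ `&` _ = [set 0]); first exact: integral_set1.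
apply/seteqP; split => r /=; rewrite in_itv/= andbT.
  by move=> [r0 r1]; apply/eqP; rewrite eq_le r0.
by move=> ->.
Qed.

(** With h = (rho r)^(a/2) / a the argument is 2 h, and h^2 = X(rho) X(r): the two
    power series then agree term by term. *)
Lemma normalized_bessel_jcliff (rho r : R) : 0 < rho -> 0 < r ->
  normalized_bessel (2 * lam / a) (2 / a * (rho * r) `^ (a / 2)) =
  jcliff c (radial r * radial rho).
Proof.
move=> rho0 r0; have rr0 : 0 < rho * r by rewrite mulr_gt0.
pose h := (rho * r) `^ (a / 2) / a.
have h0 : 0 < h by rewrite divr_gt0 ?powR_gt0.
have -> : 2 / a * (rho * r) `^ (a / 2) = 2 * h by rewrite /h; ring.
have -> : radial r * radial rho = h * h.
  rewrite /radial rho0 r0 /h.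
  have e : (rho * r) `^ (a / 2) * (rho * r) `^ (a / 2) = rho `^ a * r `^ a.
    rewrite -powRDgt0// -splitr powRM//; exact: ltW.
  transitivity ((rho `^ a * r `^ a) / a / a); first by ring.
  by rewrite -e; ring.
have h20 : 0 < 2 * h by apply: mulr_gt0 => //; exact: h0.
rewrite /normalized_bessel (gt_eqF h20).
pose mm := 2 * lam / a; have cm : mm + 1 = c by [].
rewrite -/mm -sGammaE cm /jcliff /BesselJ.
have Gc := sGamma_gt0 c0.
have e (k : nat) : (-1) ^+ k / (k`!%:R * Gamma (k%:R + mm + 1)) * (2 * h / 2) `^ (2 * k%:R + mm) =
    (sGamma c)^-1 * h `^ mm * (jcoeff c k * (h * h) ^+ k).
  rewrite -sGammaE -addrA cm addrC Gamma_poch// (_ : 2 * h / 2 = h); last by field.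
  rewrite powRDgt0// powRrM powR_mulrn ?powR_ge0// -[2%R]/(2%:R) powR_mulrn ?(ltW h0)// expr2.
  rewrite /jcoeff /icoeff; have := poch_gt0 k c0; have : 0 < k`!%:R :> R by rewrite ltr0n fact_gt0.
  move: (k`!%:R) (poch c k) => F P F0 P0.
  by field; rewrite !gt_eqF.
have -> : limn (series (fun k : nat => (-1) ^+ k / (k`!%:R * Gamma (k%:R + mm + 1)) * (2 * h / 2) `^ (2 * k%:R + mm))) =
    (sGamma c)^-1 * h `^ mm * limn (pseries (jcoeff c) (h * h)).
  apply/cvg_lim => //; under [X in series X]eq_fun do rewrite e.
  rewrite (_ : series _ = fun n => (sGamma c)^-1 * h `^ mm * pseries (jcoeff c) (h * h) n).
    have hc := @jcliff_cvg _ _ c_ge (h * h).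
    apply: cvgM; first exact: cvg_cst.
    exact: hc.
  by apply/funext => n; rewrite /pseries /series/= mulr_sumr.
rewrite powRM ?(ltW h0)// !powRN.
have : 0 < h `^ mm by rewrite powR_gt0.
have : 0 < 2 `^ mm :> R by rewrite powR_gt0.
move: (h `^ mm) (2 `^ mm) => A B A0 B0.
by field; rewrite !gt_eqF.
Qed.

(** Polynomial decay of every order beats the growth of any power of 1 + X. *)
Lemma nu_integrable_decay (u : R -> R) k : measurable_fun setT u ->
  (forall n, exists M, forall x, `|x| ^+ n * `|u x| <= M) ->
  m.-integrable setT (EFin \o (fun r => if 0 < r then u r else k)).
Proof.
move=> mU bU; have mX := measurable_radial.
(* (1 + X)^(-s) is integrable for s > c. *)
pose s := c + 1.
pose n := (Num.truncn (a * s)).+1.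
have [M0 h0] := bU 0%N; have [Mn hn] := bU n.
pose w r := if 0 < r then u r else k.
have mw : measurable_fun setT w.
  by apply: measurable_fun_ifT => //; exact: measurable_fun_ltr.
pose C := (1 + a^-1) `^ s * (M0 + Mn) + `|k| * 2 `^ s.
have s0 : 0 < s by rewrite addr_gt0.
have a1 : 0 < 1 + a^-1 by rewrite addr_gt0 ?invr_gt0.
have M00 : 0 <= M0 by apply: le_trans (h0 0); rewrite mulr_ge0.
have Mn0 : 0 <= Mn by apply: le_trans (hn 0); rewrite mulr_ge0.
have C0 : 0 <= C by rewrite addr_ge0 ?mulr_ge0 ?powR_ge0 ?addr_ge0.
have bound r : `|w r| <= C * (1 + radial r) `^ (- s).
  have X1 : 0 < 1 + radial r by rewrite addr_gt0 ?radial_gt0.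
  rewrite powRN ler_pdivlMr ?powR_gt0// /w /radial.
  case: ifPn => [r0|_]; last first.
    rewrite (_ : 1 + 1 = 2)// /C ler_wpDl// mulr_ge0 ?powR_ge0 ?addr_ge0//.
  rewrite /C ler_wpDr ?mulr_ge0 ?powR_ge0//.
  have [r1|r1] := leP r 1.
    have := h0 r; rewrite expr0 mul1r => hr.
    rewrite mulrC; apply: ler_pM; rewrite ?powR_ge0//; last by rewrite ler_wpDr.
    apply: ge0_ler_powR; rewrite ?nnegrE ?(ltW s0) ?(ltW a1)//.
      by rewrite addr_ge0// divr_ge0 ?powR_ge0// ltW.
    rewrite lerD2l ler_piMl ?invr_ge0 ?(ltW a0)//.
    have <- : 1 `^ a = 1 :> R by rewrite powR1.
    by apply: ge0_ler_powR; rewrite ?nnegrE ?(ltW a0) ?(ltW r0).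
  have rn : r `^ (a * s) <= r ^+ n.
    rewrite -powR_mulrn ?(ltW r0)//; apply: ler_powR; first exact: ltW r1.
    exact: ltW (truncnS_gt _).
  have := hn r; rewrite (ger0_norm (ltW r0)) => hr.
  apply: (@le_trans _ _ (`|u r| * ((1 + a^-1) `^ s * r ^+ n))).
    apply: ler_wpM2l => //; apply: (@le_trans _ _ (((1 + a^-1) * r `^ a) `^ s)).
      apply: ge0_ler_powR; rewrite ?nnegrE ?(ltW s0)//.
      - by rewrite addr_ge0// divr_ge0 ?powR_ge0// ltW.
      - by rewrite mulr_ge0 ?powR_ge0// ltW.
      rewrite mulrDl mul1r (mulrC a^-1) lerD2r.
      by rewrite -[leLHS](powRr0 r); apply: ler_powR; [exact: ltW r1|exact: ltW].
    rewrite powRM ?powR_ge0 ?(ltW a1)// -powRrM ler_wpM2l ?powR_ge0//.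
  rewrite mulrCA ler_wpM2l ?powR_ge0// mulrC; apply: (le_trans hr).
  by rewrite lerDr.
have iX : m.-integrable setT (EFin \o (fun r => C * (1 + radial r) `^ (- s))).
  apply/integrableP; split; first by apply: mfun_EFin; mfun.
  apply: (@le_lt_trans _ _ (\int[m]_r (C%:E * ((1 + radial r) `^ (- s))%:E))%E).
    rewrite le_eqVlt; apply/orP; left; apply/eqP; apply: eq_integral => r _.
    by rewrite /= ger0_norm ?EFinM// mulr_ge0// powR_ge0.
  rewrite ge0_integralZl//=; last 2 first.
  - by mfun.
  - by move=> r _; rewrite lee_fin powR_ge0.
  have sc : c + 0 < s by rewrite addr0 ltrDl.
  have h := integral_affine_power nu_bessel_measure (lexx 0) sc.
  rewrite (_ : \int[m]_r ((1 + radial r) `^ (- s))%:E =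
     \int[m]_r (radial r `^ 0 * (1 + radial r) `^ (- s))%:E)%E; first by rewrite h -EFinM ltry.
  by apply: eq_integral => r _; rewrite powRr0 mul1r.
apply: le_integrable iX => //; first exact: mfun_EFin.
by move=> r _; rewrite /= lee_fin (le_trans (bound r))// ler_norm.
Qed.

End NuMeasure.

(** * Pitt's inequality *)

Lemma poweR_half_le (R : realType) (C : R) (A B : \bar R) : 0 <= C -> (0 <= A)%E -> (0 <= B)%E ->
  ((A `^ 2^-1 <= C%:E * B `^ 2^-1) <-> (A <= (C ^+ 2)%:E * B))%E.
Proof.
move=> C0 A0 B0.
have sqE (x : \bar R) : (0 <= x)%E -> ((x `^ 2^-1) `^ 2)%E = x.
  by move=> x0; rewrite -poweRrM mulVf// poweRe1.
have C2 : (C%:E `^ 2 = (C ^+ 2)%:E)%E by rewrite poweR_EFin powR_mulrn.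
have mono (r : R) (x y : \bar R) : 0 <= r -> (0 <= x)%E -> (0 <= y)%E -> (x <= y)%E -> (x `^ r <= y `^ r)%E.
  by move=> r0 x0 y0; apply: gt0_ler_poweR => //; rewrite in_itv/= ?x0 ?y0 leey.
have CE : (0 <= C%:E)%E by rewrite lee_fin.
split=> h.
  rewrite -(sqE _ A0) -C2 -{1}(sqE _ B0) -poweRM ?poweR_ge0//.
  by apply: mono => //; rewrite ?poweR_ge0// mule_ge0 ?poweR_ge0.
have -> : (C%:E * B `^ 2^-1 = ((C ^+ 2)%:E * B) `^ 2^-1)%E.
  rewrite poweRM//; last by rewrite lee_fin sqr_ge0.
  by rewrite -C2 -poweRrM mulfV// poweRe1.
by apply: mono => //; rewrite ?invr_ge0// mule_ge0// lee_fin sqr_ge0.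
Qed.

Section PittOnHalfline.
Context (R : realType) (lam a : R).
Hypotheses (a0 : 0 < a) (lam_ge : 0 <= 4 * lam + a).
Local Notation m := (nu_sf a0 lam_ge).
Local Notation X := (radial a).
Let c := 2 * lam / a + 1.
Let H := nu_bessel_measure a0 lam_ge.
Let mX := bm_measurable H.
Let X_gt0 := bm_gt0 H.
Let mN : measurable ([set r : R | r <= 0] : set (measurableTypeR R)).
Proof.
rewrite (_ : [set r : R | r <= 0] = `]-oo, 0]%classic); first exact: measurable_itv.
by apply/seteqP; split => r /=; rewrite in_itv.
Qed.

Lemma eq_nu_integral (f g : R -> \bar R) : (forall r, 0 < r -> f r = g r) ->
  (\int[m]_r f r = \int[m]_r g r)%E.
Proof.
move=> fg; apply: (@eq_integral_null _ _ _ m _ f g mN); first exact: nu_nonpos.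
by move=> r /= /negP; rewrite -ltNge; exact: fg.
Qed.

Lemma L2norm_nu_sqr (f : R -> R[i]%C) : L2norm_nu lam a f =
  ((\int[m]_r (complex.Re (f r) ^+ 2 + complex.Im (f r) ^+ 2)%:E) `^ 2^-1)%E.
Proof.
rewrite /L2norm_nu unlock; congr (_ `^ _)%E; apply: eq_integral => r _.
rewrite /=; case: (f r) => x y /=.
rewrite ger0_norm ?sqrtr_ge0// powR_mulrn ?sqrtr_ge0// sqr_sqrtr//.
by rewrite addr_ge0 ?sqr_ge0.
Qed.

(** Only positive arguments count, since nu does not charge the other ones. *)
Definition has_parts (f : R -> R[i]%C) (u v : R -> R) :=
  forall r, 0 < r -> u r = complex.Re (f r) /\ v r = complex.Im (f r).

Lemma hankel_has_parts (f : R -> R[i]%C) u v : has_parts f u v ->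
  has_parts (hankel lam a f) (bessel_transform m X c u) (bessel_transform m X c v).
Proof.
move=> fuv rho rho0; rewrite /hankel/=.
have key (w h : R -> R) : (forall r, 0 < r -> w r = h r) ->
    bessel_transform m X c w rho = \int[nu lam a]_(r in `[0, +oo[)
      (h r * normalized_bessel (2 * lam / a) (2 / a * (rho * r) `^ (a / 2))).
  move=> wh; congr fine; rewrite [RHS]integral_mkcond.
  apply: eq_nu_integral => r r0.
  rewrite patchE mem_set/=; last by rewrite in_itv/= andbT ltW.
  by rewrite normalized_bessel_jcliff// wh.
by split; apply: key => r /fuv[].
Qed.

Lemma radial_powR (s r : R) : 0 < r ->
  (r `^ s) ^+ 2 = a `^ (2 * s / a) * X r `^ (2 * s / a).
Proof.
move=> r0; rewrite /radial r0 -powRM ?(ltW a0) ?divr_ge0 ?powR_ge0 ?(ltW a0)//.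
rewrite mulrCA mulfV ?gt_eqF// mulr1 -powRrM -powR_mulrn ?powR_ge0// -powRrM.
by congr (_ `^ _); field; rewrite gt_eqF.
Qed.

Lemma weighted_square (f : R -> R[i]%C) (u v : R -> R) (s : R) :
  measurable_fun setT u -> measurable_fun setT v -> has_parts f u v ->
  (\int[m]_r (complex.Re ((r `^ s)%:C%C * f r) ^+ 2 + complex.Im ((r `^ s)%:C%C * f r) ^+ 2)%:E =
   (a `^ (2 * s / a))%:E * (\int[m]_r (X r `^ (2 * s / a) * u r ^+ 2)%:E +
                           \int[m]_r (X r `^ (2 * s / a) * v r ^+ 2)%:E))%E.
Proof.
move=> mu mv fuv.
pose U r := X r `^ (2 * s / a) * u r ^+ 2; pose V r := X r `^ (2 * s / a) * v r ^+ 2.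
have mU : measurable_fun setT U by rewrite /U; mfun.
have mV : measurable_fun setT V by rewrite /V; mfun.
have U0 r : 0 <= U r by apply: mulr_ge0; [exact: powR_ge0|exact: sqr_ge0].
have V0 r : 0 <= V r by apply: mulr_ge0; [exact: powR_ge0|exact: sqr_ge0].
transitivity (\int[m]_r ((a `^ (2 * s / a))%:E * ((U r)%:E + (V r)%:E)))%E.
  apply: eq_nu_integral => r r0; rewrite -EFinD -EFinM; congr EFin.
  have [uE vE] := fuv r r0; have e := radial_powR s r0.
  move: uE vE; case: (f r) => x y /= uE vE.
  rewrite !mul0r subr0 addr0 !exprMn e /U /V uE vE; ring.
rewrite (@ge0_integralZl _ _ _ m setT measurableT (fun r => (U r)%:E + (V r)%:E)%E).
- rewrite (@ge0_integralD _ _ _ m setT measurableT (EFin \o U) (EFin \o V))//.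
  + by move=> r _; rewrite /= lee_fin.
  + exact: mfun_EFin.
  + by move=> r _; rewrite /= lee_fin.
  + exact: mfun_EFin.
- by apply: emeasurable_funD; exact: mfun_EFin.
- by move=> r _; rewrite adde_ge0// lee_fin.
- by rewrite lee_fin powR_ge0.
Qed.

Variable beta : R.
Let b := beta / a.

Local Notation lhs u := (\int[m]_y (X y `^ (- (2 * b)) * bessel_transform m X c u y ^+ 2)%:E)%E.
Local Notation rhs u := (\int[m]_x (X x `^ (2 * b) * u x ^+ 2)%:E)%E.

(** The weights rho^(-beta) = (a X)^(-b) and r^beta = (a X)^b contribute the powers
    of a. *)
Lemma pitt_ineqE (f : R -> R[i]%C) (u v : R -> R) (C : R) : 0 <= C ->
  m.-integrable setT (EFin \o u) -> m.-integrable setT (EFin \o v) -> has_parts f u v ->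
  (pitt_ineq beta lam a C f <->
   ((lhs u + lhs v) <= (C ^+ 2 * (a `^ (2 * b)) ^+ 2)%:E * (rhs u + rhs v))%E).
Proof.
move=> C0 iu iv fuv.
have mu : measurable_fun setT u by apply/measurable_EFinP; exact: measurable_int iu.
have mv : measurable_fun setT v by apply/measurable_EFinP; exact: measurable_int iv.
have q0 : 0 < a `^ (2 * b) by rewrite powR_gt0.
rewrite /pitt_ineq !L2norm_nu_sqr poweR_half_le//; last 2 first.
- by apply: integral_ge0 => r _; rewrite lee_fin addr_ge0 ?sqr_ge0.
- by apply: integral_ge0 => r _; rewrite lee_fin addr_ge0 ?sqr_ge0.
rewrite (weighted_square _ mu mv fuv) (weighted_square _ _ _ (hankel_has_parts fuv)); last 2 first.
- exact: (measurable_bessel_transform H iu).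
- exact: (measurable_bessel_transform H iv).
rewrite (_ : 2 * beta / a = 2 * b); last by rewrite /b mulrA.
rewrite (_ : 2 * (- beta) / a = - (2 * b)); last by rewrite /b; field; rewrite gt_eqF.
rewrite powRN; move: (lhs u + lhs v)%E (rhs u + rhs v)%E => A B.
rewrite muleA -EFinM.
have -> : (C ^+ 2 * (a `^ (2 * b)) ^+ 2)%:E = ((a `^ (2 * b))%:E * (C ^+ 2 * a `^ (2 * b))%:E)%E.
  by rewrite -EFinM; congr EFin; ring.
by rewrite -muleA lee_pdivrMl.
Qed.

Lemma schwartz_parts (f : R -> R[i]%C) : schwartz_halfline f -> exists u v,
  [/\ m.-integrable setT (EFin \o u), m.-integrable setT (EFin \o v) & has_parts f u v].
Proof.
move=> [g [sRe sIm bg] fg].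
have smooth_measurable (h : R -> R) : smooth h -> measurable_fun setT h.
  move=> sh; apply: continuous_measurable_fun => x.
  have := sh 0%N x; rewrite derive1n0 => /derivable1_diffP; exact: differentiable_continuous.
have normRe (z : R[i]%C) : `|complex.Re z| <= Normc.normc z.
  case: z => x y /=; rewrite -sqrtr_sqr; apply: ler_wsqrtr.
  by rewrite lerDl sqr_ge0.
have normIm (z : R[i]%C) : `|complex.Im z| <= Normc.normc z.
  case: z => x y /=; rewrite -sqrtr_sqr; apply: ler_wsqrtr.
  by rewrite lerDr sqr_ge0.
have c0 x : cderiven 0 g x = g x by rewrite /cderiven !derive1n0; case: (g x).
exists (fun r => if 0 < r then complex.Re (g r) else 0).
exists (fun r => if 0 < r then complex.Im (g r) else 0).
split.
- apply: (nu_integrable_decay a0 lam_ge 0 (smooth_measurable _ sRe)) => n.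
  have [M hM] := bg n 0%N; exists M => x; apply: le_trans (hM x).
  by rewrite c0 ler_wpM2l// exprn_ge0.
- apply: (nu_integrable_decay a0 lam_ge 0 (smooth_measurable _ sIm)) => n.
  have [M hM] := bg n 0%N; exists M => x; apply: le_trans (hM x).
  by rewrite c0 ler_wpM2l// exprn_ge0.
by move=> r r0; rewrite r0 fg ?ltW.
Qed.

Lemma pitt_test_profile_anti (p y z : R) : 0 <= p -> 0 < y -> y <= z ->
  z `^ (- p) * expR (- (2^-1 * z)) <= y `^ (- p) * expR (- (2^-1 * y)).
Proof.
move=> p0 y0 yz; have z0 := lt_le_trans y0 yz.
apply: ler_pM; rewrite ?powR_ge0 ?expR_ge0//.
  rewrite !powRN lef_pV2 ?posrE ?powR_gt0//.
  by apply: ge0_ler_powR; rewrite ?nnegrE ?(ltW y0) ?(ltW z0).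
by rewrite ler_expR lerN2 ler_wpM2l.
Qed.

Definition reg_radial (n : nat) (r : R) := reg_base n.+1%:R^-1 r `^ (a / 2) / a.
Definition reg_test p n r := reg_radial n r `^ (- p) * expR (- (2^-1 * reg_radial n r)).

(** The base r^2 + 1/n decreases to r^2, and x^(-p) exp(- x / 2) is decreasing in
    x, so the functions increase to the test function. *)
Lemma reg_test_sequence p : 0 < p ->
  test_sequence m X p (fun n r => if 0 < r then reg_test p n r else pitt_test X p r).
Proof.
move=> p0; have eps0 n : 0 < n.+1%:R^-1 :> R by rewrite invr_gt0.
have a2 : 0 <= a / 2 by rewrite divr_ge0// ltW.
have sq (r : R) : 0 < r -> (r ^+ 2) `^ (a / 2) = r `^ a.
  by move=> r0; rewrite -powR_mulrn ?(ltW r0)// -powRrM; congr (_ `^ _); field.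
have reg_gt0 n r : 0 < reg_radial n r.
  by rewrite divr_gt0// powR_gt0// reg_base_gt0.
have Xle n r : 0 < r -> X r <= reg_radial n r.
  move=> r0; rewrite /radial r0 /reg_radial ler_wpM2r ?invr_ge0 ?(ltW a0)// -sq//.
  apply: ge0_ler_powR; rewrite ?nnegrE ?sqr_ge0 ?(ltW (reg_base_gt0 _ _))//.
  by rewrite /reg_base lerDr ltW.
have nd n k r : (n <= k)%N -> reg_radial k r <= reg_radial n r.
  move=> nk; rewrite /reg_radial ler_wpM2r ?invr_ge0 ?(ltW a0)//.
  apply: ge0_ler_powR; rewrite ?nnegrE ?(ltW (reg_base_gt0 _ _))//.
  by rewrite /reg_base lerD2r lef_pV2 ?posrE// ler_nat.
split.
- move=> n; have sp := reg_span_test n.+1%:R^-1 a0 p.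
  have sm := (reg_span_smooth a0 (eps0 n) sp).
  have mt : measurable_fun setT (reg_test p n).
    apply: continuous_measurable_fun => x.
    have := sm 0%N x; rewrite derive1n0 => /derivable1_diffP; exact: differentiable_continuous.
  have := nu_integrable_decay a0 lam_ge (expR (- 2^-1)) mt
    (fun k => reg_span_bounded a0 (eps0 n) k sp).
  congr (_.-integrable _ _); apply/funext => r; congr EFin.
  case: ifPn => // r0; rewrite /pitt_test /radial (negbTE r0) powR1 mul1r mulr1 //.
- move=> n r; case: ifPn => r0; last first.
    by rewrite lexx andbT mulr_ge0 ?powR_ge0 ?expR_ge0.
  rewrite mulr_ge0 ?powR_ge0 ?expR_ge0//=.
  by apply: pitt_test_profile_anti; [exact: ltW|exact: X_gt0|exact: Xle].
- move=> r n k nk; case: ifPn => // r0.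
  by apply: pitt_test_profile_anti; [exact: ltW|exact: reg_gt0|exact: nd].
move=> r; have [r0|_] := ltP 0 r; last exact: cvg_cst.
have rc : reg_radial n r @[n --> \oo] --> X r.
  rewrite /radial r0; apply: cvgM; last exact: cvg_cst.
  have r2 : 0 < r ^+ 2 by exact: exprn_gt0.
  rewrite -sq//; apply: (continuous_cvg _ (@powR_continuous R (a / 2) (r ^+ 2) r2)).
  rewrite -[X in _ --> X]add0r; apply: cvgD; last exact: cvg_cst.
  exact: cvg_harmonic.
apply: cvgM.
  by apply: (continuous_cvg _ (@powR_continuous R (- p) (X r) (X_gt0 r))).
apply: (continuous_cvg _ (@continuous_expR R _)).
by apply: cvgN; apply: cvgM => //; exact: cvg_cst.
Qed.

Lemma schwartz_reg_test p n : schwartz_halfline (fun x => (reg_test p n x)%:C%C).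
Proof.
have eps0 : 0 < n.+1%:R^-1 :> R by rewrite invr_gt0.
exists (fun x => (reg_test p n x)%:C%C) => //.
exact: schwartz_reg_span a0 eps0 _ (reg_span_test _ a0 p).
Qed.

Hypotheses (beta_ge0 : 0 <= beta) (beta_lt : beta < lam + a / 2).
Let b0 : 0 <= b. Proof. by rewrite divr_ge0// ltW. Qed.
Let bc : b < c / 2.
Proof.
rewrite /b ltr_pdivrMr// (_ : c / 2 * a = lam + a / 2)//.
by rewrite /c; field; rewrite gt_eqF.
Qed.
Let g1 : 0 < sGamma (c / 2 - b). Proof. by apply: sGamma_gt0; rewrite subr_gt0. Qed.
Let g2 : 0 < sGamma (c / 2 + b).
Proof. by apply: sGamma_gt0; move: b0 bc; lra. Qed.

Lemma pitt_constE : pitt_const beta lam a =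
  (a `^ (2 * b))^-1 * (sGamma (c / 2 - b) / sGamma (c / 2 + b)).
Proof.
rewrite /pitt_const powRN !sGammaE; congr (_^-1 * (Gamma _ / Gamma _)).
- by congr (_ `^ _); rewrite /b mulrA.
- by rewrite /c /b; field; rewrite gt_eqF.
- by rewrite /c /b; field; rewrite gt_eqF.
Qed.

Lemma pitt_const_gt0 : 0 < pitt_const beta lam a.
Proof. by rewrite pitt_constE mulr_gt0 ?invr_gt0 ?powR_gt0// divr_gt0. Qed.

Lemma pitt_holds (f : R -> R[i]%C) : schwartz_halfline f ->
  pitt_ineq beta lam a (pitt_const beta lam a) f.
Proof.
move=> /schwartz_parts[u [v [iu iv fuv]]].
apply/(pitt_ineqE (ltW pitt_const_gt0) iu iv fuv).
have -> : pitt_const beta lam a ^+ 2 * (a `^ (2 * b)) ^+ 2 =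
    (sGamma (c / 2 - b) / sGamma (c / 2 + b)) ^+ 2.
  rewrite pitt_constE -exprMn; congr (_ ^+ 2); rewrite mulrAC mulVf ?mul1r//.
  by rewrite gt_eqF// powR_gt0.
rewrite ge0_muleDr; last 2 first.
- by apply: integral_ge0 => r _; rewrite lee_fin mulr_ge0 ?powR_ge0 ?sqr_ge0.
- by apply: integral_ge0 => r _; rewrite lee_fin mulr_ge0 ?powR_ge0 ?sqr_ge0.
by apply: leeD; apply: (pitt_upper H).
Qed.

Lemma pitt_sharp (C : R) : (forall f : R -> R[i]%C, schwartz_halfline f ->
  pitt_ineq beta lam a C f) -> pitt_const beta lam a <= C.
Proof.
(* Squaring norms requires a nonnegative constant; as the claimed constant is
   positive, replacing C by max(C, 0) loses nothing. *)
move=> hC; pose C' := Num.max C 0.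
have C'0 : 0 <= C' by rewrite le_max lexx orbT.
have q0 : 0 < a `^ (2 * b) by rewrite powR_gt0.
have iz : m.-integrable setT (EFin \o (fun=> 0 : R)) by exact: integrable0.
have lower : (sGamma (c / 2 - b) / sGamma (c / 2 + b)) ^+ 2 <= C' ^+ 2 * (a `^ (2 * b)) ^+ 2.
  apply: (pitt_lower H) => //; first by rewrite mulr_ge0 ?sqr_ge0.
  move=> p p0 _; have ts := reg_test_sequence p0; eexists; first exact: ts.
  move=> n; have [it _ _ _] := ts.
  pose f x := (reg_test p n x)%:C%C.
  have fuv : has_parts f (fun r => if 0 < r then reg_test p n r else pitt_test X p r) (fun=> 0).
    by move=> r r0; rewrite r0.
  have := pitt_ineqE C'0 (it n) iz fuv => -[h _].
  have {}h := h _.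
  have l0 : lhs (fun=> 0) = 0%E.
    transitivity (\int[m]_y (cst 0%E y))%E; last exact: integral0.
    apply: eq_integral => y _ /=; congr EFin.
    rewrite (_ : bessel_transform m X c (fun=> 0) y = 0) ?expr0n ?mulr0//.
    rewrite /bessel_transform; under eq_Rintegral do rewrite mul0r.
    by rewrite /Rintegral integral0.
  have r0 : rhs (fun=> 0) = 0%E.
    transitivity (\int[m]_y (cst 0%E y))%E; last exact: integral0.
    by apply: eq_integral => y _ /=; congr EFin; rewrite expr0n mulr0.
  rewrite l0 r0 !adde0 in h; apply: h.
  apply: le_trans (hC _ (schwartz_reg_test p n)) _.
  apply: lee_wpmul2r; first exact: Lnorm_ge0.
  by rewrite lee_fin le_max lexx.
have le1 : pitt_const beta lam a <= C'.
  rewrite pitt_constE ler_pdivrMl//.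
  rewrite -ler_sqr ?nnegrE; [|by rewrite divr_ge0// ltW|by rewrite mulr_ge0// ltW].
  by rewrite [leRHS]exprMn [leRHS]mulrC.
move: le1; rewrite /C' le_max => /orP[//|].
by rewrite leNgt pitt_const_gt0.
Qed.

End PittOnHalfline.

Theorem theorem2p2 (R : realType) (a lam beta : R)
    (a_gt0 : 0 < a) (lam_ge : 0 <= 4 * lam + a)
    (beta_ge0 : 0 <= beta) (beta_lt : beta < lam + a / 2) :
  (forall f : R -> complex R, schwartz_halfline f ->
     pitt_ineq beta lam a (pitt_const beta lam a) f) /\
  (forall C : R,
     (forall f : R -> complex R, schwartz_halfline f ->
        pitt_ineq beta lam a C f) ->
     pitt_const beta lam a <= C).
Proof. split; [exact: pitt_holds|exact: pitt_sharp]. Qed.
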